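(* For all $\lambda>0$, $N_{\mathrm{disk}}(\lambda)\le N_D(\lambda)$.
   Context: $N_{\mathrm{disk}}(\lambda)$ is the number (counted with multiplicity) of eigenvalues of the Dirichlet Laplacian on the unit disk in $\mathbb R^2$ which are less than or equal to $\lambda^2$. By separation of variables these eigenvalues are the squares of the positive zeroes of the Bessel functions $J_{|n|}(z)$, $n\in\mathbb Z$, so $N_{\mathrm{disk}}(\lambda)=\sum_{n\in\mathbb Z}\#\{\text{zeroes of }J_{|n|}\text{ in }(0,\lambda]\}$. $D:=\{(x,y)\in\mathbb R^2 : -1\le x\le1,\ \max(0,-x)\le y\le\frac1\pi(\sqrt{1-x^2}-x\arccos x)\}$, and $N_D(\lambda):=\#\{(n,k)\in\mathbb Z^2 : (n,k-\tfrac14)\in\lambda D\}$. *)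

(* Defs.v *)
From mathcomp Require Import all_boot all_order all_algebra.
From mathcomp Require Import all_classical all_reals all_analysis.
Import Order.TTheory GRing.Theory Num.Theory.
Import numFieldNormedType.Exports.

Set Implicit Arguments.
Unset Strict Implicit.
Unset Printing Implicit Defensive.

Local Open Scope classical_set_scope.
Local Open Scope ring_scope.

Section DirichletDisk.
Variable R : realType.
Implicit Types (u : R * R -> R) (mu lambda : R).

Definition open_disk : set (R * R) := [set p | p.1 ^+ 2 + p.2 ^+ 2 < 1].
Definition closed_disk : set (R * R) := [set p | p.1 ^+ 2 + p.2 ^+ 2 <= 1].
Definition unit_circle : set (R * R) := [set p | p.1 ^+ 2 + p.2 ^+ 2 = 1].

Definition dirx : R * R := (1, 0).
Definition diry : R * R := (0, 1).

(* Only meaningful for an open set Om. *)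
Fixpoint Ck (k : nat) (Om : set (R * R)) (u : R * R -> R) : Prop :=
  (forall p, Om p -> {for p, continuous u}) /\
  match k with
  | 0%N => True
  | k'.+1 =>
      (forall p, Om p -> derivable u p dirx /\ derivable u p diry) /\
      Ck k' Om (fun p => 'D_dirx u p) /\ Ck k' Om (fun p => 'D_diry u p)
  end.

Definition laplacian u (p : R * R) : R :=
  'D_dirx (fun q => 'D_dirx u q) p + 'D_diry (fun q => 'D_diry u q) p.

(* Classical solutions of - Delta u = mu u in the disk, u = 0 on the circle,
   the zero solution included.  Since u is a total function, its values outside
   the closed disk are irrelevant; below, vanishing and linear independence are
   therefore always tested on the open disk (equivalently, by continuity, on
   the closed one). *)
Definition dirichlet_eigenspace mu : set (R * R -> R) :=
  [set u | [/\ {within closed_disk, continuous u},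
               Ck 2 open_disk u,
               forall p, open_disk p -> - laplacian u p = mu * u p &
               forall p, unit_circle p -> u p = 0]].

Definition dirichlet_eigenvalue mu : Prop :=
  exists2 u, dirichlet_eigenspace mu u & exists2 p, open_disk p & u p != 0.

Definition lin_indep_on_disk (m : nat) (u : 'I_m -> R * R -> R) : Prop :=
  forall c : 'I_m -> R,
    (forall p, open_disk p -> \sum_(i < m) c i * u i p = 0) ->
    forall i, c i = 0.

(* The dimension of the eigenspace, +oo if it is infinite-dimensional. *)
Definition multiplicity mu : \bar R :=
  ereal_sup [set m%:R%:E | m in [set m : nat |
    exists2 u : 'I_m -> R * R -> R,
      (forall i, dirichlet_eigenspace mu (u i)) & lin_indep_on_disk u]].

Definition N_disk lambda : \bar R :=
  \esum_(mu in [set mu | dirichlet_eigenvalue mu /\ mu <= lambda ^+ 2])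
    multiplicity mu.

Definition domD : set (R * R) :=
  [set p | -1 <= p.1 <= 1 /\
     Num.max 0 (- p.1) <= p.2 <=
       pi^-1 * (Num.sqrt (1 - p.1 ^+ 2) - p.1 * acos p.1)].

Definition dilate lambda (A : set (R * R)) : set (R * R) :=
  [set lambda *: p | p in A].

Definition N_D lambda : \bar R :=
  counting [set nk : int * int |
    dilate lambda domD (nk.1%:~R, nk.2%:~R - 4^-1)].

End DirichletDisk.

(* Main.v *)
(* Write an eigenfunction u in polar coordinates.  Its n-th cosine and sine
   coefficients are bounded solutions of Bessel's equation on (0, 1) vanishing at
   1, hence multiples of J_n (sqrt mu r), and they all vanish unless
   J_n (sqrt mu) = 0; by completeness of the trigonometric system the multiplicity
   of mu is at most the number of n in Z with J_|n| (sqrt mu) = 0.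

   It remains to see that if J_n has k zeros in (0, X], then n < X and
   phi_n (X) >= pi (k - 1/4), where
   phi_n (x) = sqrt (x^2 - n^2) - n acos (n / x).
   By Sturm comparison with (phi_n')^(-1/2) sin phi_n, the value of phi_n
   increases by at most pi from one zero to the next, so it suffices to have the
   inequality for large zeros up to an error tending to 0.  There, the Fresnel
   asymptotics of Poisson's integral put the zeros near pi (j + n / 2 - 1 / 4)
   with j an integer, and j is identified by a comparison for n = 0 and by
   Rolle's theorem for the passage from n to n + 1. *)

Require Import Defs.
From mathcomp Require Import all_boot all_order all_algebra.
From mathcomp Require Import all_classical all_reals all_analysis.
From mathcomp Require Import ring lra zify.
Import Order.TTheory GRing.Theory Num.Theory.
Import numFieldNormedType.Exports.
Set Implicit Arguments.
Unset Strict Implicit.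
Unset Printing Implicit Defensive.
Local Open Scope classical_set_scope.
Local Open Scope ring_scope.

(** * Integrals of continuous functions *)

(** The link with [domD]: [phiJ n lambda / (pi * lambda)] is the height of its upper boundary at x =
    n / lambda, so k zeros of J_n up to lambda yield the lattice points (n, 1), ..., (n, k). Since
    acos (- x) = pi - acos x, the fibre over - n is the fibre over n raised by n, which accommodates
    the sine modes. The comparison phase is accurate only at infinity, so the phase bound is proved
    backwards: a given list of zeros is continued to a very large one, where count and phase agree
    up to e, and every added zero costs at most pi of phase. Asymptotics alone determine the large
    zeros modulo pi only; a rough lower bound with an error less than pi selects the right j, and 3
    pi / 4 is the error that the passage from n to n + 1 leaves. Poisson's integral stands for J_n
    because derivative, recurrence, positivity near 0 and asymptotics all come from it by
    integration by parts. Boundedness at the origin excludes the second solution of Bessel's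
    equation through a logarithmic divergence. Zeros are handled as arbitrary finite increasing
    lists, and eigenvalues as finite sets. *)

Section Integral.
Variable R : realType.
Implicit Types (f g F : R -> R) (a b c k x M : R).

Definition Int a b f : R := \int[lebesgue_measure]_(x in `[a, b]) f x.

Lemma integrable_cont a b f : continuous f ->
  lebesgue_measure.-integrable `[a, b] (EFin \o f).
Proof.
move=> cf; apply: continuous_compact_integrable; first exact: segment_compact.
exact: continuous_subspaceT.
Qed.

Lemma Int_ext a b f g : (forall x, a <= x <= b -> f x = g x) ->
  Int a b f = Int a b g.
Proof. by move=> h; apply: eq_Rintegral => x; rewrite inE /= in_itv/=; exact: h. Qed.

Lemma IntD a b f g : continuous f -> continuous g ->
  Int a b (fun x => f x + g x) = Int a b f + Int a b g.
Proof. by move=> cf cg; apply: RintegralD => //; exact: integrable_cont. Qed.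

Lemma IntZ a b k f : continuous f -> Int a b (fun x => k * f x) = k * Int a b f.
Proof. by move=> cf; apply: RintegralZl => //; exact: integrable_cont. Qed.

Lemma IntN a b f : continuous f -> Int a b (fun x => - f x) = - Int a b f.
Proof. by move=> cf; rewrite -mulN1r -IntZ//; apply: Int_ext => x _; rewrite mulN1r. Qed.

Lemma IntB a b f g : continuous f -> continuous g ->
  Int a b (fun x => f x - g x) = Int a b f - Int a b g.
Proof. by move=> cf cg; apply: RintegralB => //; exact: integrable_cont. Qed.

Lemma Int_le a b f g : continuous f -> continuous g ->
  (forall x, a <= x <= b -> f x <= g x) -> Int a b f <= Int a b g.
Proof.
move=> cf cg h; apply: le_Rintegral => //; try exact: integrable_cont.
Qed.

Lemma Int_cst a b k : a <= b -> Int a b (cst k) = k * (b - a).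
Proof.
move=> ab; rewrite /Int Rintegral_cst//; congr (_ * _).
transitivity (fine (if a%:E < b%:E then b%:E - a%:E else 0)%E).
  by congr fine; exact: (lebesgue_measure_itv `[a, b]).
by move: ab; rewrite lte_fin le_eqVlt => /predU1P[->|->//]; rewrite ltxx subrr.
Qed.

Lemma Int_norm_le a b f (M : R) : a <= b -> continuous f ->
  (forall x, a <= x <= b -> `|f x| <= M) -> `|Int a b f| <= M * (b - a).
Proof.
move=> ab cf h; rewrite ler_norml -mulNr -!Int_cst//.
have cc k : continuous (cst k : R -> R) by move=> x; exact: cvg_cst.
by apply/andP; split; apply: Int_le => // x /h; rewrite ler_norml => /andP[].
Qed.

Lemma continuous_primitive c f : continuous f ->
  exists F, forall x, c < x -> is_derive x 1 F (f x).
Proof.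
move=> cf; exists (fun x => Int c x f) => x cx.
have [||||d1 d2] := @continuous_FTC1 R f (BLeft c) x (x + 1).
- by rewrite ltrDl.
- exact: integrable_cont.
- by [].
- exact: cf.
by apply: DeriveDef; [exact: d1 | rewrite -derive1E; exact: d2].
Qed.

Lemma Int_FTC a b f F : a <= b -> continuous f ->
  (forall x, a <= x <= b -> is_derive x 1 F (f x)) -> Int a b f = F b - F a.
Proof.
rewrite le_eqVlt => /predU1P[->|ab] cf dF.
  by rewrite /Int subrr set_itv1 Rintegral_set1.
rewrite /Int /Rintegral (@continuous_FTC2 _ f F a b)//.
- exact: continuous_subspaceT.
- have cF x : a <= x <= b -> {for x, continuous F}.
    move=> /dF dFx; apply: differentiable_continuous.
    by apply/derivable1_diffP; case: dFx.
  split.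
  + move=> x; rewrite in_itv/= => /andP[h1 h2].
    by case: (dF x) => //; rewrite !ltW.
  + by apply: cvg_at_right_filter; apply: cF; rewrite lexx ltW.
  + by apply: cvg_at_left_filter; apply: cF; rewrite lexx ltW.
- move=> x; rewrite in_itv/= => /andP[h1 h2].
  by rewrite derive1E; case: (dF x) => //; rewrite !ltW.
Qed.

Lemma Int_cat a b c f : a <= b -> b <= c -> continuous f ->
  Int a c f = Int a b f + Int b c f.
Proof.
(* The primitive is differentiable only to the right of its base point; starting at a - 1 makes a
   itself admissible. *)
move=> ab bc cf; have [F dF] := continuous_primitive (a - 1) cf.
have dF' x : a <= x -> is_derive x 1 F (f x).
  by move=> ax; apply: dF; rewrite ltrBlDr (le_lt_trans ax)// ltrDl.
have FTC p q : a <= p -> p <= q -> Int p q f = F q - F p.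
  move=> ap pq; apply: Int_FTC => // x /andP[px _].
  exact/dF'/(le_trans ap).
rewrite FTC// ?(le_trans ab)// FTC// FTC//; ring.
Qed.

Lemma Int_ge0 a b f : (forall x, a <= x <= b -> 0 <= f x) -> 0 <= Int a b f.
Proof. by move=> h; apply: Rintegral_ge0 => x; rewrite /= in_itv/=; exact: h. Qed.

Lemma Int_gt0 a b c f : a < c < b -> continuous f ->
  (forall x, a <= x <= b -> 0 <= f x) -> 0 < f c -> 0 < Int a b f.
Proof.
move=> /andP[ac cb] cf f0 fc.
have [e /= e0 he] : \forall e \near 0^'+, a <= c - e /\ c + e <= b /\
    forall x, `|c - x| <= e -> f c / 2 <= f x.
  have /cvgrPdist_le /(_ (f c / 2)) : f @ c --> f c by exact: cf.
  rewrite divr_gt0// => /(_ erefl) /nbhs_ballP[e /= e0 he].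
  near=> d; have d0 : 0 < d by [].
  split; [|split].
  - suff : d <= c - a by move=> ?; lra.
    by near: d; apply: nbhs_right_le; rewrite subr_gt0.
  - suff : d <= b - c by move=> ?; lra.
    by near: d; apply: nbhs_right_le; rewrite subr_gt0.
  move=> x xd; have : `|f c - f x| <= f c / 2.
    apply: he; rewrite /ball/= (le_lt_trans xd)//.
  by rewrite ler_norml => /andP[]; lra.
have [//||h1 [h2 h3]] := he (e / 2); first by rewrite /= sub0r normrN gtr0_norm; lra.
  lra.
have : Int (c - e / 2) (c + e / 2) (cst (f c / 2)) <=
       Int (c - e / 2) (c + e / 2) f.
  apply: Int_le => //; first by move=> x; exact: cvg_cst.
  move=> x /andP[x1 x2]; apply: h3; rewrite ler_norml; lra.
rewrite Int_cst; last lra.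
rewrite (Int_cat h1 (c := b))//; last lra.
rewrite (Int_cat _ h2)//; last lra.
have := Int_ge0 (a := a) (b := c - e / 2) (f := f).
have := Int_ge0 (a := c + e / 2) (b := b) (f := f).
move=> i1 i2 i3.
have j1 : 0 <= Int (c + e / 2) b f by apply: i1 => x /andP[? ?]; apply: f0; lra.
have j2 : 0 <= Int a (c - e / 2) f by apply: i2 => x /andP[? ?]; apply: f0; lra.
have : 0 < f c / 2 * (c + e / 2 - (c - e / 2)) by apply: mulr_gt0; lra.
lra.
Unshelve. all: by end_near. Qed.

Lemma Int_derive a b u v (f df : R -> R -> R) x M : a <= b -> u < x < v ->
  (forall y, u < y < v -> continuous (f y)) ->
  (forall y t, u < y < v -> a <= t <= b -> is_derive y 1 (f ^~ t) (df y t)) ->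
  (forall y t, u < y < v -> a <= t <= b -> `|df y t| <= M) ->
  is_derive x 1 (fun y => Int a b (f y)) (Int a b (df x)).
Proof.
move=> ab uxv cf dfd dfM.
have M0 : 0 <= M by apply: le_trans (dfM x a uxv _) => //; rewrite lexx.
have I1 : `]u, v[%classic x by rewrite /= in_itv.
have I2 y : `]u, v[%classic y ->
    (@lebesgue_measure R).-integrable `[a, b] (EFin \o f y).
  by rewrite /= in_itv/= => h; apply: integrable_cont; exact: cf.
have I3 y t : `]u, v[%classic y -> `[a, b]%classic t -> derivable (f ^~ t) y 1.
  by rewrite /= !in_itv/= => h1 h2; case: (dfd y t h1 h2).
have P y t : u < y < v -> a <= t <= b -> partial1of2 f y t = df y t.
  by move=> h1 h2; rewrite partial1of2E; case: (dfd y t h1 h2).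
have I4 : (@lebesgue_measure R).-integrable `[a, b] (EFin \o cst M).
  by apply: integrable_cont => y; exact: cvg_cst.
have I5 y t : `]u, v[%classic y -> `[a, b]%classic t ->
    `|partial1of2 f y t| <= cst M t.
  by rewrite /= !in_itv/= => h1 h2; rewrite P//; exact: dfM.
have mB : measurable (`[a, b]%classic : set (measurableTypeR R)) by [].
apply: DeriveDef; first exact: (derivable_under_integral mB I1 I2 I3 _ I4 I5).
rewrite -derive1E (differentiation_under_integral mB I1 I2 I3 _ I4 I5)//.
by apply: Int_ext => t h; exact: P.
Qed.
End Integral.

(** * Derivatives *)

Section Calculus.
Variable R : realType.
Implicit Types (f g : R -> R) (a b x k d df dg : R).

Lemma der_eq f x d d' : is_derive x 1 f d -> d = d' -> is_derive x 1 f d'.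
Proof. by move=> ? <-. Qed.

Lemma der_id x : is_derive x 1 (fun y : R => y) 1.
Proof. exact: is_derive_id. Qed.

Lemma der_cst x k : is_derive x 1 (fun _ : R => k) 0.
Proof. exact: is_derive_cst. Qed.

Lemma derD f g x df dg : is_derive x 1 f df -> is_derive x 1 g dg ->
  is_derive x 1 (fun y => f y + g y) (df + dg).
Proof. by move=> h1 h2; exact: (is_deriveD h1 h2). Qed.

Lemma derN f x df : is_derive x 1 f df -> is_derive x 1 (fun y => - f y) (- df).
Proof. by move=> h; exact: (is_deriveN h). Qed.

Lemma derM f g x df dg : is_derive x 1 f df -> is_derive x 1 g dg ->
  is_derive x 1 (fun y => f y * g y) (df * g x + f x * dg).
Proof.
move=> h1 h2; apply: der_eq (is_deriveM h1 h2) _.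
by rewrite /GRing.scale/= addrC mulrC [X in _ + X]mulrC mulrC [g x * _]mulrC.
Qed.

Lemma derX f x df n : is_derive x 1 f df ->
  is_derive x 1 (fun y => f y ^+ n) (n%:R * f x ^+ n.-1 * df).
Proof.
move=> h; elim: n => [|n IH]; first by rewrite !mul0r; exact: der_cst.
have -> : (fun y => f y ^+ n.+1) = (fun y => f y * f y ^+ n).
  by apply/funext => y; rewrite exprS.
apply: der_eq (derM h IH) _ => /=.
case: n {IH} => [|n] /=; last by rewrite -[n.+2]addn1 natrD exprS; ring.
by rewrite !expr0; ring.
Qed.

Lemma der_comp g f x df dg : is_derive x 1 f df -> is_derive (f x) 1 g dg ->
  is_derive x 1 (fun y => g (f y)) (dg * df).
Proof.
move=> h1 h2; apply: der_eq (@is_derive1_comp _ g f x dg df h2 h1) _.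
by rewrite /GRing.scale/=.
Qed.

Lemma derV f x df : f x != 0 -> is_derive x 1 f df ->
  is_derive x 1 (fun y => (f y)^-1) (- df / f x ^+ 2).
Proof.
move=> fx h; apply: der_eq (is_deriveV fx h) _.
by rewrite /GRing.scale/=; field.
Qed.

Lemma der_cos f x df : is_derive x 1 f df ->
  is_derive x 1 (fun y => cos (f y)) (- sin (f x) * df).
Proof. by move=> h; exact: der_comp h (is_derive_cos _). Qed.

Lemma der_sin f x df : is_derive x 1 f df ->
  is_derive x 1 (fun y => sin (f y)) (cos (f x) * df).
Proof. by move=> h; exact: der_comp h (is_derive_sin _). Qed.

Lemma der_cont f x df : is_derive x 1 f df -> {for x, continuous f}.
Proof.
by move=> [h _]; apply: differentiable_continuous; apply/derivable1_diffP.
Qed.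

Lemma der_MVT a b f (df : R -> R) : a < b ->
  (forall x, a <= x <= b -> is_derive x 1 f (df x)) ->
  exists2 c, a < c < b & f b - f a = df c * (b - a).
Proof.
move=> ab dF; case: (@MVT _ f df a b ab) => [x||c].
- by rewrite in_itv/= => /andP[? ?]; apply: dF; rewrite !ltW.
- apply: derivable_within_continuous => x; rewrite in_itv/= => h.
  by case: (dF x h).
- by rewrite in_itv/=; exists c.
Qed.

Lemma der_ge0_le a b f (df : R -> R) : a <= b ->
  (forall x, a <= x <= b -> is_derive x 1 f (df x)) ->
  (forall x, a < x < b -> 0 <= df x) -> f a <= f b.
Proof.
rewrite le_eqVlt => /predU1P[->//|ab] /(der_MVT ab)[c cab E] h.
by rewrite -subr_ge0 E mulr_ge0 ?h// subr_ge0 ltW.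
Qed.

Lemma der_gt0_lt a b f (df : R -> R) : a < b ->
  (forall x, a <= x <= b -> is_derive x 1 f (df x)) ->
  (forall x, a < x < b -> 0 < df x) -> f a < f b.
Proof.
move=> ab /(der_MVT ab)[c cab E] h.
by rewrite -subr_gt0 E mulr_gt0 ?h// subr_gt0.
Qed.

Lemma der_eq0_cst a b f : a <= b ->
  (forall x, a <= x <= b -> is_derive x 1 f 0) -> f a = f b.
Proof.
rewrite le_eqVlt => /predU1P[->//|ab] /(der_MVT (df := cst 0) ab)[c cab /= E].
by apply/esym/eqP; rewrite -subr_eq0 E mul0r.
Qed.

Lemma exists_zero a b f : a <= b -> (forall x, a <= x <= b -> {for x, continuous f}) ->
  f a * f b <= 0 -> exists2 c, a <= c <= b & f c = 0.
Proof.
move=> ab cf fab; have [||c] := @IVT _ f a b 0 ab.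
- by apply: continuous_in_subspaceT => x; rewrite inE/= in_itv/=; exact: cf.
- by case: (lerP (f a) (f b)) => h; apply/andP; split; nra.
- by rewrite in_itv/= => ? ?; exists c.
Qed.
End Calculus.

(* [is_derive] is a class: [notypeclasses] keeps its instances from filling the
   premises with derivatives in another shape. *)
Ltac der_step :=
  first [ match goal with H : is_derive _ _ _ _ |- _ => notypeclasses refine H end |
  lazymatch goal with
  | |- is_derive _ _ (fun _ => ?k) _ => notypeclasses refine (der_cst _ _)
  | |- is_derive _ _ (fun y => y) _ => notypeclasses refine (der_id _)
  | |- is_derive _ _ (fun y => @GRing.add _ _ _) _ => notypeclasses refine (derD _ _)
  | |- is_derive _ _ (fun y => @GRing.opp _ _) _ => notypeclasses refine (derN _)
  | |- is_derive _ _ (fun y => @GRing.mul _ _ _) _ => notypeclasses refine (derM _ _)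
  | |- is_derive _ _ (fun y => @GRing.exp _ _ _) _ => notypeclasses refine (derX _ _)
  | |- is_derive _ _ (fun y => cos _) _ => notypeclasses refine (der_cos _)
  | |- is_derive _ _ (fun y => sin _) _ => notypeclasses refine (der_sin _)
  | |- is_derive _ _ (fun y => @GRing.inv _ _) _ =>
      notypeclasses refine (derV _ _); [assumption|]
  | |- is_derive ?x ?v (@GRing.mul _ ?k) ?d =>
      change (is_derive x v (fun y => k * y) d)
  | |- is_derive ?x ?v (@GRing.add _ ?k) ?d =>
      change (is_derive x v (fun y => k + y) d)
  | |- is_derive ?x ?v (@GRing.inv _) ?d =>
      change (is_derive x v (fun y => y^-1) d)
  | |- is_derive ?x ?v (@GRing.opp _) ?d =>
      change (is_derive x v (fun y => - y) d)
  | |- is_derive _ _ (@cos _) _ => notypeclasses refine (is_derive_cos _)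
  | |- is_derive _ _ (@sin _) _ => notypeclasses refine (is_derive_sin _)
  end ].
Ltac der := repeat der_step.
Ltac deq := notypeclasses refine (der_eq _ _); [solve [der]|rewrite /=].
Ltac dcont := notypeclasses refine (der_cont _); solve [der].

(** * Bessel functions of integer order *)

Section BesselIntegral.
Variable R : realType.
Implicit Types (x z t : R) (n k : nat).

(* Poisson's integral: [x ^+ n * PJ n x] is a constant multiple of $J_n(x)$. *)
Definition PJ n x : R :=
  Int 0 (pi / 2) (fun t => cos (x * cos t) * sin t ^+ (2 * n)).

Lemma pihalf_ge0 : 0 <= pi / 2 :> R.
Proof. by rewrite divr_ge0 ?pi_ge0. Qed.

Lemma pihalf_gt1 : 1 < pi / 2 :> R.
Proof.
rewrite lt_neqAle pihalf_ge1 andbT; apply/eqP => E.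
by have := cos1_gt0 R; rewrite E cos_pihalf ltxx.
Qed.

Lemma PJ_der_cos n x : is_derive x 1 (PJ n)
  (Int 0 (pi / 2) (fun t => - (cos t * sin (x * cos t) * sin t ^+ (2 * n)))).
Proof.
apply: (@Int_derive R 0 (pi / 2) (x - 1) (x + 1) _
  (fun x t => - (cos t * sin (x * cos t) * sin t ^+ (2 * n))) x 1).
- exact: pihalf_ge0.
- by rewrite ltrDl ltrBlDr ltrDl ltr01.
- by move=> y _ t; dcont.
- by move=> y t _ _; deq; ring.
- move=> y t _ _; rewrite normrN !normrM normrX.
  have h1 := cos_max t; have h2 := sin_max (y * cos t).
  have : `|sin t| ^+ (2 * n) <= 1 by rewrite exprn_ile1// sin_max.
  move=> h3; rewrite mulr_ile1 ?mulr_ge0 ?exprn_ge0// mulr_ile1//.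
Qed.

(** Integration by parts in t with the primitive G below. As [PJ n] is a multiple of x^-n J_n, this
    is the classical (x^-n J_n)' = - x^-n J_(n+1). *)
Lemma PJ_der n x : is_derive x 1 (PJ n) (- (x / (2 * n + 1)%:R) * PJ n.+1 x).
Proof.
apply: der_eq (PJ_der_cos n x) _.
pose G t := sin (x * cos t) * sin t ^+ (2 * n + 1) / (2 * n + 1)%:R.
have dG t : is_derive t 1 G (cos t * sin (x * cos t) * sin t ^+ (2 * n)
    - (x / (2 * n + 1)%:R) * (cos (x * cos t) * sin t ^+ (2 * n.+1))).
  rewrite /G; deq; rewrite addn1/=.
  have -> : (2 * n.+1 = (2 * n).+2)%N by lia.
  have : (2 * n).+1%:R != 0 :> R by [].
  by rewrite !exprS => ?; field.
have c1 : continuous (fun t => cos t * sin (x * cos t) * sin t ^+ (2 * n)).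
  by move=> t; dcont.
have c2 : continuous (fun t => cos (x * cos t) * sin t ^+ (2 * n.+1)).
  by move=> t; dcont.
have G0 : G 0 = 0 by rewrite /G sin0 addn1 exprS mul0r mulr0 mul0r.
have G1 : G (pi / 2) = 0 by rewrite /G cos_pihalf mulr0 sin0 !mul0r.
have := Int_FTC pihalf_ge0 _ (fun t _ => dG t).
rewrite G0 G1 subrr IntB ?IntZ//; last by move=> t; dcont.
rewrite IntN// -/(PJ n.+1 x) mulNr => h; congr (- _); apply/eqP.
by rewrite -subr_eq0; apply/eqP/h => t; dcont.
Qed.

(** By [PJ_der] the left side is x times the derivative of [PJ n.+1]. Integrating the derivative of
    cos (x cos t) sin^(2n+1) t cos t gives the identity, which is the three-term recurrence of the
    J_n and contains Bessel's equation. *)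
Lemma PJ_rec n x : x * (- (x / (2 * n.+1 + 1)%:R) * PJ n.+2 x) =
  (2 * n + 1)%:R * PJ n x - (2 * n + 2)%:R * PJ n.+1 x.
Proof.
have [_ d1] := PJ_der n.+1 x; have [_ d2] := PJ_der_cos n.+1 x.
rewrite -d1 d2 {d1 d2}.
pose G t := cos (x * cos t) * sin t ^+ (2 * n + 1) * cos t.
have dG t : is_derive t 1 G
    (x * (cos t * sin (x * cos t) * sin t ^+ (2 * n.+1)) +
     ((2 * n + 1)%:R * (cos (x * cos t) * sin t ^+ (2 * n))
     - (2 * n + 2)%:R * (cos (x * cos t) * sin t ^+ (2 * n.+1)))).
  rewrite /G; deq; rewrite addn1 addn2/=.
  have -> : (2 * n.+1 = (2 * n).+2)%N by lia.
  have C : cos t ^+ 2 = 1 - sin t ^+ 2 by rewrite cos2sin2.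
  rewrite !exprS -[(2 * n).+2]addn1 natrD; set s := sin t ^+ _.
  rewrite [RHS](_ : _ = x * cos t * sin (x * cos t) * (sin t * (sin t * s)) +
    (2 * n).+1%:R * cos (x * cos t) * s * (1 - sin t ^+ 2)
     - cos (x * cos t) * (sin t * (sin t * s))); last by ring.
  by rewrite -C; ring.
have c0 : continuous (fun t => cos t * sin (x * cos t) * sin t ^+ (2 * n.+1)).
  by move=> t; dcont.
have c1 : continuous (fun t => cos (x * cos t) * sin t ^+ (2 * n)).
  by move=> t; dcont.
have c2 : continuous (fun t => cos (x * cos t) * sin t ^+ (2 * n.+1)).
  by move=> t; dcont.
have G0 : G 0 = 0 by rewrite /G sin0 addn1 exprS mul0r mulr0 mul0r.
have G1 : G (pi / 2) = 0 by rewrite /G cos_pihalf mulr0.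
have := Int_FTC pihalf_ge0 _ (fun t _ => dG t).
rewrite G0 G1 subrr IntD; [|by move=> t; dcont..].
rewrite IntB; [|by move=> t; dcont..].
rewrite !IntZ// -/(PJ n x) -/(PJ n.+1 x) IntN// => h.
apply/eqP; rewrite -subr_eq0.
rewrite mulrN -opprD h ?oppr0//.
by move=> t; dcont.
Qed.

Lemma PJ_gt0 n x : 0 <= x < pi / 2 -> 0 < PJ n x.
Proof.
move=> /andP[x0 x1]; have pi0 := pi_gt0 R.
have c t : 0 <= t <= pi / 2 -> 0 < cos (x * cos t).
  move=> /andP[t0 t1]; apply: cos_gt0_pihalf.
  have ct : 0 <= cos t by apply: cos_ge0_pihalf; apply/andP; split; lra.
  have := cos_le1 t; move=> ct1; apply/andP; split; nra.
apply: (@Int_gt0 R _ _ (pi / 4)).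
- by apply/andP; split; lra.
- by move=> t; dcont.
- move=> t tt; apply: mulr_ge0; first exact/ltW/c.
  rewrite exprn_ge0// sin_ge0_pi//; move: tt => /andP[? ?]; apply/andP; split; lra.
- apply: mulr_gt0; first by apply: c; apply/andP; split; lra.
  by rewrite exprn_gt0// sin_gt0_pi//; apply/andP; split; lra.
Qed.

Definition fJ n : R -> R := fun x => x ^+ n * PJ n x.
(** This is x times the derivative of [fJ n]: the pair turns Bessel's equation into a first-order
    system whose coefficients are singular only at 0. *)
Definition fJ1 n : R -> R := fun x => n%:R * x ^+ n * PJ n x -
  x ^+ n.+2 / (2 * n + 1)%:R * PJ n.+1 x.

Lemma fJ_der n x : x != 0 -> is_derive x 1 (fJ n) (fJ1 n x / x).
Proof.
move=> x0; have h := PJ_der n x; rewrite /fJ; deq.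
rewrite /fJ1 /=; have e : (2 * n + 1)%:R != 0 :> R by rewrite addn1.
move: e; set c := (2 * n + 1)%:R => e.
by case: n {h} c e => [|n] c e /=; rewrite ?exprS ?expr0; field; rewrite x0.
Qed.

Lemma fJ1_der n x : x != 0 ->
  is_derive x 1 (fJ1 n) ((n%:R ^+ 2 - x ^+ 2) / x * fJ n x).
Proof.
move=> x0; have h := PJ_der n x; have h1 := PJ_der n.+1 x.
rewrite /fJ1; deq.
rewrite /fJ.
have E := PJ_rec n x.
have e : (2 * n + 1)%:R != 0 :> R by rewrite addn1.
have e2 : (2 * n.+1 + 1)%:R != 0 :> R by rewrite addn1.
have E2 : - (x / (2 * n.+1 + 1)%:R) * PJ n.+2 x =
  ((2 * n + 1)%:R * PJ n x - (2 * n + 2)%:R * PJ n.+1 x) / x.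
  by rewrite -E [RHS]mulrC mulKf.
have Hn : n%:R * x ^+ n.-1 = n%:R * x ^+ n / x.
  case: n {h h1 E E2 e e2} => [|n] /=; first by rewrite !mul0r.
  by rewrite exprS; field.
rewrite E2 mulr1 Hn !exprS {h h1 E E2 e2 Hn}.
have -> : n.+2%:R = n%:R + 2 :> R by rewrite -[n.+2]addn2 natrD.
move: e; rewrite !(natrD _ (2 * n)) natrM => e; by field; rewrite x0 e.
Qed.

Lemma PJ_cont n x : {for x, continuous (PJ n)}.
Proof. exact: der_cont (PJ_der n x). Qed.

Lemma PJ_neq0_le n x : 0 < x <= n%:R -> PJ n x != 0.
Proof.
case: n => [|n]; first by move=> /andP[]; lra.
move=> /andP[x0 xn].
have df (y : R) : y != 0 -> is_derive y 1 (fJ n.+1) (fJ1 n.+1 y / y) by exact: fJ_der.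
have df1 (y : R) : y != 0 ->
    is_derive y 1 (fJ1 n.+1) ((n.+1%:R ^+ 2 - y ^+ 2) / y * fJ n.+1 y).
  exact: fJ1_der.
(* f f1 is nondecreasing and vanishes at 0, hence f^2 is nondecreasing. *)
have ff1 y : 0 < y <= x -> 0 <= fJ n.+1 y * fJ1 n.+1 y.
  move=> /andP[y0 yx].
  have c0 : {for 0, continuous (fun y => fJ n.+1 y * fJ1 n.+1 y)}.
    have h := PJ_der n.+1 0; have h1 := PJ_der n.+2 0.
    by rewrite /fJ /fJ1; dcont.
  have z0 : fJ n.+1 0 * fJ1 n.+1 0 = 0 by rewrite /fJ exprS !mul0r.
  rewrite -z0; apply/ler_addgt0Pr => e e0.
  have /cvgrPdist_le /(_ e e0) := c0; rewrite -nbhs_nearE => /nbhs_ballP[d /= d0 hd].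
  pose z := Num.min (d / 2) y.
  have z1 : 0 < z by rewrite lt_min y0 divr_gt0.
  have zy : z <= y by rewrite ge_min lexx orbT.
  have zd : z < d by rewrite gt_min; apply/orP; left; lra.
  have : `|fJ n.+1 0 * fJ1 n.+1 0 - fJ n.+1 z * fJ1 n.+1 z| <= e.
    by apply: hd; rewrite /ball/= sub0r normrN gtr0_norm.
  rewrite ler_norml => /andP[_ h].
  suff : fJ n.+1 z * fJ1 n.+1 z <= fJ n.+1 y * fJ1 n.+1 y by lra.
  apply: (@der_ge0_le R z y (fun y => fJ n.+1 y * fJ1 n.+1 y)
    (fun w => (fJ1 n.+1 w ^+ 2 + (n.+1%:R ^+ 2 - w ^+ 2) * fJ n.+1 w ^+ 2) / w)).
  - exact: zy.
  - move=> w /andP[zw wy]; have w0 : w != 0 by rewrite gt_eqF// (lt_le_trans z1).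
    have h1 := df w w0; have h2 := df1 w w0; deq; by field.
  - move=> w /andP[zw wy]; apply: divr_ge0; last by rewrite ltW// (lt_trans z1).
    rewrite addr_ge0 ?sqr_ge0// mulr_ge0 ?sqr_ge0// subr_ge0.
    by rewrite lerXn2r ?nnegrE ?ler0n ?(ltW (lt_trans z1 zw))//; lra.
(* A starting point at most 1 < pi / 2, where [PJ_gt0] gives a positive value for the monotone
   square. *)
pose z := Num.min 1 x.
have z0 : 0 < z by rewrite lt_min x0 ltr01.
have zx : z <= x by rewrite ge_min lexx orbT.
have p2 := pihalf_gt1.
have fz : 0 < fJ n.+1 z.
  rewrite /fJ mulr_gt0 ?exprn_gt0// PJ_gt0// (ltW z0)/=.
  by rewrite (le_lt_trans _ p2)// ge_min lexx.
have : fJ n.+1 z ^+ 2 <= fJ n.+1 x ^+ 2.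
  apply: (@der_ge0_le R z x (fun y => fJ n.+1 y ^+ 2)
    (fun w => 2 * (fJ n.+1 w * fJ1 n.+1 w) / w)) => //.
  - move=> w /andP[zw wx]; have w0 : w != 0 by rewrite gt_eqF// (lt_le_trans z0).
    by have h1 := df w w0; deq; rewrite expr1; field.
  - move=> w /andP[zw wx]; have w0 := lt_trans z0 zw.
    by rewrite divr_ge0 ?(ltW w0)// mulr_ge0// ff1// w0 ltW.
apply: contraTneq => E; rewrite {2}/fJ E mulr0 expr0n/= -ltNge.
by rewrite exprn_gt0.
Qed.

(** By the recurrence a common zero of orders n and n + 1 is a zero of all higher orders, but orders
    at least x have no zero at x by [PJ_neq0_le]. *)
Lemma PJ_simple n x : 0 < x -> PJ n x = 0 -> PJ n.+1 x != 0.
Proof.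
move=> x0 h; apply/eqP => h1.
have x0' : x != 0 by rewrite gt_eqF.
have H k : PJ (n + k) x = 0 /\ PJ (n + k).+1 x = 0.
  elim: k => [|k [h2 h3]]; first by rewrite addn0.
  rewrite addnS; split => //; have /eqP := PJ_rec (n + k) x.
  rewrite h2 h3 !mulr0 subrr mulf_eq0 (negbTE x0')/= mulf_eq0 oppr_eq0 mulf_eq0.
  by rewrite (negbTE x0') invr_eq0/= addn1 pnatr_eq0/= => /eqP.
pose k := (Num.truncn x).+1.
have [h2 _] := H k; have : PJ (n + k) x != 0.
  apply: PJ_neq0_le; rewrite x0/= (@le_trans _ _ k%:R)//; last first.
    by rewrite ler_nat leq_addl.
  by rewrite ltW// truncnS_gt.
by rewrite h2 eqxx.
Qed.
End BesselIntegral.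

(** * Asymptotics at infinity *)

Section Fresnel.
Variable R : realType.
Implicit Types (f h p q A B : R -> R) (a b e k x t K M X : R).

(* Integration by parts for [k * q = p - h'] without any regularity of [p]. *)
Lemma Int_oscillating a b k (M : R) h p q : a <= b -> continuous q ->
  (forall t, a <= t <= b -> is_derive t 1 h (p t - k * q t)) ->
  (forall t, a <= t <= b -> `|p t| <= M) ->
  `|k * Int a b q| <= `|h a| + `|h b| + M * (b - a).
Proof.
move=> ab cq dh pM; have [Q dQ] := continuous_primitive (a - 1) cq.
have dQ' t : a <= t <= b -> is_derive t 1 Q (q t).
  by move=> /andP[at_ _]; apply: dQ; lra.
rewrite (Int_FTC ab cq dQ').
move: ab; rewrite le_eqVlt => /predU1P[E|ab].
  by rewrite E !subrr !mulr0 normr0 addr0 addr_ge0.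
have [t|c /andP[ac cb]] := @der_MVT R a b (fun t => h t + k * Q t) p ab.
  move=> tab; have h1 := dh t tab; have h2 := dQ' t tab; deq; ring.
move=> E; have -> : k * (Q b - Q a) = p c * (b - a) - h b + h a by rewrite -E; ring.
have h1 : `|p c * (b - a)| <= M * (b - a).
  rewrite normrM (@gtr0_norm _ (b - a)) ?subr_gt0// ler_wpM2r//; first lra.
  by apply: pM; rewrite !ltW.
apply: le_trans (ler_normD _ _) _; have := ler_normB (p c * (b - a)) (h b); lra.
Qed.

Definition vanishing f := forall e, 0 < e -> exists X, forall x, X <= x -> `|f x| <= e.

Lemma vanishingD f h : vanishing f -> vanishing h ->
  vanishing (fun x => f x + h x).
Proof.
move=> v1 v2 e e0; have e2 : 0 < e / 2 by rewrite divr_gt0.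
have [X1 h1] := v1 _ e2; have [X2 h2] := v2 _ e2; exists (Num.max X1 X2) => x.
rewrite ge_max => /andP[/h1 ? /h2 ?]; apply: le_trans (ler_normD _ _) _; lra.
Qed.

Lemma vanishing_bounded f h (K X : R) : (forall x, X <= x -> `|f x| <= K) ->
  vanishing h -> vanishing (fun x => f x * h x).
Proof.
move=> fK vh e e0; pose K1 := Num.max K 1.
have K0 : 0 < K1 by rewrite lt_max ltr01 orbT.
have [X1 h1] := vh _ (divr_gt0 e0 K0); exists (Num.max X X1) => x.
rewrite ge_max => /andP[/fK h2 /h1 h3]; rewrite normrM.
have -> : e = K1 * (e / K1) by field; rewrite gt_eqF.
by apply: ler_pM => //; rewrite le_max h2.
Qed.

Lemma vanishing_inv : vanishing (fun x => x^-1).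
Proof.
move=> e e0; exists e^-1 => x ex; have e1 : 0 < e^-1 by rewrite invr_gt0.
have x0 : 0 < x by exact: lt_le_trans ex.
by rewrite gtr0_norm ?invr_gt0// invf_ple ?posrE.
Qed.

Lemma vanishing_le f h (X : R) : (forall x, X <= x -> `|f x| <= `|h x|) ->
  vanishing h -> vanishing f.
Proof.
move=> fh vh e e0; have [X1 h1] := vh _ e0; exists (Num.max X X1) => x.
by rewrite ge_max => /andP[/fh h2 /h1 h3]; exact: le_trans h3.
Qed.

(** The Fresnel integrals. The range -1 < x has 0 in its interior, so that the derivatives at 0 are
    two-sided. *)
Definition is_fresnel A B := [/\ A 0 = 0, B 0 = 0,
  forall x, -1 < x -> is_derive x 1 A (cos (x ^+ 2)) &
  forall x, -1 < x -> is_derive x 1 B (sin (x ^+ 2))].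

Lemma exists_fresnel : exists A B, is_fresnel A B.
Proof.
have c1 : continuous (fun x : R => cos (x ^+ 2)) by move=> x; dcont.
have c2 : continuous (fun x : R => sin (x ^+ 2)) by move=> x; dcont.
have [A dA] := continuous_primitive (-1) c1.
have [B dB] := continuous_primitive (-1) c2.
exists (fun x => A x - A 0), (fun x => B x - B 0); split; rewrite ?subrr//.
  by move=> x /dA h; deq; rewrite addr0.
by move=> x /dB h; deq; rewrite addr0.
Qed.

Lemma fresnel_scale A B x a : is_fresnel A B -> 0 <= x ->
  Int 0 1 (fun t => x * cos (x ^+ 2 * t ^+ 2 + a)) = cos a * A x - sin a * B x.
Proof.
move=> [A0 B0 dA dB] x0.
have dF t : 0 <= t <= 1 -> is_derive t 1
    (fun t => cos a * A (x * t) - sin a * B (x * t))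
    (x * cos (x ^+ 2 * t ^+ 2 + a)).
  move=> /andP[t0 _]; have xt : -1 < x * t.
    by rewrite (lt_le_trans _ (mulr_ge0 x0 t0)).
  have d1 : is_derive t 1 (fun t => x * t) x by deq; ring.
  have h1 := der_comp d1 (dA _ xt); have h2 := der_comp d1 (dB _ xt).
  by deq; rewrite cosD exprMn; ring.
rewrite (Int_FTC ler01 _ dF); last by move=> t; dcont.
by rewrite !mulr0 A0 B0 !mulr1; ring.
Qed.

(** The oscillating analogue of the integral of exp (- x^2 (1 + t^2)) / (1 + t^2), known from the
    elementary evaluation of the Gaussian integral; a is a phase that selects real or imaginary
    part. *)
Definition fresnel_err a x : R :=
  Int 0 1 (fun t => sin (x ^+ 2 * (1 + t ^+ 2) + a) * (1 + t ^+ 2)^-1).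

Lemma onesqr_gt0 t : 0 < 1 + t ^+ 2.
Proof. by rewrite ltr_pwDl// sqr_ge0. Qed.

Lemma onesqr_der t :
  is_derive t 1 (fun t => (1 + t ^+ 2)^-1) (- (2 * t) / (1 + t ^+ 2) ^+ 2).
Proof.
have nz : 1 + t ^+ 2 != 0 by rewrite gt_eqF// onesqr_gt0.
by deq; rewrite expr1; field.
Qed.

Lemma fresnel_err_cont a x :
  continuous (fun t => sin (x ^+ 2 * (1 + t ^+ 2) + a) * (1 + t ^+ 2)^-1).
Proof. by move=> t; have h := onesqr_der t; dcont. Qed.

(** The left side is the real part of (A + i B)^2 exp (i a). Its x-derivative, rewritten by
    [fresnel_scale], is the derivative of [fresnel_err a] under the integral sign, and both sides
    vanish at 0. *)
Lemma fresnel_id A B a x : is_fresnel A B -> 0 <= x ->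
  (A x ^+ 2 - B x ^+ 2) * cos a - 2 * A x * B x * sin a =
  fresnel_err a x - fresnel_err a 0.
Proof.
move=> AB x0; have [A0 B0 dA dB] := AB.
pose H x := (A x ^+ 2 - B x ^+ 2) * cos a - 2 * A x * B x * sin a - fresnel_err a x.
suff : H 0 = H x by rewrite /H A0 B0 => E; lra.
apply: der_eq0_cst => // y /andP[y0 yx].
have y1 : -1 < y by rewrite (lt_le_trans _ y0).
have h1 := dA y y1; have h2 := dB y y1.
have h3 : is_derive y 1 (fresnel_err a)
    (Int 0 1 (fun t => 2 * y * cos (y ^+ 2 * t ^+ 2 + (y ^+ 2 + a)))).
  apply: (@Int_derive R 0 1 (-1) (x + 1) _
    (fun y t => 2 * y * cos (y ^+ 2 * t ^+ 2 + (y ^+ 2 + a))) y (2 * (x + 1))) => //.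
  - by apply/andP; split; lra.
  - by move=> z _; exact: fresnel_err_cont.
  - move=> z t _ _; deq; rewrite expr1 mulr0 addr0.
    have -> : z ^+ 2 * (1 + t ^+ 2) + a = z ^+ 2 * t ^+ 2 + (z ^+ 2 + a) by ring.
    by field; rewrite gt_eqF// onesqr_gt0.
  - move=> z t /andP[z1 z2] _; rewrite normrM -[leRHS]mulr1 ler_pM//.
      by rewrite normrM ger0_norm// ler_pM2l// ler_norml; apply/andP; split; lra.
    exact: cos_max.
have E : Int 0 1 (fun t => 2 * y * cos (y ^+ 2 * t ^+ 2 + (y ^+ 2 + a))) =
    2 * (cos (y ^+ 2 + a) * A y - sin (y ^+ 2 + a) * B y).
  rewrite -fresnel_scale// -IntZ; last by move=> t; dcont.
  by apply: Int_ext => t _; rewrite mulrA.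
rewrite E in h3; rewrite /H; deq; rewrite !expr1 cosD sinD; ring.
Qed.

(** The phase x^2 (1 + t^2) is stationary only at t = 0: a short interval [0, e] is bounded
    trivially, and on [e, 1] integration by parts gains a factor x^-2. *)
Lemma fresnel_err_vanishing a : vanishing (fresnel_err a).
Proof.
move=> e0' e0'0; pose e := Num.min (e0' / 2) (1 / 2).
have e0 : 0 < e by rewrite lt_min !divr_gt0.
have ee : e <= e0' / 2 by rewrite ge_min lexx.
have e1 : e < 1 by rewrite gt_min; apply/orP; right; lra.
pose K := e^-1 + e^-1 + 2 * e^-1 ^+ 2.
have K0 : 0 < K by rewrite /K !addr_gt0 ?mulr_gt0 ?exprn_gt0 ?invr_gt0.
exists (1 + K / (e0' / 2)) => x xX.
have Kq : 0 < K / (e0' / 2) by rewrite !divr_gt0.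
have x1 : 1 <= x by lra.
have xe : K <= x ^+ 2 * (e0' / 2).
  rewrite -ler_pdivrMr ?divr_gt0// (@le_trans _ _ x)//; first lra.
  by rewrite expr2 ler_peMr//; lra.
rewrite /fresnel_err (Int_cat (ltW e0) (ltW e1)); last exact: fresnel_err_cont.
set I1 := Int 0 e _; set I2 := Int e 1 _.
have b1 : `|I1| <= 1 * (e - 0).
  apply: Int_norm_le; [exact: ltW|exact: fresnel_err_cont|].
  move=> t _; rewrite normrM mulr_ile1// ?sin_max//.
  rewrite gtr0_norm ?invr_gt0 ?onesqr_gt0// invf_le1 ?onesqr_gt0//.
  by rewrite lerDl sqr_ge0.
have b2 : `|x ^+ 2 * I2| <= K.
  (* The amplitude 1 / (1 + t^2) divided by 2 t, the t-derivative of the phase up to x^2. *)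
  pose v t : R := (2 * t * (1 + t ^+ 2))^-1.
  have tp t : e <= t -> 0 < 2 * t * (1 + t ^+ 2).
    by move=> et; rewrite !mulr_gt0 ?onesqr_gt0// (lt_le_trans e0).
  have dv t : e <= t -> is_derive t 1 v
      (- ((2 + 6 * t ^+ 2) / (2 * t * (1 + t ^+ 2)) ^+ 2)).
    move=> et; have nz : 2 * t * (1 + t ^+ 2) != 0 by rewrite gt_eqF// tp.
    rewrite /v; deq; rewrite expr1; field; rewrite !gt_eqF ?onesqr_gt0//; lra.
  have vb t : e <= t -> `|v t| <= e^-1.
    move=> et; rewrite /v gtr0_norm ?invr_gt0 ?tp// lef_pV2 ?posrE ?tp//.
    rewrite (@le_trans _ _ (t * 1))//; first by rewrite mulr1.
    by rewrite [2 * t]mulrC -mulrA ler_pM2l ?(lt_le_trans e0)//; have := sqr_ge0 t; lra.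
  apply: le_trans (@Int_oscillating e 1 (x ^+ 2) (2 * e^-1 ^+ 2)
    (fun t => cos (x ^+ 2 * (1 + t ^+ 2) + a) * v t)
    (fun t => cos (x ^+ 2 * (1 + t ^+ 2) + a) *
      (- ((2 + 6 * t ^+ 2) / (2 * t * (1 + t ^+ 2)) ^+ 2))) _ _ _ _ _) _.
  - exact: ltW.
  - exact: fresnel_err_cont.
  - move=> t /andP[et _]; have h1 := dv t et; deq; rewrite /v expr1.
    field; rewrite !gt_eqF ?onesqr_gt0//; lra.
  - move=> t /andP[et t1]; rewrite normrM -[leRHS]mul1r ler_pM ?cos_max//.
    rewrite normrN ger0_norm; last first.
      by rewrite divr_ge0 ?sqr_ge0// addr_ge0// mulr_ge0 ?sqr_ge0.
    have t0 : 0 < t by exact: lt_le_trans et.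
    rewrite ler_pdivrMr ?exprn_gt0 ?tp// exprVn.
    have : 1 <= e^-2 * t ^+ 2.
      by rewrite mulrC ler_pdivlMr ?exprn_gt0// mul1r lerXn2r// nnegrE ltW.
    have := sqr_ge0 t; set s := t ^+ 2 => s0 h.
    have -> : 2 / e ^+ 2 * (2 * t * (1 + s)) ^+ 2 =
      8 * (e^-2 * s) * (1 + s) ^+ 2 by rewrite /s; field; rewrite gt_eqF.
    apply: (@le_trans _ _ (8 * 1 * (1 + s) ^+ 2)); first by nra.
    by rewrite ler_wpM2r ?sqr_ge0// ler_pM2l.
  rewrite /K; have := vb e (lexx _); have := vb 1 (ltW e1).
  have n1 t : `|cos (x ^+ 2 * (1 + t ^+ 2) + a) * v t| <= `|v t|.
    by rewrite normrM ler_piMl ?cos_max.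
  have := n1 e; have := n1 1.
  have : 2 * e^-1 ^+ 2 * (1 - e) <= 2 * e^-1 ^+ 2.
    have : 0 <= 2 * e^-1 ^+ 2 by rewrite mulr_ge0 ?sqr_ge0.
    by move: (2 * _) => r r0; nra.
  lra.
have b3 : `|I2| <= e0' / 2.
  have x2 : 0 < x ^+ 2 by rewrite exprn_gt0//; lra.
  by rewrite -(ler_pM2l x2) (le_trans _ xe)// -[X in X * _](gtr0_norm x2) -normrM.
apply: le_trans (ler_normD _ _) _; lra.
Qed.

(** [fresnel_id] with a = 0 gives A^2 - B^2 -> 0, and with a = - pi / 2 it gives 2 A B -> k > 0.
    Hence A and B eventually have the same sign, are bounded and stay away from 0, and A - B is (A^2
    - B^2) / (A + B). *)
Lemma fresnel_asymptotics A B : is_fresnel A B ->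
  vanishing (fun x => A x - B x) /\
  exists d K X : R, 0 < d /\ forall x, X <= x -> d <= `|A x| <= K.
Proof.
move=> AB; pose k := Int 0 1 (fun t : R => (1 + t ^+ 2)^-1).
have k0 : 0 < k.
  apply: (@Int_gt0 R 0 1 (1 / 2)).
  - by apply/andP; split; lra.
  - by move=> t; exact: der_cont (onesqr_der t).
  - by move=> t _; rewrite invr_ge0 ltW// onesqr_gt0.
  - by rewrite invr_gt0 onesqr_gt0.
have E1 x : 0 <= x -> A x ^+ 2 - B x ^+ 2 = fresnel_err 0 x.
  move=> x0; have := fresnel_id 0 AB x0; rewrite cos0 sin0 mulr1 mulr0 subr0 => ->.
  suff -> : fresnel_err 0 0 = 0 by rewrite subr0.
  rewrite /fresnel_err (@Int_ext R 0 1 _ (cst 0)) ?Int_cst ?mul0r// => t _.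
  by rewrite expr0n/= mul0r addr0 sin0 mul0r.
have E2 x : 0 <= x -> 2 * A x * B x = fresnel_err (- (pi / 2)) x + k.
  move=> x0; have := fresnel_id (- (pi / 2)) AB x0.
  rewrite cosN sinN cos_pihalf sin_pihalf mulr0 sub0r mulrN1 opprK => ->.
  congr (_ + _); rewrite -(opprK k); congr (- _).
  rewrite /fresnel_err /k -IntN; last by move=> t; exact: der_cont (onesqr_der t).
  by apply: Int_ext => t _; rewrite expr0n/= mul0r add0r sinN sin_pihalf mulN1r.
have v1 := fresnel_err_vanishing 0; have v2 := fresnel_err_vanishing (- (pi / 2)).
(* An error at most k / 8 keeps 2 A B above k / 2 and A^2 above d2; an error at most 1 gives the
   upper bound for A^2. *)
pose d2 := Num.min (k / 8) 1.
have d20 : 0 < d2 by rewrite lt_min divr_gt0 ?ltr01.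
have d2k : d2 <= k / 8 by rewrite ge_min lexx.
have d21 : d2 <= 1 by rewrite ge_min lexx orbT.
have [X1 h1] := v1 _ d20; have [X2 h2] := v2 _ d20.
pose X := Num.max 0 (Num.max X1 X2).
have key x : X <= x -> [/\ k / 2 <= 2 * A x * B x, d2 <= A x ^+ 2 & A x ^+ 2 <= k + 2].
  rewrite !ge_max => /and3P[x0 /h1 + /h2]; rewrite -E1// !ler_norml => /andP[a1 a2] /andP[a3 a4].
  have := E2 x x0; move: (fresnel_err _ x) a3 a4 => r a3 a4 E.
  have p1 : 0 <= (A x - B x) ^+ 2 by exact: sqr_ge0.
  have p2 : 0 <= (A x + B x) ^+ 2 by exact: sqr_ge0.
  have p3 : 0 <= B x ^+ 2 by exact: sqr_ge0.
  have p4 : 0 <= A x ^+ 2 by exact: sqr_ge0.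
  have p5 : (A x - B x) ^+ 2 = A x ^+ 2 + B x ^+ 2 - 2 * A x * B x by ring.
  split; [lra|lra|].
  have q1 : (A x ^+ 2) * (B x ^+ 2) <= ((k + 1) / 2) ^+ 2.
    rewrite -exprMn lerXn2r// ?nnegrE; lra.
  rewrite leNgt; apply/negP => h; nra.
have sd : 0 < Num.sqrt d2 by rewrite sqrtr_gt0.
split; last first.
  exists (Num.sqrt d2), (Num.sqrt (k + 2)), X; split => // x /key[_ b1 b2].
  by rewrite -sqrtr_sqr !ler_sqrt//; [apply/andP; split|lra|exact: sqr_ge0].
apply: (@vanishing_le _ (fun x => (Num.sqrt d2)^-1 * fresnel_err 0 x) X); last first.
  by apply: (@vanishing_bounded (cst (Num.sqrt d2)^-1) _ `|(Num.sqrt d2)^-1| 0).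
move=> x xX; have [b1 b2 _] := key x xX.
have x0 : 0 <= x by move: xX; rewrite ge_max => /andP[].
rewrite normrM (@gtr0_norm _ (_^-1)) ?invr_gt0// mulrC ler_pdivlMr// -E1//.
have -> : A x ^+ 2 - B x ^+ 2 = (A x - B x) * (A x + B x) by ring.
rewrite normrM ler_wpM2l//.
rewrite -[leRHS]sqrtr_sqr ler_sqrt ?sqr_ge0//.
have : 0 <= B x ^+ 2 by exact: sqr_ge0.
have -> : (A x + B x) ^+ 2 = A x ^+ 2 + B x ^+ 2 + 2 * A x * B x by ring.
lra.
Qed.
End Fresnel.

(** * Stationary phase for Poisson's integral *)

Section BesselAsymptotics.
Variable R : realType.
Implicit Types (A B a w dw : R -> R) (x t th M : R) (n : nat).

Local Notation s4 := (sin (pi / 4 : R)).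

Lemma s4_sqr : s4 ^+ 2 = 1 / 2.
Proof.
have := cos_pihalf R; have -> : pi / 2 = pi / 4 + pi / 4 :> R by lra.
by rewrite cosD -!expr2 cos2sin2; lra.
Qed.

Lemma s4_gt0 : 0 < s4.
Proof. by have := pi_gt0 R => ?; apply: sin_gt0_pi; apply/andP; split; lra. Qed.

Lemma c4_s4 : cos (pi / 4) = s4.
Proof.
have p0 := pi_gt0 R.
have c0 : 0 < cos (pi / 4 : R) by apply: cos_gt0_pihalf; apply/andP; split; lra.
apply/eqP; rewrite -(@eqrXn2 _ 2)// ?ltW ?s4_gt0//.
by rewrite cos2sin2 s4_sqr; apply/eqP; lra.
Qed.

(** For the amplitude cos (t / 2) the integral is exact: x cos t = x - (p sin (t / 2))^2 with p^2 =
    2 x, so the substitution p sin (t / 2) produces Fresnel integrals up to p sin (pi / 4) = sqrt x.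
    The remaining amplitude is sin t times w; it vanishes at the stationary point, so integration by
    parts makes its contribution O(1 / x), against the factor sqrt x. *)
Lemma amplitude_asymptotics A B a w dw M th : is_fresnel A B -> continuous a ->
  (forall t, 0 <= t <= pi / 2 -> is_derive t 1 w (dw t)) ->
  (forall t, 0 <= t <= pi / 2 -> `|dw t| <= M) ->
  (forall t, 0 <= t <= pi / 2 -> sin t * w t = a t - cos (t / 2)) ->
  vanishing (fun x => Num.sqrt x *
      Int 0 (pi / 2) (fun t => cos (x * cos t + th) * a t) -
    2 * s4 * (cos (x + th) * A (Num.sqrt x) + sin (x + th) * B (Num.sqrt x))).
Proof.
move=> [A0 B0 dA dB] ca dw_ dwM wE; have s0 := s4_gt0; have s2 := s4_sqr.
pose C : R := `|w 0| + `|w (pi / 2)| + M * (pi / 2 - 0).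
apply: (@vanishing_le _ _ (fun x => C * Num.sqrt x^-1) 1); last first.
  apply: (@vanishing_bounded _ (fun=> C) _ `|C| 0) => // e e0.
  have [X hX] := vanishing_inv (exprn_gt0 2 e0).
  exists (Num.max 1 X) => x; rewrite ge_max => /andP[x1 /hX].
  have x0 : 0 <= x^-1 by rewrite invr_ge0; lra.
  rewrite (ger0_norm x0) (ger0_norm (sqrtr_ge0 _)) => h.
  by rewrite -(ger0_norm (ltW e0)) -sqrtr_sqr ler_sqrt// sqr_ge0.
move=> x x1; have x0 : 0 < x by lra.
have sx : 0 < Num.sqrt x by rewrite sqrtr_gt0.
pose p : R := Num.sqrt x / s4; have p0 : 0 < p by rewrite divr_gt0.
have p2 : p ^+ 2 = 2 * x.
  by rewrite expr_div_n sqr_sqrtr ?ltW// s2; lra.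
have cq : continuous (fun t => cos (x * cos t + th) * (a t - cos (t / 2))).
  move=> t; apply: cvgM; first by dcont.
  by apply: cvgB; [exact: ca|dcont].
have cm : continuous (fun t => cos (x * cos t + th) * cos (t / 2)).
  by move=> t; dcont.
have dF t : 0 <= t <= pi / 2 -> is_derive t 1
    (fun t => 2 / p * (cos (x + th) * A (p * sin (t / 2)) +
                       sin (x + th) * B (p * sin (t / 2))))
    (cos (x * cos t + th) * cos (t / 2)).
  move=> /andP[t0 t1]; have pt : -1 < p * sin (t / 2).
    apply: (@lt_le_trans _ _ 0) => //; apply: mulr_ge0; first exact: ltW.
    by apply: sin_ge0_pi; apply/andP; split; have := pi_gt0 R; lra.
  have d1 : is_derive t 1 (fun t => p * sin (t / 2)) (p * cos (t / 2) / 2).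
    by deq; field.
  have h1 := der_comp d1 (dA _ pt); have h2 := der_comp d1 (dB _ pt).
  have -> : x * cos t + th = x + th - (p * sin (t / 2)) ^+ 2.
    rewrite exprMn p2 [in LHS](splitr t) cosD -!expr2 cos2sin2; ring.
  deq; rewrite cosB; field; exact: lt0r_neq0.
have Em : Int 0 (pi / 2) (fun t => cos (x * cos t + th) * cos (t / 2)) =
    2 / p * (cos (x + th) * A (Num.sqrt x) + sin (x + th) * B (Num.sqrt x)).
  rewrite (Int_FTC (pihalf_ge0 R) cm dF) mul0r sin0 mulr0 A0 B0 !mulr0 addr0 mulr0 subr0.
  have -> : pi / 2 / 2 = pi / 4 :> R by lra.
  by rewrite /p divfK// gt_eqF.
have -> : Int 0 (pi / 2) (fun t => cos (x * cos t + th) * a t) =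
    Int 0 (pi / 2) (fun t => cos (x * cos t + th) * cos (t / 2)) +
    Int 0 (pi / 2) (fun t => cos (x * cos t + th) * (a t - cos (t / 2))).
  by rewrite -IntD//; apply: Int_ext => t _; ring.
have bd := @Int_oscillating R 0 (pi / 2) x M
   (fun t => w t * sin (x * cos t + th)) (fun t => dw t * sin (x * cos t + th))
   _ (pihalf_ge0 R) cq _ _.
rewrite Em mulrDr; have -> : Num.sqrt x * (2 / p * (cos (x + th) * A (Num.sqrt x) +
    sin (x + th) * B (Num.sqrt x))) = 2 * s4 * (cos (x + th) * A (Num.sqrt x) +
    sin (x + th) * B (Num.sqrt x)).
  by rewrite /p; field; rewrite !gt_eqF.
rewrite addrAC subrr add0r.
set I := Int _ _ _ in bd *.
have -> : Num.sqrt x * I = Num.sqrt x^-1 * (x * I).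
  rewrite mulrA; congr (_ * _); rewrite sqrtrV ?ltW//.
  by rewrite -[X in _ * X](sqr_sqrtr (ltW x0)); field; rewrite gt_eqF.
rewrite normrM [leRHS]normrM mulrC ler_wpM2r//.
apply: le_trans (bd _ _) _.
- move=> t tt; have h1 := dw_ t tt; deq.
  by rewrite -(wE t tt); ring.
- move=> t tt; rewrite normrM (le_trans _ (dwM t tt))// ler_piMr ?sin_max//.
- apply: le_trans (ler_norm _); rewrite /C.
  have n1 t : `|w t * sin (x * cos t + th)| <= `|w t|.
    by rewrite normrM ler_piMr ?sin_max.
  have := n1 0; have := n1 (pi / 2); lra.
Qed.

(** [w0] and [w1] are the quotients of 1 - cos (t / 2) and cos t - cos (t / 2) by sin t, with the
    common factor sin (t / 2) cancelled so that t = 0 is not singular. *)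
Let D t : R := 2 * (1 + cos (t / 2)) * cos (t / 2).
Let w0 t := sin (t / 2) / D t.
Let D' t : R := - sin (t / 2) * (1 + 2 * cos (t / 2)).
Let dw0 t := (cos (t / 2) / 2 * D t - sin (t / 2) * D' t) / D t ^+ 2.
Let w1 t := - (2 * cos (t / 2) + 1) * w0 t.
Let dw1 t := sin (t / 2) * w0 t - (2 * cos (t / 2) + 1) * dw0 t.

Lemma cos_half_ge t : 0 <= t <= pi / 2 -> 1 / 2 <= cos (t / 2).
Proof.
move=> /andP[t0 t1]; have p0 := pi_gt0 R.
have : s4 <= cos (t / 2).
  rewrite -c4_s4; move: t1; rewrite le_eqVlt => /predU1P[->|t1].
    by rewrite -mulrA -invfM -natrM.
  rewrite ltW// ltr_cos ?in_itv/=; [lra| |]; apply/andP; split; lra.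
have := s4_gt0; have := s4_sqr; nra.
Qed.

Let D_ge1 t : 0 <= t <= pi / 2 -> 1 <= D t.
Proof. by move=> /cos_half_ge h; rewrite /D; nra. Qed.

Let w0_der t : 0 <= t <= pi / 2 -> is_derive t 1 w0 (dw0 t).
Proof.
move=> /D_ge1 h; have nz : D t != 0 by rewrite gt_eqF//; lra.
have dD : is_derive t 1 D (D' t) by rewrite /D; deq; rewrite /D'; field.
rewrite /w0; deq; rewrite /dw0; by field.
Qed.

Let w1_der t : 0 <= t <= pi / 2 -> is_derive t 1 w1 (dw1 t).
Proof.
move=> h; have h1 := w0_der h; rewrite /w1; deq; rewrite /dw1; by field.
Qed.

Let w0_bound t : 0 <= t <= pi / 2 -> `|w0 t| <= 1 /\ `|dw0 t| <= 8.
Proof.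
move=> h; have D1 := D_ge1 h; have D0 : 0 < D t by lra.
have := sin_max (t / 2); rewrite ler_norml => /andP[s1 s2].
have := cos_max (t / 2); rewrite ler_norml => /andP[_ c2].
have c1 := cos_half_ge h.
rewrite /w0 /dw0 !normrM !normfV (gtr0_norm D0) (gtr0_norm (exprn_gt0 2 D0)).
split.
  rewrite ler_pdivrMr// mul1r (le_trans _ D1)// ler_norml s1 s2//.
rewrite ler_pdivrMr ?exprn_gt0//.
have D2 : 1 <= D t ^+ 2 by rewrite expr_ge1//; lra.
apply: (@le_trans _ _ (8 * 1)); last by rewrite ler_pM2l.
rewrite mulr1 /D' /D; move: (sin _) (cos _) s1 s2 c1 c2 => s c s1 s2 c1 c2.
rewrite ler_norml; have ss : 0 <= s ^+ 2 <= 1 by apply/andP; split; nra.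
have -> : c / 2 * (2 * (1 + c) * c) - s * (- s * (1 + 2 * c)) =
  (1 + c) * (c * c) + s ^+ 2 * (1 + 2 * c) by field.
move: (s ^+ 2) ss => q /andP[q0 q1].
have cc : 0 <= c * c <= 1 by apply/andP; split; nra.
move: (c * c) cc => r /andP[r0 r1]; apply/andP; split; nra.
Qed.

Let w1_bound t : 0 <= t <= pi / 2 -> `|dw1 t| <= 32.
Proof.
move=> h; have [b1 b2] := w0_bound h.
have c1 := cos_half_ge h; have := cos_max (t / 2); rewrite ler_norml => /andP[_ c2].
apply: le_trans (ler_normB _ _) _.
rewrite (normrM (sin _) (w0 t)) (normrM _ (dw0 t)).
have := sin_max (t / 2); rewrite (@ger0_norm _ (_ + 1)); last lra.
have := normr_ge0 (w0 t); have := normr_ge0 (dw0 t).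
have := normr_ge0 (sin (t / 2)); nra.
Qed.

Let w0_amp t : 0 <= t <= pi / 2 -> sin t * w0 t = 1 - cos (t / 2).
Proof.
move=> h; have D1 := D_ge1 h; have c1 := cos_half_ge h.
rewrite [in sin t](splitr t) sinD /w0 /D.
have -> : sin (t / 2) * cos (t / 2) + cos (t / 2) * sin (t / 2) =
  2 * sin (t / 2) * cos (t / 2) by ring.
have -> : 2 * sin (t / 2) * cos (t / 2) * (sin (t / 2) / (2 * (1 + cos (t / 2)) * cos (t / 2)))
  = sin (t / 2) ^+ 2 / (1 + cos (t / 2)) by field; rewrite !gt_eqF//; lra.
by rewrite sin2cos2; field; rewrite gt_eqF//; lra.
Qed.

Let w1_amp t : 0 <= t <= pi / 2 -> sin t * w1 t = cos t - cos (t / 2).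
Proof.
move=> h; rewrite /w1 mulrCA w0_amp// [in cos t](splitr t) cosD -!expr2 sin2cos2; ring.
Qed.

(* The normalisation under which [PJ n] has a nonzero oscillating limit. *)
Definition TJ n x : R := x ^+ n * Num.sqrt x * PJ n x.

Lemma TJ0_asymptotics A B : is_fresnel A B ->
  vanishing (fun x => TJ 0 x -
    2 * s4 * (cos x * A (Num.sqrt x) + sin x * B (Num.sqrt x))).
Proof.
move=> AB; have c1 : continuous (cst 1 : R -> R) by move=> t; exact: cvg_cst.
have := amplitude_asymptotics 0 AB c1 w0_der (fun t h => (w0_bound h).2) w0_amp.
apply: (@vanishing_le _ _ _ 0) => x _; rewrite !addr0 /TJ expr0 mul1r /PJ muln0.
rewrite [X in `|_ * X - _| <= _](_ : _ =
  Int 0 (pi / 2) (fun t => cos (x * cos t + 0) * cst 1 t))//.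
by apply: Int_ext => t _; rewrite addr0 expr0.
Qed.

(** The amplitude sin^2 t of [PJ 1] vanishes at the stationary point, so x * PJ 1 is read as minus
    the derivative of [PJ 0]: this has the amplitude cos t and the phase shift - pi / 2. *)
Lemma TJ1_asymptotics A B : is_fresnel A B ->
  vanishing (fun x => TJ 1 x -
    2 * s4 * (sin x * A (Num.sqrt x) - cos x * B (Num.sqrt x))).
Proof.
move=> AB; have c1 : continuous (fun t : R => cos t) by move=> t; dcont.
have := amplitude_asymptotics (- (pi / 2)) AB c1 w1_der w1_bound w1_amp.
apply: (@vanishing_le _ _ _ 0) => x _; rewrite cosBpihalf sinBpihalf mulNr.
rewrite /TJ expr1 [x * _]mulrC -[_ * x * _]mulrA.
have [_ e1] := PJ_der 0 x; have [_ e2] := PJ_der_cos 0 x.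
have -> : x * PJ 1 x = - 'D_1 (PJ 0) x by rewrite e1 muln0 add0n divr1 mulNr opprK.
rewrite e2 -IntN; last by move=> t; dcont.
rewrite [X in `|_ * X - _| <= _](_ : _ =
  Int 0 (pi / 2) (fun t => cos (x * cos t + (- (pi / 2))) * cos t))//.
by apply: Int_ext => t _; rewrite muln0 expr0 cosBpihalf; ring.
Qed.

Lemma TJ_rec n x : 0 < x -> TJ n.+2 x =
  (2 * n + 3)%:R * ((2 * n + 2)%:R * (TJ n.+1 x * x^-1) - (2 * n + 1)%:R * TJ n x).
Proof.
move=> x0; have := PJ_rec n x; rewrite /TJ.
have -> : (2 * n.+1 + 1 = 2 * n + 3)%N by lia.
have : (2 * n + 3)%:R != 0 :> R by rewrite addnS pnatr_eq0.
move: (2 * n + 3)%:R (2 * n + 2)%:R (2 * n + 1)%:R (PJ n.+2 x) (PJ n.+1 x) (PJ n x).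
move=> c3 c2 c1 p2 p1 p c30 E.
have -> : c3 * (c2 * (x ^+ n.+1 * Num.sqrt x * p1 / x) - c1 * (x ^+ n * Num.sqrt x * p))
   = - c3 * x ^+ n * Num.sqrt x * (c1 * p - c2 * p1).
  by rewrite exprS; field; rewrite gt_eqF.
by rewrite -E !exprS; field.
Qed.

(** The oscillating factor of J_n at infinity, usually written cos (x - n pi / 2 - pi / 4). *)
Definition SJ n x : R := sin (x + pi / 4 - n%:R * (pi / 2)).

Lemma SJ_SS n x : SJ n.+2 x = - SJ n x.
Proof.
rewrite /SJ -[n.+2]addn2 (natrD _ n 2).
have -> : x + pi / 4 - (n%:R + 2) * (pi / 2) = x + pi / 4 - n%:R * (pi / 2) - pi by field.
by move: (x + _ - _) => u; rewrite -[in RHS](subrK pi u) sinDpi opprK.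
Qed.

Lemma SJ0 x : SJ 0 x = s4 * (cos x + sin x).
Proof. by rewrite /SJ mul0r subr0 sinD c4_s4; ring. Qed.

Lemma SJ1 x : SJ 1 x = s4 * (sin x - cos x).
Proof. by rewrite /SJ mul1r sinBpihalf cosD c4_s4; ring. Qed.

Lemma vanishing_sqrt (f : R -> R) :
  vanishing f -> vanishing (fun x => f (Num.sqrt x)).
Proof.
move=> vf e /vf[X h]; exists (Num.max 0 X ^+ 2) => x xX; apply: h.
rewrite (@le_trans _ _ (Num.max 0 X)) ?le_max ?lexx ?orbT//.
rewrite -[leLHS]ger0_norm ?le_max ?lexx// -sqrtr_sqr ler_sqrt//.
by apply: le_trans xX; exact: sqr_ge0.
Qed.

(** The modulus f is A (sqrt x), the same for all orders. Orders 0 and 1 come from A - B -> 0; in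
    the recurrence the term of order n + 1 carries 1 / x and vanishes, while [SJ n.+2] is - [SJ n],
    so the constant c stays positive. *)
Lemma TJ_asymptotics : exists (f : R -> R) (d K X : R), [/\ 0 < d,
  forall x, X <= x -> d <= `|f x| <= K &
  forall n, exists2 c : R, 0 < c & vanishing (fun x => TJ n x - c * (f x * SJ n x))].
Proof.
have [A [B AB]] := exists_fresnel R.
have [v [d [K [X [d0 hK]]]]] := fresnel_asymptotics AB.
pose f x := A (Num.sqrt x); pose g x := A (Num.sqrt x) - B (Num.sqrt x).
have fK x : Num.max 0 X ^+ 2 <= x -> d <= `|f x| <= K.
  move=> xX; apply: hK; rewrite (@le_trans _ _ (Num.max 0 X)) ?le_max ?lexx ?orbT//.
  rewrite -[leLHS]ger0_norm ?le_max ?lexx// -sqrtr_sqr ler_sqrt//.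
  by apply: le_trans xX; exact: sqr_ge0.
have vg : vanishing g by exact: vanishing_sqrt v.
have s0 := s4_gt0.
have bd (h : R -> R) : (forall x, `|h x| <= 1) -> vanishing (fun x => 2 * s4 * h x * g x).
  move=> h1; apply: (@vanishing_bounded _ _ _ (2 * s4) 0) vg => x _.
  have s2 : 0 < 2 * s4 by rewrite mulr_gt0.
  by rewrite normrM gtr0_norm// ler_piMr// ltW.
exists f, d, K, (Num.max 0 X ^+ 2); split => //.
suff H n : (exists2 c : R, 0 < c & vanishing (fun x => TJ n x - c * (f x * SJ n x))) /\
  (exists2 c : R, 0 < c & vanishing (fun x => TJ n.+1 x - c * (f x * SJ n.+1 x))).
  by move=> n; case: (H n).
elim: n => [|n [[c c0 hc] [c' c'0 hc']]].
  split; exists 2 => //.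
    apply: (@vanishing_le _ _ _ 0)
      (vanishingD (TJ0_asymptotics AB) (bd (fun x => - sin x) _)) => x => [_|].
      by rewrite SJ0 /f /g le_eqVlt; apply/orP; left; apply/eqP; congr (`|_|); ring.
    by rewrite normrN sin_max.
  apply: (@vanishing_le _ _ _ 0)
    (vanishingD (TJ1_asymptotics AB) (bd (fun x => cos x) _)) => x => [_|].
    by rewrite SJ1 /f /g le_eqVlt; apply/orP; left; apply/eqP; congr (`|_|); ring.
  exact: cos_max.
split; first by exists c'.
exists ((2 * n + 3)%:R * (2 * n + 1)%:R * c).
  by rewrite !mulr_gt0// ltr0n addnS.
have cv (a : R) (h : R -> R) : vanishing h -> vanishing (fun x => a * h x).
  by move=> vh; apply: (@vanishing_bounded _ (fun=> a) _ `|a| 0).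
have v1 : vanishing (fun x => c' * (f x * SJ n.+1 x) * x^-1).
  apply: (@vanishing_bounded _ _ _ (c' * K) (Num.max 0 X ^+ 2)); last exact: vanishing_inv.
  move=> x /fK /andP[_ h]; rewrite normrM gtr0_norm// ler_pM2l// normrM.
  by rewrite (le_trans _ h)// ler_piMr ?sin_max.
have v2 : vanishing (fun x => (TJ n.+1 x - c' * (f x * SJ n.+1 x)) * x^-1).
  apply: (@vanishing_le _ _ _ 1) hc' => x x1; rewrite normrM ler_piMr//.
  by rewrite gtr0_norm ?invr_gt0 ?invf_le1//; lra.
have v3 := cv ((2 * n + 3)%:R * (2 * n + 2)%:R) _ (vanishingD v1 v2).
have := vanishingD v3 (cv (- ((2 * n + 3)%:R * (2 * n + 1)%:R)) _ hc).
apply: (@vanishing_le _ _ _ 1) => x x1; rewrite TJ_rec ?SJ_SS; last by lra.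
rewrite le_eqVlt; apply/orP; left; apply/eqP; congr (`|_|); ring.
Qed.

(** At a zero only c f [SJ n] is left of the asymptotics, and c f is bounded away from 0. *)
Lemma PJ_zero_loc n e : 0 < e ->
  exists X, forall z, X <= z -> PJ n z = 0 -> `|SJ n z| <= e.
Proof.
move=> e0; have [f [d [K [X [d0 hf /(_ n)[c c0 v]]]]]] := TJ_asymptotics.
have [Y hY] := v _ (mulr_gt0 (mulr_gt0 c0 d0) e0).
exists (Num.max X Y) => z; rewrite ge_max => /andP[/hf /andP[h1 _] /hY h2] hz.
move: h2; rewrite /TJ hz mulr0 sub0r normrN normrM gtr0_norm// -mulrA ler_pM2l//.
rewrite normrM => h2; rewrite -(ler_pM2l d0) (le_trans _ h2)//.
by rewrite ler_wpM2r.
Qed.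
End BesselAsymptotics.

(** * Zeros of Bessel functions *)

Section BesselZeros.
Variable R : realType.
Implicit Types (a b c e x y z : R) (n k m : nat) (s : seq R).

Definition zeros n s := forall z, z \in s -> 0 < z /\ PJ n z = 0.

Lemma zeros_cat n s1 s2 : zeros n s1 -> zeros n s2 -> zeros n (s1 ++ s2).
Proof. by move=> h1 h2 z; rewrite mem_cat => /orP[/h1|/h2]. Qed.

Lemma zeros_cons n z s : zeros n (z :: s) -> [/\ 0 < z, PJ n z = 0 & zeros n s].
Proof.
move=> h; have [h1 h2] := h z (mem_head _ _); split=> // y ys.
by apply: h; rewrite inE ys orbT.
Qed.

(** Reflected at pi m, the point lies in [e, 3 pi / 4], a part of [e, pi - e] because e <= pi / 4;
    there the sine is at least sin e. *)
Lemma sin_abs_ge e y m : 0 < e <= pi / 4 ->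
  pi * m%:R - 3 * pi / 4 <= y -> y <= pi * m%:R - e -> sin e <= `|sin y|.
Proof.
move=> /andP[e0 e1] y1 y2; have p0 := pi_gt0 R.
have -> : `|sin y| = `|sin (pi * m%:R - y)|.
  elim: m {y1 y2} => [|m IH]; first by rewrite mulr0 sub0r sinN normrN.
  rewrite IH -natr1; have -> : pi * (m%:R + 1) - y = pi * m%:R - y + pi by ring.
  by rewrite sinDpi normrN.
apply: le_trans (ler_norm _).
have : e <= pi * m%:R - y <= 3 * pi / 4 by apply/andP; split; lra.
move: (pi * m%:R - y) => w /andP[w1 w2].
have -> : w = (w + e) / 2 + (w - e) / 2 by field.
have {1}-> : e = (w + e) / 2 - (w - e) / 2 by field.
have c0 : 0 <= cos ((w + e) / 2) by apply: cos_ge0_pihalf; apply/andP; split; lra.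
have s0 : 0 <= sin ((w - e) / 2) by apply: sin_ge0_pi; apply/andP; split; lra.
rewrite sinB sinD; nra.
Qed.

(** The large-x expansion of the phase of J_0, without its constant, cut after the term in 1 / x;
    the cut errs on the fast side. *)
Definition psi0 x := x - (8 * x)^-1.

(* [rho] is the logarithmic derivative x v' / v of v = p^(-1/2) sin (psi0 + c),
   p = x psi0', which oscillates faster than J_0. *)
Let rho c x := (8 * x ^+ 2 + 1)^-1 - 1 / 2 +
  (x + (8 * x)^-1) * (cos (psi0 x + c) / sin (psi0 x + c)).
Let kappa x := (64 * x ^+ 3)^-1 + 16 * x / (8 * x ^+ 2 + 1) ^+ 2 +
  8 * x / (8 * x ^+ 2 + 1) ^+ 2.

(** The Riccati equation of the comparison function. Where [fJ 0] is nonzero, [fJ1 0 / fJ 0]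
    satisfies the same equation without kappa, and kappa > 0 expresses the faster oscillation. *)
Let rho_der c x : 0 < x -> sin (psi0 x + c) != 0 ->
  is_derive x 1 (rho c) (- x - kappa x - rho c x ^+ 2 / x).
Proof.
move=> x0 s0; have nz1 : 8 * x ^+ 2 + 1 != 0.
  by rewrite gt_eqF// ltr_wpDl// mulr_ge0// sqr_ge0.
have nz2 : 8 * x != 0 by rewrite gt_eqF// mulr_gt0.
have h : is_derive x 1 (fun x => psi0 x + c) (1 + (8 * x ^+ 2)^-1).
  by rewrite /psi0; deq; field; rewrite gt_eqF.
rewrite /rho /kappa; deq.
by field; rewrite s0 nz1 gt_eqF.
Qed.

(** Sturm comparison in Picone's form: if the phase gained less than pi, the comparison function
    could be shifted so as to have no zero on [a, b], and Z would be strictly increasing between two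
    zeros of itself. *)
Lemma PJ0_zero_gap a b : 0 < a -> a < b -> PJ 0 a = 0 -> PJ 0 b = 0 ->
  psi0 a + pi <= psi0 b.
Proof.
move=> a0 ab fa fb; have p0 := pi_gt0 R; rewrite leNgt; apply/negP => hgap.
have psi_mono x y : 0 < x -> x <= y -> psi0 x <= psi0 y.
  move=> x0 xy; rewrite /psi0 lerB// lef_pV2 ?posrE ?mulr_gt0//; last by lra.
  by rewrite ler_pM2l.
(* This shift places the phases at a and b symmetrically about pi / 2, hence inside (0, pi). *)
pose c := (psi0 a + pi - psi0 b) / 2 - psi0 a.
have s0 x : a <= x <= b -> sin (psi0 x + c) != 0.
  move=> /andP[ax xb]; have h1 := psi_mono a x a0 ax.
  have h2 := psi_mono x b (lt_le_trans a0 ax) xb.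
  by rewrite gt_eqF// sin_gt0_pi// /c; apply/andP; split; lra.
have f0 y : PJ 0 y = fJ 0 y by rewrite /fJ expr0 mul1r.
pose Z x := fJ 0 x * fJ1 0 x - fJ 0 x ^+ 2 * rho c x.
suff : Z a < Z b by rewrite /Z -!f0 fa fb !expr2 !mul0r subrr ltxx.
apply: (@der_gt0_lt R a b Z (fun x =>
  ((fJ1 0 x - fJ 0 x * rho c x) ^+ 2 / x + kappa x * fJ 0 x ^+ 2))) => //.
  move=> x xab; have x0 : 0 < x by case/andP: xab; lra.
  have h1 := fJ_der 0 (lt0r_neq0 x0); have h2 := fJ1_der 0 (lt0r_neq0 x0).
  have h3 := rho_der x0 (s0 x xab); rewrite /Z; deq; field; rewrite gt_eqF//.
move=> x /andP[ax xb]; have x0 : 0 < x by lra.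
have D0 : 0 < 8 * x ^+ 2 + 1 by rewrite ltr_wpDl// mulr_ge0// sqr_ge0.
have k0 : 0 < kappa x.
  by rewrite /kappa !addr_gt0 ?invr_gt0 ?divr_gt0 ?mulr_gt0 ?exprn_gt0.
(* At a zero of J_0 the kappa term is lost, and positivity comes from the simplicity of the zero. *)
have [E|E] := eqVneq (fJ 0 x) 0.
  rewrite E mul0r subr0 expr0n/= mulr0 addr0 divr_gt0// exprn_even_gt0//=.
  rewrite /fJ1 mul0r mul0r sub0r muln0 add0n divr1 oppr_eq0 mulf_neq0//.
    by rewrite expf_neq0// gt_eqF.
  by apply: PJ_simple => //; rewrite f0.
rewrite ltr_wpDl ?divr_ge0 ?sqr_ge0 ?ltW// mulr_gt0//.
by rewrite exprn_even_gt0.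
Qed.

(** The gaps add up from the first zero, which is at least pi / 2, so that [psi0] is positive there;
    and psi0 x < x at the last one. The bound is exactly the rough estimate that
    [zeros_lower_sharpen] requires for n = 0. *)
Lemma PJ0_zeros_lower s : sorted <%R s -> zeros 0 s -> (0 < size s)%N ->
  pi * ((size s)%:R - 1) < last 0 s.
Proof.
case: s => // z s; rewrite /= => ss /zeros_cons[z0 hz hs] _.
have p0 := pi_gt0 R.
have zpi : pi / 2 <= z.
  by rewrite leNgt; apply/negP => h; have := @PJ_gt0 R 0 z; rewrite hz ltxx ltW// h => /(_ isT).
have H : psi0 z + pi * (size s)%:R <= psi0 (last z s).
  elim: s z z0 hz ss hs {zpi} => [|y s IH] z z0 hz /=; first by rewrite mulr0 addr0.
  move=> /andP[zy ss] /zeros_cons[y0 hy hs].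
  have := IH y y0 hy ss hs; have := PJ0_zero_gap z0 zy hz hy.
  by rewrite -natr1 mulrDr mulr1; lra.
have l0 : 0 < last z s.
  have := mem_last z s; rewrite inE => /predU1P[->//|/hs[]//].
rewrite -natr1 addrK.
have h1 : 0 < (8 * last z s)^-1 by rewrite invr_gt0 mulr_gt0.
have h2 : (8 * z)^-1 < z.
  rewrite invf_plt ?posrE ?mulr_gt0//.
  have := pihalf_ge1 R => ?; apply: (@le_lt_trans _ _ 1); last lra.
  by rewrite invf_le1//; lra.
by move: H; rewrite /psi0; lra.
Qed.

(** Asymptotically, the k-th positive zero is at least pi (k + n / 2 - 1 / 4). Any increasing list
    of k zeros will do, since skipping zeros only moves its last element to the right. *)
Definition zeros_lower n := forall e, 0 < e -> exists M, forall s,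
  sorted <%R s -> zeros n s -> (M <= size s)%N ->
  pi * (size s)%:R - e < last 0 s + pi / 4 - n%:R * (pi / 2).

(** The bound improves itself: at a large zero the sine of y is close to 0 by [PJ_zero_loc], whereas
    [sin_abs_ge] forbids this on all of [pi k - 3 pi / 4, pi k - e]. *)
Lemma zeros_lower_sharpen n :
  (exists M, forall s, sorted <%R s -> zeros n s -> (M <= size s)%N ->
    pi * (size s)%:R - 3 * pi / 4 <= last 0 s + pi / 4 - n%:R * (pi / 2)) ->
  zeros_lower n.
Proof.
move=> [M hM] e0 e00; have p0 := pi_gt0 R; pose e := Num.min e0 (pi / 4).
have eb : 0 < e <= pi / 4 by rewrite lt_min e00 ge_min lexx orbT !andbT; lra.
have se : 0 < sin e by case/andP: eb => *; apply: sin_gt0_pi; apply/andP; split; lra.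
have se2 : 0 < sin e / 2 by lra.
have [X hX] := PJ_zero_loc n se2.
(* By the rough bound, more than X / pi + 2 zeros push the last one beyond X. *)
exists (maxn (maxn M 1) (Num.truncn (X / pi + 2)).+1) => s ss hs.
rewrite !geq_max => /andP[/andP[sM s1] sX].
have := hM s ss hs sM; set y := last 0 s + _ - _ => h1.
suff h : pi * (size s)%:R - e < y.
  by apply: le_lt_trans h; rewrite lerB// ge_min lexx.
rewrite ltNge; apply/negP => ye.
have h2 : sin e <= `|sin y| by apply: (sin_abs_ge eb h1 ye).
have [_ hl] : 0 < last 0 s /\ PJ n (last 0 s) = 0.
  by apply: hs; case: (s) s1 => //= z s' _; exact: mem_last.
suff : `|sin y| <= sin e / 2 by lra.
apply: hX hl.
have h4 : X / pi + 2 < (size s)%:R.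
  by apply: lt_le_trans (truncnS_gt _) _; rewrite ler_nat.
have n0 : 0 <= n%:R * (pi / 2 : R) by apply: mulr_ge0 => //; lra.
have : pi * (X / pi + 2) < pi * (size s)%:R by rewrite ltr_pM2l.
rewrite mulrDr [pi * (X / _)]mulrC divfK ?gt_eqF//.
by move: h1; rewrite /y; lra.
Qed.

(** Rolle's theorem for x^(2n+2) [PJ n.+1], a multiple of x^(n+1) J_(n+1), whose derivative is a
    multiple of x^(n+1) J_n. The power makes 0 an admissible left end. *)
Lemma PJ_rolle n a b : 0 <= a -> a < b -> (a = 0 \/ PJ n.+1 a = 0) ->
  PJ n.+1 b = 0 -> exists2 c, a < c < b & PJ n c = 0.
Proof.
move=> a0 ab ha hb.
have [x xab|c cab] := @der_MVT R a b (fun x => x ^+ (2 * n + 2) * PJ n.+1 x)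
  (fun x => (2 * n + 1)%:R * x ^+ (2 * n + 1) * PJ n x) ab.
  have E := PJ_rec n x; have h := PJ_der n.+1 x.
  move: E h; set r := _ * PJ n.+2 x => E h; deq.
  rewrite mulr1 addn2 addn1/= [x ^+ _.+2]exprS; set q := x ^+ _.
  rewrite (_ : _ + x * q * r = q * ((2 * n).+2%:R * PJ n.+1 x + x * r)); last by ring.
  by rewrite E addn1 addn2; ring.
have -> : b ^+ (2 * n + 2) * PJ n.+1 b - a ^+ (2 * n + 2) * PJ n.+1 a = 0.
  by case: ha => [->|->]; rewrite hb ?addn2 ?exprS ?mul0r !mulr0 subrr.
move=> /esym/eqP; rewrite !mulf_eq0 subr_eq0 (gt_eqF ab) orbF.
rewrite pnatr_eq0 addn1/= expf_eq0/= => /orP[/eqP E|/eqP E]; last by exists c.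
by move: cab; rewrite E; lra.
Qed.

Lemma zeros_rolle n a s : 0 <= a -> (a = 0 \/ PJ n.+1 a = 0) ->
  path <%R a s -> zeros n.+1 s -> exists s', [/\ size s' = size s,
    path <%R a s', zeros n s' & last a s' <= last a s].
Proof.
elim: s a => [|z s IH] a a0 ha /=; first by move=> _ _; exists [::].
move=> /andP[az ss] /zeros_cons[z0 hz hs].
have [c /andP[ac cz] hc] := PJ_rolle a0 az ha hz.
have [s' [s1 s2 s3 s4]] := IH z (ltW z0) (or_intror hz) ss hs.
exists (c :: s'); split => /=; first by rewrite s1.
- rewrite ac; case: s' s2 {s1 s3 s4} => //= y s' /andP[zy ->].
  by rewrite (lt_trans cz zy).
- by move=> y; rewrite inE => /predU1P[->|/s3//]; split=> //; exact: le_lt_trans ac.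
- apply: le_trans s4; case: s' {s1 s2 s3} => //=; exact: ltW.
Qed.

(** From n to n + 1, Rolle's theorem from 0 on supplies as many zeros of order n, the last of them
    no larger. The term n pi / 2 grows by pi / 2, and the induction hypothesis with e = pi / 4 makes
    the total loss 3 pi / 4, which is then sharpened. *)
Lemma PJ_zeros_lower n : zeros_lower n.
Proof.
have p0 := pi_gt0 R.
elim: n => [|n IH]; apply: zeros_lower_sharpen.
  exists 1%N => s ss hs s1; have := PJ0_zeros_lower ss hs s1; lra.
have [|M hM] := IH (pi / 4); first by lra.
exists (maxn M 1) => s ss hs; rewrite geq_max => /andP[sM s1].
have p0s : path <%R 0 s.
  case: s ss hs {sM s1} => //= z s ss /zeros_cons[-> _ _] //.
have [s' [e1 e2 e3 e4]] := zeros_rolle (lexx 0) (or_introl erefl) p0s hs.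
have := hM s' (path_sorted e2) e3; rewrite e1 => /(_ sM).
have -> : n.+1%:R * (pi / 2) = n%:R * (pi / 2) + pi / 2 :> R.
  by rewrite -[n.+1%:R]natr1 mulrDl mul1r.
lra.
Qed.
End BesselZeros.

(** * Sturm comparison with the phase phi_n *)

Section BesselPhase.
Variable R : realType.
Implicit Types (a b c e x y z : R) (n k m : nat) (s : seq R).

Definition phiJ n x : R := Num.sqrt (x ^+ 2 - n%:R ^+ 2) - n%:R * acos (n%:R / x).

Lemma sqr_gap_gt0 n x : n%:R < x -> 0 < x ^+ 2 - n%:R ^+ 2.
Proof. by move=> h; rewrite subr_gt0 ltrXn2r ?nnegrE//= (le_trans _ (ltW h)). Qed.

Lemma phiJ_der n x : n%:R < x ->
  is_derive x 1 (phiJ n) (Num.sqrt (x ^+ 2 - n%:R ^+ 2) / x).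
Proof.
move=> nx; have n0 : 0 <= n%:R :> R by [].
have x0 : 0 < x by exact: le_lt_trans nx.
have h0 := sqr_gap_gt0 nx; have nz : x != 0 by rewrite gt_eqF.
have d1 : is_derive x 1 (fun x : R => x ^+ 2 - n%:R ^+ 2) (2 * x).
  by deq; rewrite expr1; ring.
have d2 := der_comp d1 (is_derive1_sqrt h0).
have d3 : is_derive x 1 (fun x : R => n%:R / x) (- n%:R / x ^+ 2).
  by deq; field.
have q1 : -1 < n%:R / x < 1.
  rewrite ltr_pdivrMr// mul1r nx andbT; apply: (@lt_le_trans _ _ 0) => //.
  by rewrite divr_ge0// ltW.
have d4 := der_comp d3 (is_derive1_acos q1).
have E : Num.sqrt (1 - (n%:R / x) ^+ 2) = Num.sqrt (x ^+ 2 - n%:R ^+ 2) / x.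
  have -> : 1 - (n%:R / x) ^+ 2 = (x ^+ 2 - n%:R ^+ 2) / x ^+ 2 by field.
  by rewrite sqrtrM ?ltW// sqrtrV ?sqr_ge0// sqrtr_sqr gtr0_norm.
rewrite E in d4; rewrite /phiJ; deq.
have p0 : 0 < Num.sqrt (x ^+ 2 - n%:R ^+ 2) by rewrite sqrtr_gt0.
have := sqr_sqrtr (ltW h0); move: (Num.sqrt _) p0 => p p0 E2.
have pn : p != 0 by rewrite gt_eqF.
rewrite [RHS](_ : _ = p ^+ 2 / (p * x)); last by field; rewrite nz.
by rewrite E2; field; rewrite nz.
Qed.

Lemma phiJ_lt n x y : n%:R < x -> x < y -> phiJ n x < phiJ n y.
Proof.
move=> nx xy; apply: der_gt0_lt xy (fun z h => @phiJ_der n z _) _ => z /andP[h1 _].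
  exact: lt_le_trans h1.
have nz := lt_trans nx h1; apply: divr_gt0; first by rewrite sqrtr_gt0 sqr_gap_gt0.
exact: le_lt_trans nz.
Qed.

Lemma phiJ_le n x y : n%:R < x -> x <= y -> phiJ n x <= phiJ n y.
Proof. by move=> nx; rewrite le_eqVlt => /predU1P[->//|xy]; rewrite ltW// phiJ_lt. Qed.

(** With th = asin (n / x) the claim reads 1 <= cos th + th sin th, and the right side has
    derivative th cos th >= 0. It passes from the position of a large zero to its phase. *)
Lemma phiJ_lower n x : n%:R < x -> x - n%:R * (pi / 2) <= phiJ n x.
Proof.
move=> nx; have n0 : 0 <= n%:R :> R by [].
have x0 : 0 < x by exact: le_lt_trans nx.
have h0 := sqr_gap_gt0 nx; have p0 := pi_gt0 R.
pose th := pi / 2 - acos (n%:R / x).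
have q0 : 0 <= n%:R / x by rewrite divr_ge0// ltW.
have q1 : n%:R / x <= 1 by rewrite ler_pdivrMr// mul1r ltW.
have q2 : -1 <= n%:R / x <= 1 by rewrite q1 andbT; lra.
have [t0 t1] : 0 <= th /\ th <= pi / 2.
  have := acos_ge0 q2 => h1; split; last by rewrite /th; lra.
  rewrite /th subr_ge0 leNgt; apply/negP => h.
  have := acosK q2; suff : cos (acos (n%:R / x)) < 0 by lra.
  rewrite -cos_pihalf ltr_cos// in_itv/= ?h1/=.
    by apply/andP; split; lra.
  exact: acos_lepi.
have S : sin th = n%:R / x by rewrite /th -cosBpihalf [pi / 2 - _]addrC addrK cosN acosK.
have C : cos th = Num.sqrt (x ^+ 2 - n%:R ^+ 2) / x.
  rewrite /th -[pi / 2 - _]opprB cosN cosBpihalf sin_acos//.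
  have -> : 1 - (n%:R / x) ^+ 2 = (x ^+ 2 - n%:R ^+ 2) / x ^+ 2.
    by field; rewrite gt_eqF.
  by rewrite sqrtrM ?ltW// sqrtrV ?sqr_ge0// sqrtr_sqr gtr0_norm.
have key : cos 0 + 0 * sin 0 <= cos th + th * sin th.
  apply: (@der_ge0_le R 0 th (fun t => cos t + t * sin t) (fun t => t * cos t)) => //.
    by move=> t _; deq; ring.
  move=> t /andP[h1 h2]; rewrite mulr_ge0 ?ltW// cos_gt0_pihalf//.
  by apply/andP; split; lra.
move: key; rewrite cos0 mul0r addr0 C S => key.
have : x * 1 <= x * (Num.sqrt (x ^+ 2 - n%:R ^+ 2) / x + th * (n%:R / x)).
  by rewrite ler_pM2l.
have -> : x * (Num.sqrt (x ^+ 2 - n%:R ^+ 2) / x + th * (n%:R / x)) =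
  Num.sqrt (x ^+ 2 - n%:R ^+ 2) + th * n%:R by field; rewrite gt_eqF.
by rewrite /phiJ /th; lra.
Qed.

(* W is the Wronskian of J_n and (phi')^(-1/2) sin (phi - phi z), up to powers
   of x: the latter oscillates more slowly than J_n. *)
Lemma PJ_next_zero n z : n%:R < z -> PJ n z = 0 ->
  exists2 y, z < y & PJ n y = 0 /\ phiJ n y <= phiJ n z + pi.
Proof.
move=> nz hz; have n0 : 0 <= n%:R :> R by [].
have z0 : 0 < z by exact: le_lt_trans nz.
have p0 := pi_gt0 R.
have cphi x : z <= x -> {for x, continuous (phiJ n)}.
  by move=> zx; apply: der_cont (@phiJ_der n x _); exact: lt_le_trans zx.
(* [phiJ_lower] makes the phase at b at least phiJ n z + pi, so the intermediate value theorem
   provides w. *)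
pose b := z + pi + n%:R * (pi / 2) + `|phiJ n z|.
have zb : z <= b.
  have : 0 <= n%:R * (pi / 2 : R) by apply: mulr_ge0 => //; lra.
  by rewrite /b; have := normr_ge0 (phiJ n z); lra.
have [||w /andP[zw wb] hw] :=
    @exists_zero R z b (fun x => phiJ n x - (phiJ n z + pi)) zb.
- move=> x /andP[zx _]; apply: continuousB; first exact: cphi.
  exact: cvg_cst.
- have := phiJ_lower (lt_le_trans nz zb).
  have := ler_norm (phiJ n z); move: (phiJ n b) => q h1 h2.
  have : 0 <= q - (phiJ n z + pi) by move: h2; rewrite /b; lra.
  by nra.
have {}hw : phiJ n w = phiJ n z + pi by lra.
have {}zw : z < w.
  by rewrite lt_neqAle zw andbT; apply/eqP => E; move: hw; rewrite -E; lra.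
have [[y /andP[zy yw] hy]|none] := pselect (exists2 y, z < y <= w & PJ n y = 0).
  exists y => //; split=> //; rewrite -hw.
  by apply: phiJ_le => //; exact: lt_trans zy.
(* Without a zero in (z, w] the sign of J_n is constant there; the constant factor [fJ n w] in W
   makes it irrelevant which sign it is. *)
have sgn x : z < x <= w -> 0 < PJ n x * PJ n w.
  move=> /andP[zx xw]; rewrite ltNge; apply/negP => h.
  have [c /andP[xc cw] hc] := exists_zero xw (fun c _ => @PJ_cont R n c) h.
  by apply: none; exists c => //; rewrite (lt_le_trans zx xc).
pose s x : R := Num.sqrt (Num.sqrt (x ^+ 2 - n%:R ^+ 2)).
pose th x := phiJ n x - phiJ n z.
pose W x := (fJ1 n x * sin (th x) + fJ n x * (x ^+ 2 / (2 * s x ^+ 4) * sin (th x)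
  - s x ^+ 2 * cos (th x))) / s x * fJ n w.
have fw : 0 < fJ n w * fJ n w.
  rewrite /fJ mulrACA mulr_gt0 ?sgn ?zw ?lexx//.
  by rewrite mulr_gt0 ?exprn_gt0 ?(lt_trans z0).
have s4 x : n%:R < x -> [/\ 0 < s x, s x ^+ 4 = x ^+ 2 - n%:R ^+ 2 &
    s x ^+ 2 = Num.sqrt (x ^+ 2 - n%:R ^+ 2)].
  move=> nx; have h0 := sqr_gap_gt0 nx.
  have h1 : 0 < Num.sqrt (x ^+ 2 - n%:R ^+ 2) by rewrite sqrtr_gt0.
  have h2 : s x ^+ 2 = Num.sqrt (x ^+ 2 - n%:R ^+ 2) by rewrite sqr_sqrtr ?ltW.
  split => //; first by rewrite sqrtr_gt0.
  by rewrite (exprM _ 2 2) h2 sqr_sqrtr// ltW.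
have : - W z < - W w.
  apply: (@der_gt0_lt R z w (fun x => - W x) (fun x =>
    (x ^+ 3 / (4 * s x ^+ 8) + n%:R ^+ 2 * x / s x ^+ 8) * (fJ n x * fJ n w)
      * sin (th x) / s x)) => //.
    move=> x /andP[zx xw]; have nx : n%:R < x by exact: lt_le_trans zx.
    have x0 : 0 < x by exact: le_lt_trans nx.
    have xn0 : x != 0 by rewrite gt_eqF.
    have [sx0 sx4 sx2] := s4 x nx.
    have ds : is_derive x 1 s (x / (2 * s x ^+ 3)).
      have h0 := sqr_gap_gt0 nx.
      have d1 : is_derive x 1 (fun x : R => x ^+ 2 - n%:R ^+ 2) (2 * x).
        by deq; rewrite expr1; ring.
      have h1 : 0 < Num.sqrt (x ^+ 2 - n%:R ^+ 2) by rewrite sqrtr_gt0.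
      apply: der_eq (der_comp (der_comp d1 (is_derive1_sqrt h0)) (is_derive1_sqrt h1)) _.
      by rewrite -/(s x) -sx2; field; rewrite gt_eqF.
    have d1 := fJ_der n xn0; have d2 := fJ1_der n xn0.
    have d3 := phiJ_der nx; rewrite -sx2 in d3.
    have n1 : 2 * s x ^+ 4 != 0 by rewrite gt_eqF// mulr_gt0// exprn_gt0.
    have n2 : s x != 0 by rewrite gt_eqF.
    have N2 : n%:R ^+ 2 = x ^+ 2 - s x ^+ 4 by rewrite sx4; ring.
    rewrite /W /th; deq; rewrite !expr1 -/(th x) N2.
    by field; rewrite n2 xn0.
  move=> x /andP[zx xw]; have nx : n%:R < x by exact: lt_trans zx.
  have x0 : 0 < x by exact: le_lt_trans nx.
  have [sx0 _ _] := s4 x nx.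
  apply: divr_gt0 => //; apply: mulr_gt0; first apply: mulr_gt0.
  - apply: ltr_wpDr; last by rewrite divr_gt0 ?mulr_gt0 ?exprn_gt0.
    by apply: divr_ge0; [apply: mulr_ge0; [exact: sqr_ge0|exact: ltW]
                        |apply: exprn_ge0; exact: ltW].
  - rewrite /fJ mulrACA; apply: mulr_gt0; last by apply: sgn; rewrite zx ltW.
    by rewrite mulr_gt0 ?exprn_gt0 ?(lt_trans z0).
  - have h1 := phiJ_lt nz zx; have h2 := phiJ_lt nx xw.
    by apply: sin_gt0_pi; rewrite /th; apply/andP; split; lra.
have [sw0 _ _] := s4 w (lt_trans nz zw).
have thw : th w = pi by rewrite /th hw addrAC subrr add0r.
have -> : W z = 0.
  have fz : fJ n z = 0 by rewrite /fJ hz mulr0.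
  by rewrite /W /th subrr sin0 fz mulr0 mul0r addr0 !mul0r.
(* At w the phase difference is pi, so the sine term drops out and W w is positive, although W
   decreases from W z = 0. *)
have -> : W w = s w ^+ 2 * (fJ n w * fJ n w) / s w.
  by rewrite /W thw sinpi cospi !mulr0 add0r sub0r mulrN1 opprK; ring.
rewrite oppr0 oppr_gt0 => h; suff : 0 < s w ^+ 2 * (fJ n w * fJ n w) / s w by lra.
by apply: divr_gt0 => //; apply: mulr_gt0 => //; exact: exprn_gt0.
Qed.

Lemma PJ_zeros_extend n z j : n%:R < z -> PJ n z = 0 -> exists s,
  [/\ size s = j, path <%R z s, zeros n s &
      phiJ n (last z s) <= phiJ n z + pi * j%:R].
Proof.
elim: j z => [|j IH] z nz hz; first by exists [::]; rewrite mulr0 addr0.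
have [y zy [hy py]] := PJ_next_zero nz hz.
have [s [s1 s2 s3 s4]] := IH y (lt_trans nz zy) hy.
exists (y :: s); split => /=; first by rewrite s1.
- by rewrite zy.
- move=> c; rewrite inE => /predU1P[->|/s3//]; split=> //.
  by apply: lt_trans zy; exact: le_lt_trans nz.
- by move: s4; rewrite -natr1 mulrDr mulr1; lra.
Qed.

(** The list is prolonged by M zeros up to some z'. With k its original size, pi (k + M) - e < z' +
    pi / 4 - n pi / 2 <= phi z' + pi / 4 <= phi z + pi M + pi / 4; M cancels and e is arbitrary. The
    1 / 4 is the pi / 4 of [SJ]. *)
Lemma PJ_zeros_phase n s (X : R) : sorted <%R s -> zeros n s -> (0 < size s)%N ->
  last 0 s <= X -> n%:R < X /\ pi * ((size s)%:R - 1 / 4) <= phiJ n X.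
Proof.
move=> ss hs s0 sX; set z := last 0 s.
have [z0 hz] : 0 < z /\ PJ n z = 0.
  by apply: hs; rewrite /z; case: (s) s0 => //= y s' _; exact: mem_last.
have nz : n%:R < z.
  rewrite ltNge; apply/negP => h.
  by have := @PJ_neq0_le R n z; rewrite z0 h hz eqxx => /(_ isT).
split; first exact: lt_le_trans sX.
apply: le_trans (phiJ_le nz sX); apply/ler_addgt0Pr => e e0.
have [M hM] := PJ_zeros_lower n e0.
have [s' [s1 s2 s3 s4]] := PJ_zeros_extend M nz hz.
have h1 : sorted <%R (s ++ s').
  case: s ss {hs sX s1 s3 s4 hz nz z0} @z s0 s2 => //= y s ss _ s2.
  by rewrite cat_path ss.
have := hM (s ++ s') h1 (zeros_cat hs s3); rewrite size_cat s1 leq_addl => /(_ isT).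
rewrite last_cat -/z natrD mulrDr => h2.
have ny : n%:R < last z s'.
  case: s' s2 {h1 h2 s1 s3 s4} => // y s' /(order_path_min lt_trans)/allP h.
  exact: lt_trans (h _ (mem_last _ _)).
by have := phiJ_lower ny; move: s4 h2; lra.
Qed.
End BesselPhase.

(** * The radial equation *)

Section RadialEquation.
Variable R : realType.
Implicit Types (a A q : R -> R) (mu nu K c r e x y d : R) (n : nat).

(* [A] stands for r a', so that the two equations say r (r a')' = (n^2 - mu r^2) a. *)
Definition radial n mu K a A := [/\
  forall r, 0 < r < 1 -> is_derive r 1 a (A r / r),
  forall r, 0 < r < 1 -> is_derive r 1 A ((n%:R ^+ 2 - mu * r ^+ 2) / r * a r),
  forall r, 0 < r < 1 -> `|a r| <= K &
  forall e, 0 < e -> exists2 d, 0 < d < 1 & forall r, d < r < 1 -> `|a r| <= e].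

(** Otherwise q + c ln r is nonincreasing on (0, r0], so q grows at least like - c ln r towards 0
    and leaves [- K, K]; the r chosen below makes it grow by 2 K + 1. *)
Lemma log_blowup q A K c r0 : 0 < c -> 0 < r0 ->
  (forall r, 0 < r <= r0 -> is_derive r 1 q (A r / r)) ->
  (forall r, 0 < r <= r0 -> `|q r| <= K) ->
  ~ (forall r, 0 < r <= r0 -> c <= - A r).
Proof.
move=> c0 r00 dq qK hA.
have K0 : 0 <= K by apply: le_trans (normr_ge0 _) (qK r0 _); rewrite r00 lexx.
pose r := r0 * expR (- ((2 * K + 1) / c)).
have E0 : 0 < (2 * K + 1) / c by rewrite divr_gt0//; lra.
have rr : 0 < r by rewrite mulr_gt0// expR_gt0.
have rr0 : r <= r0 by rewrite ger_pMr// expR_le1; lra.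
have H : - (q r + c * ln r) <= - (q r0 + c * ln r0).
  apply: (@der_ge0_le R r r0 (fun x => - (q x + c * ln x))
    (fun x => (- A x - c) / x) rr0).
    move=> x /andP[x1 x2]; have x0 : 0 < x by exact: lt_le_trans x1.
    have h1 := dq x; rewrite x0 x2 in h1; have {}h1 := h1 isT.
    have h2 := is_derive1_ln x0; deq; field; by rewrite gt_eqF.
  move=> x /andP[x1 x2]; have x0 : 0 < x by exact: lt_trans x1.
  by apply: divr_ge0; [rewrite subr_ge0; apply: hA; rewrite x0 ltW|exact: ltW].
have L : ln r = ln r0 - (2 * K + 1) / c.
  by rewrite lnM ?posrE ?expR_gt0// expRK.
move: H; rewrite L mulrBr [c * (_ / c)]mulrC divfK ?gt_eqF//.
have := qK r; have := qK r0; rewrite rr rr0 r00 lexx => /(_ isT) + /(_ isT).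
by rewrite !ler_norml => /andP[? ?] /andP[? ?]; lra.
Qed.

Lemma radialN n mu K a A : radial n mu K a A ->
  radial n mu K (fun r => - a r) (fun r => - A r).
Proof.
move=> [h1 h2 h3 h4]; split.
- by move=> r /h1 h; deq; rewrite mulNr.
- by move=> r /h2 h; deq; rewrite mulrN.
- by move=> r; rewrite normrN; exact: h3.
- by move=> e /h4[d d01 h]; exists d => // r; rewrite normrN; exact: h.
Qed.

(** For mu <= 0 the product a A is nondecreasing. A negative value would persist down to 0 and make
    a^2 blow up by [log_blowup]; hence a^2 is nondecreasing, and it tends to 0 at r = 1. *)
Lemma radial_nonpos n mu K a A : mu <= 0 -> radial n mu K a A ->
  forall r, 0 < r < 1 -> a r = 0.
Proof.
move=> mu0 [da dA aK lim].
have mono x y : 0 < x -> x <= y -> y < 1 -> a x * A x <= a y * A y.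
  move=> x0 xy y1; apply: (@der_ge0_le R x y (fun r => a r * A r)
    (fun r => (A r ^+ 2 + (n%:R ^+ 2 - mu * r ^+ 2) * a r ^+ 2) / r)) xy _ _.
    move=> r /andP[r0' r1']; have r0 : 0 < r by lra.
    have r01 : 0 < r < 1 by apply/andP; split; lra.
    by have h1 := da r r01; have h2 := dA r r01; deq; field; rewrite gt_eqF.
  move=> r /andP[r0' r1']; apply: divr_ge0; last by lra.
  apply: addr_ge0; first exact: sqr_ge0; apply: mulr_ge0; last exact: sqr_ge0.
  have : 0 <= - mu * r ^+ 2 by apply: mulr_ge0; [lra|exact: sqr_ge0].
  have : 0 <= (n%:R : R) ^+ 2 by exact: sqr_ge0.
  lra.
have aA r : 0 < r < 1 -> 0 <= a r * A r.
  move=> /andP[r0 r1]; rewrite leNgt; apply/negP => h.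
  have h2 : 0 < - (2 * (a r * A r)) by lra.
  apply: (@log_blowup (fun r => a r ^+ 2) (fun r => 2 * (a r * A r)) (K ^+ 2) _ r h2 r0).
  - move=> x /andP[x0 xr]; have x01 : 0 < x < 1 by apply/andP; split; lra.
    by have h1 := da x x01; deq; rewrite expr1; field; rewrite gt_eqF.
  - move=> x /andP[x0 xr]; have x01 : 0 < x < 1 by apply/andP; split; lra.
    rewrite normrX lerXn2r ?nnegrE// ?aK// (le_trans _ (aK x x01))//.
  - by move=> x /andP[x0 xr]; rewrite lerN2 ler_pM2l// mono.
move=> r /andP[r0 r1]; apply/eqP; rewrite -normr_le0; apply/ler_addgt0Pr => e e0.
rewrite add0r; have [d /andP[d0 d1] hd] := lim e e0.
pose s := Num.max ((d + 1) / 2) r.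
have sr : r <= s by rewrite le_max lexx orbT.
have s1 : s < 1 by rewrite gt_max r1 andbT; lra.
have sd : d < s by rewrite lt_max; apply/orP; left; lra.
apply: le_trans (hd s _); last by rewrite sd.
rewrite -ler_sqr ?nnegrE// !real_normK ?num_real//.
apply: (@der_ge0_le R r s (fun r => a r ^+ 2) (fun r => 2 * (a r * A r) / r)) sr _ _.
  move=> x /andP[x0' x1']; have x01 : 0 < x < 1 by apply/andP; split; lra.
  by have h1 := da x x01; deq; rewrite expr1; field; rewrite gt_eqF//; lra.
move=> x /andP[x0' x1']; apply: divr_ge0; last by lra.
by apply: mulr_ge0 => //; apply: aA; apply/andP; split; lra.
Qed.

Lemma fJ_scale_der n nu x : 0 < nu -> 0 < x ->
  is_derive x 1 (fun x => fJ n (nu * x)) (fJ1 n (nu * x) / x).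
Proof.
move=> nu0 x0; have nx : nu * x != 0 by rewrite gt_eqF// mulr_gt0.
have d1 : is_derive x 1 (fun x => nu * x) nu by deq; ring.
by apply: der_eq (der_comp d1 (fJ_der n nx)) _; field; rewrite !gt_eqF.
Qed.

Lemma fJ1_scale_der n nu x : 0 < nu -> 0 < x ->
  is_derive x 1 (fun x => fJ1 n (nu * x))
    ((n%:R ^+ 2 - nu ^+ 2 * x ^+ 2) / x * fJ n (nu * x)).
Proof.
move=> nu0 x0; have nx : nu * x != 0 by rewrite gt_eqF// mulr_gt0.
have d1 : is_derive x 1 (fun x => nu * x) nu by deq; ring.
by apply: der_eq (der_comp d1 (fJ1_der n nx)) _; field; rewrite !gt_eqF.
Qed.

Lemma fJ1_0 n : fJ1 n 0 = 0 :> R.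
Proof. by rewrite /fJ1 exprS !mul0r subr0; case: n => [|m]; rewrite ?exprS !(mul0r, mulr0). Qed.

(** The Wronskian is a constant C. Near 0 the term a [fJ1] tends to 0 because a is bounded, so a
    nonzero C would keep A away from 0 with a fixed sign, contrary to [log_blowup]. *)
Lemma radial_wronskian n nu K a A : 0 < nu -> radial n (nu ^+ 2) K a A ->
  forall r, 0 < r < 1 -> a r * fJ1 n (nu * r) = A r * fJ n (nu * r).
Proof.
move=> nu0 rad r r01.
wlog : a A rad / 0 < a r * fJ1 n (nu * r) - A r * fJ n (nu * r).
  move=> W; have [h|h|h] := ltgtP (a r * fJ1 n (nu * r)) (A r * fJ n (nu * r)) => //.
  - have /= := W _ _ (radialN rad); rewrite !mulNr => W'.
    suff : - (a r * fJ1 n (nu * r)) = - (A r * fJ n (nu * r)) by lra.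
    by apply: W'; lra.
  - by have := W _ _ rad; rewrite subr_gt0 => /(_ h).
have [da dA aK _] := rad; set C := _ - _ => C0; exfalso.
have WC x : 0 < x < 1 -> a x * fJ1 n (nu * x) - A x * fJ n (nu * x) = C.
  have D y : 0 < y < 1 -> is_derive y 1
      (fun x => a x * fJ1 n (nu * x) - A x * fJ n (nu * x)) 0.
    move=> y01; have y0 : 0 < y by case/andP: y01.
    have h1 := da y y01; have h2 := dA y y01.
    have h3 := fJ_scale_der n nu0 y0; have h4 := fJ1_scale_der n nu0 y0.
    by deq; field; rewrite gt_eqF.
  move=> /andP[x0 x1]; move: r01 => /andP[r0 r1]; have [xr|rx] := leP x r.
    apply: (@der_eq0_cst R x r (fun x => a x * fJ1 n (nu * x) - A x * fJ n (nu * x)) xr).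
    by move=> y /andP[? ?]; apply: D; apply/andP; split; lra.
  symmetry.
  apply: (@der_eq0_cst R r x (fun x => a x * fJ1 n (nu * x) - A x * fJ n (nu * x)) (ltW rx)).
  by move=> y /andP[? ?]; apply: D; apply/andP; split; lra.
have cf : {for (0 : R), continuous (@fJ R n)}.
  by have h := PJ_der n (0 : R); rewrite /fJ; dcont.
have cf1 : {for (0 : R), continuous (@fJ1 R n)}.
  by have h := PJ_der n (0 : R); have h1 := PJ_der n.+1 (0 : R); rewrite /fJ1; dcont.
have f10 := fJ1_0 n.
pose K1 := Num.max K 1; have K10 : 0 < K1 by rewrite lt_max ltr01 orbT.
pose M := `|fJ n 0| + 1 : R; have M0 : 0 < M by rewrite ltr_wpDl.
have [d d0 hd] : exists2 d, 0 < d & forall x, 0 < x < d ->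
    `|fJ n x| <= M /\ K1 * `|fJ1 n x| <= C / 2.
  have eps : 0 < C / 2 / K1 by rewrite !divr_gt0.
  have /cvgrPdist_le /(_ _ ltr01) := cf; rewrite -nbhs_nearE => /nbhs_ballP[d1 /= d10 h1].
  have /cvgrPdist_le /(_ _ eps) := cf1; rewrite -nbhs_nearE => /nbhs_ballP[d2 /= d20 h2].
  exists (Num.min d1 d2); first by rewrite lt_min d10.
  move=> x /andP[x0]; rewrite lt_min => /andP[x1 x2]; split.
    have := h1 x; rewrite /ball/= sub0r normrN gtr0_norm// => /(_ x1).
    by rewrite distrC => h; have := lerB_dist (fJ n x) (fJ n 0); rewrite /M; lra.
  have := h2 x; rewrite /ball/= sub0r normrN gtr0_norm// => /(_ x2).
  by rewrite f10 sub0r normrN ler_pdivlMr// mulrC.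
(* Up to r0 one has x < 1, nu x < d for the estimates above, and nu x <= 1 < pi / 2 for the
   positivity of [fJ n]. *)
pose r0 := Num.min (1 / 2) (Num.min (d / 2) 1 / nu).
have m0 : 0 < Num.min (d / 2) 1 by rewrite lt_min ltr01 divr_gt0.
have r00 : 0 < r0 by rewrite lt_min !divr_gt0.
have p2 := pihalf_gt1 R.
have c0 : 0 < C / (2 * M) by rewrite divr_gt0 ?mulr_gt0.
apply: (log_blowup (K := K) c0 r00 (q := a) (A := A)).
- move=> x /andP[x0]; rewrite le_min => /andP[x1 _]; apply: da.
  by apply/andP; split; lra.
- move=> x /andP[x0]; rewrite le_min => /andP[x1 _]; apply: aK.
  by apply/andP; split; lra.
move=> x /andP[x0]; rewrite le_min => /andP[x1].
rewrite ler_pdivlMr// mulrC le_min => /andP[x2 x3].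
have x01 : 0 < x < 1 by apply/andP; split; lra.
have nx0 : 0 < nu * x by rewrite mulr_gt0.
have [|b1 b2] := hd (nu * x); first by rewrite nx0; lra.
have gp : 0 < fJ n (nu * x).
  by rewrite mulr_gt0 ?exprn_gt0// PJ_gt0// ltW//=; lra.
rewrite gtr0_norm// in b1.
have b3 : a x * fJ1 n (nu * x) <= C / 2.
  apply: le_trans (ler_norm _) _; rewrite normrM (le_trans _ b2)// ler_wpM2r//.
  by rewrite le_max aK.
have := WC x x01 => E.
have h1 : C / 2 <= - A x * fJ n (nu * x) by lra.
have Ap : 0 <= - A x by nra.
rewrite ler_pdivrMr ?mulr_gt0//; nra.
Qed.

(** The vanishing Wronskian makes (a, A) parallel to ([fJ], [fJ1]). The factor L is an orthogonal
    projection, which avoids a division by [fJ] at its zeros; the norm N is positive since these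
    zeros are simple. *)
Lemma radial_bessel n nu K a A : 0 < nu -> radial n (nu ^+ 2) K a A ->
  exists l, forall r, 0 < r < 1 -> a r = l * fJ n (nu * r).
Proof.
move=> nu0 rad; have W := radial_wronskian nu0 rad; have [da dA _ _] := rad.
pose N r := fJ n (nu * r) ^+ 2 + fJ1 n (nu * r) ^+ 2.
have N0 r : 0 < r -> 0 < N r.
  move=> r0; have nr : 0 < nu * r by rewrite mulr_gt0.
  have [E|E] := eqVneq (PJ n (nu * r)) 0; last first.
    rewrite /N ltr_pwDl ?sqr_ge0// exprn_even_gt0//=; apply: mulf_neq0 => //.
    by rewrite expf_neq0// gt_eqF.
  rewrite /N ltr_wpDl ?sqr_ge0// exprn_even_gt0//= /fJ1 E mulr0 sub0r oppr_eq0.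
  apply: mulf_neq0; last exact: PJ_simple.
  by rewrite mulf_neq0 ?expf_neq0 ?invr_eq0 ?addn1 ?pnatr_eq0// gt_eqF.
pose L r := (a r * fJ n (nu * r) + A r * fJ1 n (nu * r)) / N r.
have aL r : 0 < r < 1 ->
    a r = L r * fJ n (nu * r) /\ A r = L r * fJ1 n (nu * r).
  move=> r01; have r0 : 0 < r by case/andP: r01.
  have Nz : N r != 0 by rewrite gt_eqF// N0.
  have Wr := W r r01; move: Nz; rewrite /L /N.
  move: (a r) (A r) (fJ n (nu * r)) (fJ1 n (nu * r)) Wr => p q g G E Nz.
  split; apply: (mulIf Nz); rewrite mulrAC divfK//.
    rewrite [RHS](_ : _ = p * g ^+ 2 + q * g * G); last by ring.
    by rewrite -E; ring.
  rewrite [RHS](_ : _ = p * G * g + q * G ^+ 2); last by ring.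
  by rewrite E; ring.
have dL r : 0 < r < 1 -> is_derive r 1 L 0.
  move=> r01; have r0 : 0 < r by case/andP: r01.
  have rz : r != 0 by rewrite gt_eqF.
  have Nz : N r != 0 by rewrite gt_eqF// N0.
  have [e1 e2] := aL r r01.
  have h1 := da r r01; have h2 := dA r r01.
  have h3 := fJ_scale_der n nu0 r0; have h4 := fJ1_scale_der n nu0 r0.
  have h5 : is_derive r 1 N (2 * fJ n (nu * r) * fJ1 n (nu * r) / r +
      2 * fJ1 n (nu * r) * ((n%:R ^+ 2 - nu ^+ 2 * r ^+ 2) / r * fJ n (nu * r))).
    by rewrite /N; deq; rewrite !expr1; field.
  rewrite /L; deq; rewrite e1 e2; move: Nz; rewrite /N.
  move: (L r) (fJ n (nu * r)) (fJ1 n (nu * r)) => l g G Nz.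
  by field; rewrite Nz rz.
exists (L (1 / 2)) => r r01; rewrite (aL r r01).1; congr (_ * _).
have [h|h] := leP r (1 / 2).
  apply: (der_eq0_cst h) => x /andP[x0 x1]; apply: dL.
  by case/andP: r01 => ? ?; apply/andP; split; lra.
symmetry; apply: (der_eq0_cst (ltW h)) => x /andP[x0 x1]; apply: dL.
by case/andP: r01 => ? ?; apply/andP; split; lra.
Qed.

(** Letting r tend to 1 in [radial_bessel] gives l [fJ n nu] = 0. *)
Lemma radial_zero_bd n nu K a A : 0 < nu -> radial n (nu ^+ 2) K a A ->
  PJ n nu != 0 -> forall x, 0 < x < 1 -> a x = 0.
Proof.
move=> nu0 rad hnu; have [l hl] := radial_bessel nu0 rad.
suff l0 : l = 0 by move=> x /hl->; rewrite l0 mul0r.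
have [_ _ _ lim] := rad.
have g0 : 0 < `|fJ n nu| by rewrite normr_gt0 mulf_neq0// expf_neq0// gt_eqF.
have cg : {for (1 : R), continuous (fun x => fJ n (nu * x))}.
  exact: der_cont (fJ_scale_der n nu0 ltr01).
apply/eqP; rewrite -normr_le0 -(pmulr_lle0 _ g0) -normrM; apply/ler_addgt0Pr => e e0.
rewrite add0r; have e2 : 0 < e / 2 by lra.
have l1 : 0 < `|l| + 1 by rewrite ltr_wpDl.
have [d /andP[d0 d1] hd] := lim _ e2.
have /cvgrPdist_le /(_ _ (divr_gt0 e2 l1)) := cg.
rewrite -nbhs_nearE => /nbhs_ballP[d' /= d'0 h'].
pose x := Num.max ((d + 1) / 2) (1 - d' / 2).
have x1 : x < 1 by rewrite gt_max; apply/andP; split; lra.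
have xd : d < x by rewrite lt_max; apply/orP; left; lra.
have xd' : 1 - d' < x by rewrite lt_max; apply/orP; right; lra.
have := h' x; rewrite /ball/= gtr0_norm ?subr_gt0// mulr1 => h1.
have {}h1 : `|fJ n nu - fJ n (nu * x)| <= e / 2 / (`|l| + 1) by apply: h1; lra.
have x01 : 0 < x < 1 by rewrite x1 (lt_trans d0 xd).
have := hd x; rewrite xd x1 => /(_ isT); rewrite hl// => h2.
rewrite (_ : l * fJ n nu = l * fJ n (nu * x) + l * (fJ n nu - fJ n (nu * x))); last by ring.
apply: le_trans (ler_normD _ _) _; rewrite [X in _ + X]normrM.
have : `|l| * `|fJ n nu - fJ n (nu * x)| <= e / 2.
  rewrite ler_pdivlMr// in h1; apply: le_trans h1; rewrite mulrC.
  by rewrite ler_wpM2l// lerDl.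
lra.
Qed.
End RadialEquation.

(** * Polar coordinates and Fourier coefficients *)

Section DiskCalculus.
Variable R : realType.
Implicit Types (f w wx wy : R * R -> R) (p : R * R) (x y r t e s : R).

Lemma near_ball2 (P : R * R -> Prop) p : (\forall q \near p, P q) ->
  exists2 d : R, 0 < d & forall x y, `|x - p.1| < d -> `|y - p.2| < d -> P (x, y).
Proof.
rewrite -nbhs_nearE => /nbhs_ballP[d /= d0 h]; exists d => // x y hx hy.
by apply: h; split; rewrite /ball/= distrC.
Qed.

Lemma open_disk_near p : open_disk p -> \forall q \near p, open_disk q.
Proof.
rewrite /open_disk/= => hp.
have c : {for p, continuous (fun q : R * R => q.1 ^+ 2 + q.2 ^+ 2)}.
  have -> : (fun q : R * R => q.1 ^+ 2 + q.2 ^+ 2) = (fun q => q.1 * q.1 + q.2 * q.2).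
    by apply/funext => q; rewrite !expr2.
  by apply: cvgD; apply: cvgM; try exact: cvg_fst; exact: cvg_snd.
by have /cvgr_lt := c; apply.
Qed.

(** The partial derivatives are arguments, so that explicit formulas can be supplied for them, as
    for the Euler field in [radial_coef]. *)
Definition C1 w wx wy := forall p, open_disk p ->
  [/\ {for p, continuous wx}, {for p, continuous wy},
      is_derive p.1 1 (fun t => w (t, p.2)) (wx p) &
      is_derive p.2 1 (fun t => w (p.1, t)) (wy p)].

Lemma derive_dirx f p : derivable f p (dirx R) ->
  is_derive p.1 1 (fun t => f (t, p.2)) ('D_(dirx R) f p).
Proof.
case: p => x y /= h.
have E : (fun h => h^-1 *: ((f \o shift (x, y)) (h *: dirx R) - f (x, y))) =
    (fun h => h^-1 *: (((fun t => f (t, y)) \o shift x) (h *: (1 : R)) - f (x, y))).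
  apply/funext => e /=; congr (_ *: (f _ - _)).
  by rewrite /dirx; congr pair => /=; rewrite /GRing.scale/= ?mulr0 ?add0r.
by apply: DeriveDef; rewrite /derivable /derive -E.
Qed.

Lemma derive_diry f p : derivable f p (diry R) ->
  is_derive p.2 1 (fun t => f (p.1, t)) ('D_(diry R) f p).
Proof.
case: p => x y /= h.
have E : (fun h => h^-1 *: ((f \o shift (x, y)) (h *: diry R) - f (x, y))) =
    (fun h => h^-1 *: (((fun t => f (x, t)) \o shift y) (h *: (1 : R)) - f (x, y))).
  apply/funext => e /=; congr (_ *: (f _ - _)).
  by rewrite /diry; congr pair => /=; rewrite /GRing.scale/= ?mulr0 ?add0r.
by apply: DeriveDef; rewrite /derivable /derive -E.
Qed.

Lemma Ck1_C1 f : Ck 1 (@open_disk R) f -> 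
  C1 f (fun p => 'D_(dirx R) f p) (fun p => 'D_(diry R) f p).
Proof.
move=> [_ [d [[c1 _] [c2 _]]]] p hp; have [d1 d2] := d p hp; split.
- exact: c1.
- exact: c2.
- exact: derive_dirx.
- exact: derive_diry.
Qed.

(** By the mean value theorem the quotient is a partial derivative at a point still close to (x, y),
    uniformly in the second variable. It is applied with the variables in either order. *)
Lemma partial_quotient (g gd : R -> R -> R) x y :
  (forall e, 0 < e -> exists2 d, 0 < d &
    forall x' y', `|x' - x| < d -> `|y' - y| < d ->
      is_derive x' 1 (fun t => g t y') (gd x' y') /\ `|gd x' y' - gd x y| <= e) ->
  forall e, 0 < e -> exists2 d, 0 < d &
    forall x' y', `|x' - x| < d -> `|y' - y| < d -> x' != x ->
      `|(g x' y' - g x y') / (x' - x) - gd x y| <= e.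
Proof.
move=> H e e0; have [d d0 hd] := H e e0; exists d => // x' y' hx hy nx.
have key a b : `|a - x| < d -> `|b - x| < d -> a < b ->
    exists2 c, `|c - x| < d & (g b y' - g a y') / (b - a) = gd c y'.
  rewrite !ltr_norml => /andP[a1 a2] /andP[b1 b2] ab.
  have in_ c : a <= c <= b -> `|c - x| < d.
    by move=> /andP[c1 c2]; rewrite ltr_norml; apply/andP; split; lra.
  have [c cc|c /andP[c1 c2] E] := @der_MVT R a b (fun t => g t y') (gd ^~ y') ab.
    by have [] := hd c y' (in_ c cc) hy.
  exists c; first by apply: in_; rewrite !ltW.
  by rewrite E mulfK// subr_eq0 gt_eqF.
have x0 : `|x - x| < d by rewrite subrr normr0.
have [c cd ->] : exists2 c, `|c - x| < d & (g x' y' - g x y') / (x' - x) = gd c y'.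
  have [h|h|h] := ltgtP x' x; last by rewrite h eqxx in nx.
  - have [c cd E] := key x' x hx x0 h; exists c => //; rewrite -E.
    by rewrite -opprB -[X in _ / X]opprB invrN mulrNN.
  - exact: key.
by have [] := hd c y' cd hy.
Qed.

Lemma chain_rule w wx wy (X Y : R -> R) s dX dY : C1 w wx wy ->
  open_disk (X s, Y s) -> is_derive s 1 X dX -> is_derive s 1 Y dY ->
  is_derive s 1 (fun s => w (X s, Y s))
    (wx (X s, Y s) * dX + wy (X s, Y s) * dY).
Proof.
move=> c1 hp hX hY; have [cx cy _ _] := c1 _ hp.
set p := (X s, Y s) in hp cx cy *.
have Hx e : 0 < e -> exists2 d, 0 < d & forall x y, `|x - p.1| < d -> `|y - p.2| < d ->
    is_derive x 1 (fun t => w (t, y)) (wx (x, y)) /\ `|wx (x, y) - wx p| <= e.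
  move=> e0; have /cvgrPdist_le /(_ e e0) h1 := cx.
  have [d d0 hd] := near_ball2 (filterI (open_disk_near hp) h1).
  exists d => // x y hx hy; have [h2 h3] := hd x y hx hy.
  by split; [case: (c1 _ h2)|rewrite distrC].
have Hy e : 0 < e -> exists2 d, 0 < d & forall y x, `|y - p.2| < d -> `|x - p.1| < d ->
    is_derive y 1 (fun t => w (x, t)) (wy (x, y)) /\ `|wy (x, y) - wy p| <= e.
  move=> e0; have /cvgrPdist_le /(_ e e0) h1 := cy.
  have [d d0 hd] := near_ball2 (filterI (open_disk_near hp) h1).
  exists d => // y x hy hx; have [h2 h3] := hd x y hx hy.
  by split; [case: (c1 _ h2)|rewrite distrC].
have qx := @partial_quotient (fun x y => w (x, y)) (fun x y => wx (x, y)) p.1 p.2 Hx.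
have qy := @partial_quotient (fun y x => w (x, y)) (fun y x => wy (x, y)) p.2 p.1 Hy.
have shift (Z : R -> R) dZ : is_derive s 1 Z dZ ->
    Z (h + s) @[h --> 0^'] --> Z s /\ h^-1 * (Z (h + s) - Z s) @[h --> 0^'] --> dZ.
  move=> hZ; split.
    have /cvgrPdist_lt cZ := der_cont hZ; apply/cvgrPdist_lt => e /cZ.
    rewrite -nbhs_nearE => /nbhs_ballP[d /= d0 hd]; near=> h; apply: hd.
    rewrite /ball/= opprD addrCA subrr addr0 normrN.
    by near: h; exact: dnbhs0_lt.
  case: hZ => h1 <-; move: h1; rewrite /derivable /derive.
  by under eq_fun do rewrite scaler1.
have [cX dX'] := shift X dX hX; have [cY dY'] := shift Y dY hY.
(* The increment is split at (X s, Y (h + s)). The default values keep A times the increment of X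
   correct when that increment is 0, and keep A continuous in the limit; likewise for B. *)
pose A h := if X (h + s) == X s then wx p else
  (w (X (h + s), Y (h + s)) - w (X s, Y (h + s))) / (X (h + s) - X s).
pose B h := if Y (h + s) == Y s then wy p else
  (w (X s, Y (h + s)) - w (X s, Y s)) / (Y (h + s) - Y s).
have cA : A h @[h --> 0^'] --> wx p.
  apply/cvgrPdist_le => e e0; have [d d0 hd] := qx e e0.
  have /cvgrPdist_lt/(_ d d0) nX := cX; have /cvgrPdist_lt/(_ d d0) nY := cY.
  near=> h; rewrite /A; case: eqVneq => E; first by rewrite subrr normr0 ltW.
  rewrite distrC; apply: hd => //; rewrite distrC; first by near: h.
  by near: h.
have cB : B h @[h --> 0^'] --> wy p.
  apply/cvgrPdist_le => e e0; have [d d0 hd] := qy e e0.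
  have /cvgrPdist_lt/(_ d d0) nY := cY.
  near=> h; rewrite /B; case: eqVneq => E; first by rewrite subrr normr0 ltW.
  rewrite distrC; apply: hd => //; last by rewrite subrr normr0.
  by rewrite distrC; near: h.
have L : h^-1 *: (w (X (h + s), Y (h + s)) - w (X s, Y s)) @[h --> 0^'] -->
    wx p * dX + wy p * dY.
  rewrite [X in X @ _ --> _](_ : _ = fun h => A h * (h^-1 * (X (h + s) - X s)) +
      B h * (h^-1 * (Y (h + s) - Y s))).
    by apply: cvgD; apply: cvgM.
  apply/funext => h; rewrite /A /B /GRing.scale/=.
  have E a d k : d != 0 -> a / d * (k * d) = k * a :> R by move=> ?; rewrite mulrCA divfK.
  case: eqVneq => [->|EX]; case: eqVneq => [->|EY];
    rewrite ?E ?subr_eq0// ?subrr ?mulr0 ?addr0 ?add0r// -mulrDr; congr (_ * _); ring.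
apply: DeriveDef.
  apply/cvg_ex; exists (wx p * dX + wy p * dY).
  by under eq_fun do rewrite scaler1.
by apply/cvg_lim => //; under eq_fun do rewrite scaler1.
Unshelve. all: by end_near. Qed.
End DiskCalculus.

(** * Functions on the disk in polar coordinates *)

Section PolarCoordinates.
Variable R : realType.
Implicit Types (f w wx wy u : R * R -> R) (p : R * R) (x y r t e s v : R).

Definition polar r t : R * R := (r * cos t, r * sin t).

Lemma polar_sqr r t : (polar r t).1 ^+ 2 + (polar r t).2 ^+ 2 = r ^+ 2.
Proof. by rewrite /= !exprMn -mulrDr cos2Dsin2 mulr1. Qed.

Lemma polar_disk r t : 0 <= r < 1 -> open_disk (polar r t).
Proof.
move=> /andP[r0 r1]; rewrite /open_disk; have := polar_sqr r t; rewrite /= => ->.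
by rewrite expr_lt1.
Qed.

Lemma polar_surj p : exists r t, [/\ 0 <= r, 0 <= t <= 2 * pi & p = polar r t].
Proof.
case: p => x y; have pi0 := pi_gt0 R.
pose r := Num.sqrt (x ^+ 2 + y ^+ 2); have r0 : 0 <= r by exact: sqrtr_ge0.
have r2 : r ^+ 2 = x ^+ 2 + y ^+ 2 by rewrite sqr_sqrtr// addr_ge0 ?sqr_ge0.
have [E|nr] := eqVneq r 0.
  exists 0, 0; split => //; first by rewrite lexx/= mulr_ge0// ltW.
  move: r2; rewrite E expr0n/= => /esym/eqP.
  rewrite paddr_eq0 ?sqr_ge0// !sqrf_eq0 => /andP[/eqP-> /eqP->].
  by rewrite /polar !mul0r.
have rp : 0 < r by rewrite lt_neqAle eq_sym nr.
have q : -1 <= x / r <= 1.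
  rewrite -ler_norml normrM normfV (gtr0_norm rp) ler_pdivrMr// mul1r.
  rewrite -(gtr0_norm rp) -[leLHS]sqrtr_sqr -[leRHS]sqrtr_sqr ler_sqrt ?sqr_ge0//.
  by rewrite r2 lerDl sqr_ge0.
have c := acosK q; have s0 := sin_ge0_pi (x := acos (x / r)).
have {}s0 : 0 <= sin (acos (x / r)) by apply: s0; rewrite acos_ge0 ?acos_lepi.
have s2 : sin (acos (x / r)) ^+ 2 = (y / r) ^+ 2.
  rewrite sin2cos2 c !expr_div_n r2; field; rewrite -r2 expf_neq0//.
have xr : x = r * (x / r) by field.
have [y0|y0] := leP 0 y.
  exists r, (acos (x / r)); split=> //.
    by rewrite acos_ge0//= (le_trans (acos_lepi q))//; lra.
  rewrite /polar c -xr; congr pair; apply/eqP; rewrite -(@eqrXn2 _ 2)// ?mulr_ge0//.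
  by rewrite exprMn s2 expr_div_n; apply/eqP; field.
exists r, (pi *+ 2 - acos (x / r)); split=> //.
  by have := acos_ge0 q; have := acos_lepi q; rewrite mulr2n => ? ?; apply/andP; split; lra.
have per h : cos (pi *+ 2 - h) = cos h :> R by rewrite addrC cosD2pi cosN.
have pers h : sin (pi *+ 2 - h) = - sin h :> R by rewrite addrC sinD2pi sinN.
rewrite /polar per pers c -xr; congr pair; apply: oppr_inj; rewrite -mulrN opprK.
apply/eqP; rewrite -(@eqrXn2 _ 2)// ?mulr_ge0// ?oppr_ge0 ?ltW//.
by rewrite exprMn s2 expr_div_n sqrrN; apply/eqP; field.
Qed.

Lemma polar_dr w wx wy r t : C1 w wx wy -> 0 <= r < 1 ->
  is_derive r 1 (fun r => w (polar r t))
    (wx (polar r t) * cos t + wy (polar r t) * sin t).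
Proof.
move=> c1 r01; have d1 : is_derive r 1 (fun r => r * cos t) (cos t) by deq; ring.
have d2 : is_derive r 1 (fun r => r * sin t) (sin t) by deq; ring.
exact: (@chain_rule R w wx wy (fun r => r * cos t) (fun r => r * sin t) r _ _ c1
  (polar_disk t r01) d1 d2).
Qed.

Lemma polar_dt w wx wy r t : C1 w wx wy -> 0 <= r < 1 ->
  is_derive t 1 (fun t => w (polar r t))
    (wx (polar r t) * (- (r * sin t)) + wy (polar r t) * (r * cos t)).
Proof.
move=> c1 r01; have d1 : is_derive t 1 (fun t => r * cos t) (- (r * sin t)) by deq; ring.
have d2 : is_derive t 1 (fun t => r * sin t) (r * cos t) by deq; ring.
exact: (@chain_rule R w wx wy (fun t => r * cos t) (fun t => r * sin t) t _ _ c1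
  (polar_disk t r01) d1 d2).
Qed.

Lemma polar_cont f r : (forall p, open_disk p -> {for p, continuous f}) ->
  0 <= r < 1 -> continuous (fun t => f (polar r t)).
Proof.
move=> cf r01 t; apply: (@continuous_comp _ _ _ (polar r) f).
  have c1 : r * cos s @[s --> t] --> r * cos t.
    by apply: (der_cont (f := fun t => r * cos t) (df := - (r * sin t))); deq; ring.
  have c2 : r * sin s @[s --> t] --> r * sin t.
    by apply: (der_cont (f := fun t => r * sin t) (df := r * cos t)); deq; ring.
  exact: (cvg_pair c1 c2).
exact: cf (polar_disk t r01).
Qed.

Let sq p : R := p.1 ^+ 2 + p.2 ^+ 2.

Let sq_cont : continuous sq.
Proof.
move=> p; have -> : sq = (fun q : R * R => q.1 * q.1 + q.2 * q.2).
  by apply/funext => q; rewrite /sq !expr2.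
by apply: cvgD; apply: cvgM; try exact: cvg_fst; exact: cvg_snd.
Qed.

Lemma disk_closed v : closed [set p : R * R | p.1 ^+ 2 + p.2 ^+ 2 <= v].
Proof.
apply: (@preimage_closed _ _ sq [set y | y <= v]); last exact: closed_le.
by move=> p _; exact: sq_cont.
Qed.

Lemma disk_compact v : compact [set p : R * R | p.1 ^+ 2 + p.2 ^+ 2 <= v].
Proof.
pose b := Num.sqrt v.
apply: (@subclosed_compact _ _ (`[- b, b] `*` `[- b, b])).
- exact: disk_closed.
- by apply: compact_setX; exact: segment_compact.
- move=> [x y] /= h; rewrite !in_itv/= -!ler_norml.
  have x0 : 0 <= x ^+ 2 by exact: sqr_ge0.
  have y0 : 0 <= y ^+ 2 by exact: sqr_ge0.
  by rewrite -!sqrtr_sqr !ler_sqrt//; first split; lra.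
Qed.

Lemma disk_bounded f v : 0 <= v ->
  {within [set p : R * R | p.1 ^+ 2 + p.2 ^+ 2 <= v], continuous f} ->
  exists M : R, forall p, p.1 ^+ 2 + p.2 ^+ 2 <= v -> `|f p| <= M.
Proof.
move=> v0 cf; set D := [set p | _] in cf.
have ne : D !=set0 by exists (0, 0); rewrite /D/= expr0n/= addr0.
have cn : {within D, continuous (fun p => `|f p|)}.
  by move=> p; apply: continuous_comp; [exact: cf|exact: norm_continuous].
have [c _ hc] := compact_EVT_max ne (@disk_compact v) cn.
by exists `|f c| => p hp; apply: hc; rewrite inE.
Qed.

Lemma polar_bounded f v : (forall p, open_disk p -> {for p, continuous f}) ->
  0 <= v < 1 -> exists M : R, forall r t, 0 <= r <= v -> `|f (polar r t)| <= M.
Proof.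
move=> cf /andP[v0 v1]; have [|M hM] := @disk_bounded f (v ^+ 2) (sqr_ge0 v).
  apply: continuous_in_subspaceT => p; rewrite inE/= => hp; apply: cf.
  by rewrite /open_disk/= (le_lt_trans hp)// expr_lt1.
exists M => r t /andP[r0 rv]; apply: hM; rewrite polar_sqr.
by rewrite lerXn2r// nnegrE (le_trans r0).
Qed.

(** Uniformity in the angle comes from compactness: the points of the closed disk with |u| >= e form
    a compact set that misses the circle, so their distance to the origin has a maximum less than
    1. *)
Lemma vanishing_boundary u : {within @closed_disk R, continuous u} ->
  (forall p, unit_circle p -> u p = 0) ->
  forall e, 0 < e -> exists2 d : R, 0 < d < 1 &
    forall r t, d < r < 1 -> `|u (polar r t)| <= e.
Proof.
move=> cu u0 e e0; pose K := [set p | e <= `|u p|] `&` @closed_disk R.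
have cD : closed (@closed_disk R) by exact: disk_closed.
have cn : {within @closed_disk R, continuous (fun p => `|u p|)}.
  by move=> p; apply: continuous_comp; [exact: cu|exact: norm_continuous].
have cK : closed K.
  have /continuous_closedP/(_ [set y | e <= y]) := cn.
  move=> /(_ (@closed_ge _ e))/closed_subspaceP[V cV VE].
  by rewrite /K -[X in X `&` _]/((fun p => `|u p|) @^-1` [set y | e <= y]) -VE; exact: closedI.
have kK : compact K.
  by apply: (subclosed_compact cK (@disk_compact 1)) => p [].
have [K0|/set0P ne] := eqVneq K set0.
  exists (1 / 2); first by apply/andP; split; lra.
  move=> r t /andP[r0 r1]; rewrite leNgt; apply/negP => h.
  suff : K (polar r t) by rewrite K0.
  split; first exact: ltW.
  by rewrite /closed_disk/=; have := polar_sqr r t; rewrite /= => ->; rewrite expr_le1 ?ltW//; lra.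
have cs : {within K, continuous sq} by apply: continuous_subspaceT; exact: sq_cont.
have [c cKc hc] := compact_EVT_max ne kK cs.
have [c1 c2] : K c by move: cKc; rewrite inE.
have c3 : sq c < 1.
  rewrite lt_neqAle c2 andbT; apply/eqP => E.
  by move: c1; rewrite /= (u0 c E) normr0; lra.
have sc : 0 <= sq c by rewrite addr_ge0 ?sqr_ge0.
exists (Num.max (1 / 2) (Num.sqrt (sq c))).
  rewrite lt_max gt_max; apply/andP; split; first by apply/orP; left; lra.
  by apply/andP; split; [lra|rewrite -sqrtr1 ltr_sqrt].
move=> r t /andP[]; rewrite gt_max => /andP[r0 rc] r1; rewrite leNgt; apply/negP => h.
have hK : K (polar r t).
  split; first exact: ltW.
  by rewrite /closed_disk/=; have := polar_sqr r t; rewrite /= => ->; rewrite expr_le1 ?ltW//; lra.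
have := hc (polar r t); rewrite inE => /(_ hK); rewrite /sq polar_sqr leNgt => /negP; apply.
have rp : 0 < r by lra.
by rewrite -(gtr0_norm rp) -sqrtr_sqr ltr_sqrt ?exprn_gt0// in rc.
Qed.
End PolarCoordinates.

(** * Fourier coefficients of an eigenfunction *)

Section FourierCoefficients.
Variable R : realType.
Implicit Types (f u : R * R -> R) (p : R * R) (r t e mu K : R) (n : nat).
Implicit Types (c dc : R -> R).

(** An angular mode c'' = - n^2 c with derivative dc; the equal values at 0 and 2 pi cancel the
    boundary terms of the integration by parts in the angle. *)
Definition angular n c dc := [/\
  forall t, is_derive t 1 c (dc t),
  forall t, is_derive t 1 dc (- n%:R ^+ 2 * c t),
  c (2 * pi) = c 0, dc (2 * pi) = dc 0 & forall t, `|c t| <= 1].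

Definition coef u c r : R := Int 0 (2 * pi) (fun t => u (polar r t) * c t).

Lemma twopi_ge0 : 0 <= 2 * pi :> R.
Proof. by rewrite mulr_ge0// pi_ge0. Qed.

Lemma coef_der f fx fy c r : C1 f fx fy ->
  (forall p, open_disk p -> {for p, continuous f}) ->
  continuous c -> (forall t, `|c t| <= 1) -> 0 < r < 1 ->
  is_derive r 1 (coef f c) (Int 0 (2 * pi)
    (fun t => (fx (polar r t) * cos t + fy (polar r t) * sin t) * c t)).
Proof.
move=> c1 cf cc cb /andP[r0 r1]; pose v := (r + 1) / 2.
have v01 : 0 <= v < 1 by rewrite /v; apply/andP; split; lra.
have cfx p : open_disk p -> {for p, continuous fx} by case/c1.
have cfy p : open_disk p -> {for p, continuous fy} by case/c1.
have [M1 h1] := polar_bounded cfx v01; have [M2 h2] := polar_bounded cfy v01.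
apply: (@Int_derive R 0 (2 * pi) 0 v _
  (fun r t => (fx (polar r t) * cos t + fy (polar r t) * sin t) * c t) r (M1 + M2)).
- exact: twopi_ge0.
- by rewrite r0 /v/=; lra.
- move=> y /andP[y0 y1] t; apply: cvgM; last exact: cc.
  by apply: polar_cont => //; apply/andP; split; case/andP: v01; lra.
- move=> y t /andP[y0 y1] _; have y01 : 0 <= y < 1 by case/andP: v01 => *; apply/andP; split; lra.
  have h := polar_dr t c1 y01; deq; ring.
- move=> y t /andP[y0 y1] _; have y01 : 0 <= y <= v by apply/andP; split; lra.
  rewrite normrM -[leRHS]mulr1 ler_pM//.
  apply: le_trans (ler_normD _ _) _; rewrite !normrM lerD//.
    by rewrite (le_trans _ (h1 y t y01))// ler_piMr// cos_max.
  by rewrite (le_trans _ (h2 y t y01))// ler_piMr// sin_max.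
Qed.

Lemma coef_norm_le f c r e : continuous (fun t => f (polar r t)) ->
  continuous c -> (forall t, `|c t| <= 1) -> (forall t, `|f (polar r t)| <= e) ->
  `|coef f c r| <= e * (2 * pi).
Proof.
move=> cf cc cb hf; rewrite -[X in _ * X]subr0; apply: Int_norm_le.
- exact: twopi_ge0.
- by move=> t; apply: cvgM; [exact: cf|exact: cc].
- move=> t _; rewrite normrM (le_trans _ (hf t))// ler_piMr//.
Qed.

Lemma eigenfunction_C2 u mu : dirichlet_eigenspace mu u ->
  exists ux uy uxx uxy uyx uyy : R * R -> R,
  [/\ C1 u ux uy, C1 ux uxx uxy, C1 uy uyx uyy,
      forall p, open_disk p ->
        [/\ {for p, continuous u}, {for p, continuous ux} & {for p, continuous uy}] &
      forall p, open_disk p -> - (uxx p + uyy p) = mu * u p].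
Proof.
move=> [_ [cu [d1 [ckx cky]]] eqn _].
have Cx := Ck1_C1 ckx; have Cy := Ck1_C1 cky.
case: ckx => cux _; case: cky => cuy _.
do 6 eexists; split; [|exact: Cx|exact: Cy| |exact: eqn]; last first.
  by move=> p hp; split; [exact: cu|exact: cux|exact: cuy].
move=> p hp; have [h1 h2] := d1 p hp; split.
- exact: cux.
- exact: cuy.
- exact: derive_dirx.
- exact: derive_diry.
Qed.

(** Separation of variables: the Laplacian is integrated against the mode c over a circle, and two
    integrations by parts turn the second angular derivative into - n^2. The companion A is the
    coefficient of r times the radial derivative of u. *)
Lemma radial_coef u mu n c dc : dirichlet_eigenspace mu u -> angular n c dc ->
  exists K A, radial n mu K (coef u c) A.
Proof.
move=> E_ [hc hdc pc pdc cb]; have [cu _ _ bd] := E_.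
have [ux [uy [uxx [uxy [uyx [uyy [Cu Cx Cy cu_ eqn]]]]]]] := eigenfunction_C2 E_.
have cu' p : open_disk p -> {for p, continuous u} by case/cu_.
have cux p : open_disk p -> {for p, continuous ux} by case/cu_.
have cuy p : open_disk p -> {for p, continuous uy} by case/cu_.
have cc : continuous c by move=> t; exact: der_cont (hc t).
have pi0 := twopi_ge0.
(* The Euler field applied to u, that is r times its radial derivative. *)
pose w p := p.1 * ux p + p.2 * uy p.
pose wx p := ux p + p.1 * uxx p + p.2 * uyx p.
pose wy p := p.1 * uxy p + uy p + p.2 * uyy p.
have c1 : continuous (fun p : R * R => p.1) by move=> p; exact: cvg_fst.
have c2 : continuous (fun p : R * R => p.2) by move=> p; exact: cvg_snd.
have cw p : open_disk p -> {for p, continuous w}.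
  move=> hp; apply: cvgD; apply: cvgM; by [exact: c1|exact: c2|exact: cux|exact: cuy].
have Cw : C1 w wx wy.
  move=> p hp; have [h1 h2 h3 h4] := Cx p hp; have [k1 k2 k3 k4] := Cy p hp; split.
  - apply: cvgD; last by apply: cvgM; [exact: c2|exact: k1].
    by apply: cvgD; [exact: cux|apply: cvgM; [exact: c1|exact: h1]].
  - apply: cvgD; last by apply: cvgM; [exact: c2|exact: k2].
    by apply: cvgD; [apply: cvgM; [exact: c1|exact: h2]|exact: cuy].
  - by rewrite /w /wx /=; deq; case: (p) => x y /=; ring.
  - by rewrite /w /wy /=; deq; case: (p) => x y /=; ring.
have [M hM] := @disk_bounded R u 1 ler01 cu.
exists (M * (2 * pi)), (coef w c); split.
- move=> r r01; have r0 : 0 < r by case/andP: r01.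
  have r01' : 0 <= r < 1 by case/andP: r01 => *; apply/andP; split; lra.
  apply: der_eq (coef_der Cu cu' cc cb r01) _.
  have cwc : continuous (fun t => w (polar r t) * c t).
    by move=> t; apply: cvgM; [exact: polar_cont|exact: cc].
  rewrite [RHS]mulrC /coef -IntZ//; apply: Int_ext => t _.
  by rewrite /w /polar /=; field; rewrite gt_eqF.
- move=> r r01; have r0 : 0 < r by case/andP: r01.
  have r01' : 0 <= r < 1 by case/andP: r01 => *; apply/andP; split; lra.
  apply: der_eq (coef_der Cw cw cc cb r01) _.
  have rz : r != 0 by rewrite gt_eqF.
  (* S and dS are the first and second angular derivatives of u on the circle of radius r. *)
  pose S t := ux (polar r t) * (- (r * sin t)) + uy (polar r t) * (r * cos t).
  pose dS t := (uxx (polar r t) * (- (r * sin t)) + uxy (polar r t) * (r * cos t)) * (- (r * sin t))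
    - ux (polar r t) * (r * cos t)
    + (uyx (polar r t) * (- (r * sin t)) + uyy (polar r t) * (r * cos t)) * (r * cos t)
    - uy (polar r t) * (r * sin t).
  have hS t : is_derive t 1 S (dS t).
    have h1 := polar_dt t Cx r01'; have h2 := polar_dt t Cy r01'.
    by rewrite /S; deq; rewrite /dS; ring.
  have hU t := polar_dt t Cu r01'.
  (* The boundary term of both integrations by parts at once: its derivative is dS c + n^2 u c, and
     it takes equal values at 0 and 2 pi. *)
  pose F t := S t * c t - u (polar r t) * dc t.
  have hF t : is_derive t 1 F (dS t * c t + n%:R ^+ 2 * (u (polar r t) * c t)).
    have h1 := hS t; have h2 := hU t; have h3 := hc t; have h4 := hdc t.
    by rewrite /F; deq; rewrite /S; ring.
  have per t : polar r (2 * pi) = polar r 0 by rewrite /polar mulr_natl cos2pi sin2pi cos0 sin0.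
  have F0 : F (2 * pi) - F 0 = 0.
    rewrite /F /S (per 0) pc pdc mulr_natl cos2pi sin2pi cos0 sin0; ring.
  have cU : continuous (fun t => u (polar r t) * c t).
    by move=> t; apply: cvgM; [exact: polar_cont|exact: cc].
  have cP (g : R * R -> R) : (forall p, open_disk p -> {for p, continuous g}) ->
      continuous (fun t => g (polar r t)).
    by move=> cg; exact: polar_cont.
  have cxx : continuous (fun t => uxx (polar r t)) by apply: cP => p /Cx[].
  have cxy : continuous (fun t => uxy (polar r t)) by apply: cP => p /Cx[].
  have cyx : continuous (fun t => uyx (polar r t)) by apply: cP => p /Cy[].
  have cyy : continuous (fun t => uyy (polar r t)) by apply: cP => p /Cy[].
  have crs : continuous (fun t => r * sin t) by move=> t; dcont.
  have crs' : continuous (fun t => - (r * sin t)) by move=> t; dcont.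
  have crc : continuous (fun t => r * cos t) by move=> t; dcont.
  have cpx := cP _ cux; have cpy := cP _ cuy.
  have cdS : continuous (fun t => dS t * c t).
    move=> t; apply: cvgM; last exact: cc.
    apply: cvgB; last by apply: cvgM; [exact: cpy|exact: crs].
    apply: cvgD.
      apply: cvgB; last by apply: cvgM; [exact: cpx|exact: crc].
      apply: cvgM; last exact: crs'.
      by apply: cvgD; apply: cvgM; by [exact: cxx|exact: crs'|exact: cxy|exact: crc].
    apply: cvgM; last exact: crc.
    by apply: cvgD; apply: cvgM; by [exact: cyx|exact: crs'|exact: cyy|exact: crc].
  have cnU : continuous (fun t => n%:R ^+ 2 * (u (polar r t) * c t)).
    by move=> t; apply: cvgM; [exact: cvg_cst|exact: cU].
  have I1 : Int 0 (2 * pi) (fun t => dS t * c t) + n%:R ^+ 2 * coef u c r = 0.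
    rewrite /coef -IntZ// -IntD// -[RHS]F0; apply: Int_FTC => //.
    by move=> t; apply: cvgD; [exact: cdS|exact: cnU].
  have -> : (n%:R ^+ 2 - mu * r ^+ 2) / r * coef u c r =
      - (mu * r) * coef u c r - r^-1 * Int 0 (2 * pi) (fun t => dS t * c t).
    have -> : Int 0 (2 * pi) (fun t => dS t * c t) = - (n%:R ^+ 2 * coef u c r).
      by apply/eqP; rewrite -addr_eq0 I1.
    by field.
  rewrite /coef -!IntZ// -IntB//; last 2 first.
    by move=> t; apply: cvgM; [exact: cvg_cst|exact: cU].
    by move=> t; apply: cvgM; [exact: cvg_cst|exact: cdS].
  apply: Int_ext => t _; have := eqn _ (polar_disk t r01').
  move=> E; rewrite /dS /wx /wy /=.
  have -> : - (mu * r) * (u (polar r t) * c t) = - r * (mu * u (polar r t)) * c t by ring.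
  rewrite -E; set P := polar r t.
  have -> : - r * - (uxx P + uyy P) = r * (uxx P + uyy P) * (cos t ^+ 2 + sin t ^+ 2).
    by rewrite cos2Dsin2; ring.
  by field.
- move=> r /andP[r0 r1]; apply: coef_norm_le => //.
    by apply: polar_cont => //; apply/andP; split; lra.
  move=> t; apply: hM; rewrite polar_sqr; nra.
- move=> e e0; have p0 := pi_gt0 R; have e1 : 0 < e / (2 * pi) by rewrite divr_gt0// mulr_gt0.
  have [d d01 hd] := vanishing_boundary cu bd e1; exists d => // r /andP[dr r1].
  have d0 : 0 < d by case/andP: d01.
  have -> : e = e / (2 * pi) * (2 * pi) by rewrite divfK// gt_eqF// mulr_gt0.
  apply: coef_norm_le => //.
    by apply: polar_cont => //; apply/andP; split; lra.
  by move=> t; apply: hd; rewrite dr.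
Qed.
End FourierCoefficients.

(** * Completeness of the trigonometric system *)

Section FourierCompleteness.
Variable R : realType.
Implicit Types (h : R -> R) (t e d a x y u v : R) (n : nat) (k m : int).

(** Cosines for k >= 0 and sines for k < 0. As [Negz n] is - (n + 1), the frequency is |k| in both
    cases, and each k in Z stands for exactly one mode. *)
Definition ang k t : R :=
  match k with Posz n => cos (n%:R * t) | Negz n => sin (n.+1%:R * t) end.

Definition dang k t : R :=
  match k with
  | Posz n => - (n%:R * sin (n%:R * t)) | Negz n => n.+1%:R * cos (n.+1%:R * t)
  end.

Lemma cos_nat2pi n : cos (n%:R * (2 * pi)) = 1 :> R.
Proof.
elim: n => [|n IH]; first by rewrite mul0r cos0.
have -> : n.+1%:R * (2 * pi) = n%:R * (2 * pi) + pi *+ 2 :> R.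
  by rewrite -[n.+1%:R]natr1 mulr2n; ring.
by rewrite cosD2pi.
Qed.

Lemma sin_nat2pi n : sin (n%:R * (2 * pi)) = 0 :> R.
Proof.
elim: n => [|n IH]; first by rewrite mul0r sin0.
have -> : n.+1%:R * (2 * pi) = n%:R * (2 * pi) + pi *+ 2 :> R.
  by rewrite -[n.+1%:R]natr1 mulr2n; ring.
by rewrite sinD2pi.
Qed.

Lemma angular_ang k : angular `|k|%N (ang k) (dang k).
Proof.
case: k => n /=; split.
- by move=> t; rewrite /ang /dang; deq; ring.
- by move=> t; rewrite /ang /dang; deq; ring.
- by rewrite /ang /dang cos_nat2pi ?mulr0 cos0 ?mulr1.
- by rewrite /ang /dang sin_nat2pi !mulr0 sin0 ?mulr0.
- by move=> t; exact: cos_max.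
- by move=> t; rewrite /ang /dang; deq; ring.
- by move=> t; rewrite /ang /dang; deq; ring.
- by rewrite /ang /dang sin_nat2pi !mulr0 sin0 ?mulr0.
- by rewrite /ang /dang cos_nat2pi ?mulr0 cos0 ?mulr1.
- by move=> t; exact: sin_max.
Qed.

Lemma ang_cont k : continuous (ang k).
Proof. by have [h _ _ _ _] := angular_ang k; move=> t; exact: der_cont (h t). Qed.

Let orth h := forall k, Int 0 (2 * pi) (fun t => h t * ang k t) = 0.

Let ctrig h N t0 b m a : continuous h ->
  continuous (fun t => h t * (1 + cos (t - t0) - b) ^+ N * cos (m%:~R * t + a)).
Proof.
move=> ch t.
have k1 : {for t, continuous (fun t => (1 + cos (t - t0) - b) ^+ N)} by dcont.
have k2 : {for t, continuous (fun t => cos (m%:~R * t + a))} by dcont.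
by apply: cvgM; [apply: cvgM; [exact: ch|exact: k1]|exact: k2].
Qed.

(** Powers of the kernel are trigonometric polynomials. The product formula for cosines trades a
    factor cos (t - t0) for the shifts m + 1 and m - 1 of the frequency, so the induction on N needs
    all m in Z and all phases a. *)
Lemma orth_kernel h N t0 b : continuous h -> orth h -> forall m a,
  Int 0 (2 * pi) (fun t => h t * (1 + cos (t - t0) - b) ^+ N * cos (m%:~R * t + a)) = 0.
Proof.
move=> ch oh; elim: N => [|N IH] m a.
  have cc k : continuous (fun t => h t * ang k t).
    by move=> t; apply: cvgM; [exact: ch|exact: ang_cont].
  have H (f g : R -> R) x y : continuous f -> continuous g ->
      Int 0 (2 * pi) f = 0 -> Int 0 (2 * pi) g = 0 ->
      Int 0 (2 * pi) (fun t => x * f t + y * g t) = 0.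
    move=> cf cg f0 g0; rewrite IntD ?IntZ//; first by rewrite f0 g0 !mulr0 addr0.
      by move=> t; apply: cvgM; [exact: cvg_cst|exact: cf].
    by move=> t; apply: cvgM; [exact: cvg_cst|exact: cg].
  case: m => n.
    (* For n = 0 the index [Negz n.-1] would mean sin t instead of 0; the factor (n != 0) removes
       that term. *)
    apply: etrans (H _ _ (cos a) (- sin a * (n != 0%N)%:R) (cc (Posz n))
      (cc (Negz n.-1)) (oh _) (oh _)).
    apply: Int_ext => t _; rewrite expr0 mulr1 cosD /=.
    case: n => [|n] /=; first by rewrite !mul0r cos0 sin0; ring.
    by rewrite -[n.+1%:~R]/(n.+1%:R) mulr1; ring.
  apply: etrans (H _ _ (cos a) (sin a) (cc (Posz n.+1)) (cc (Negz n)) (oh _) (oh _)).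
  apply: Int_ext => t _; rewrite expr0 mulr1 NegzE mulrNz mulNr addrC -cosN.
  by rewrite opprD opprK cosD cosN sinN /=; ring.
have c1 := @ctrig h N t0 b m a ch.
have c2 := @ctrig h N t0 b (m + 1) (a - t0) ch.
have c3 := @ctrig h N t0 b (m - 1) (a + t0) ch.
rewrite (@Int_ext _ _ _ _ (fun t =>
   (1 - b) * (h t * (1 + cos (t - t0) - b) ^+ N * cos (m%:~R * t + a)) +
   (1 / 2 * (h t * (1 + cos (t - t0) - b) ^+ N * cos ((m + 1)%:~R * t + (a - t0))) +
    1 / 2 * (h t * (1 + cos (t - t0) - b) ^+ N * cos ((m - 1)%:~R * t + (a + t0)))))).
  rewrite IntD; last 2 first.
  - by move=> t; apply: cvgM; [exact: cvg_cst|exact: c1].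
  - by move=> t; apply: cvgD; apply: cvgM; by [exact: cvg_cst|exact: c2|exact: c3].
  rewrite IntD; last 2 first.
  - by move=> t; apply: cvgM; [exact: cvg_cst|exact: c2].
  - by move=> t; apply: cvgM; [exact: cvg_cst|exact: c3].
  by rewrite !IntZ// !IH !mulr0 !addr0.
move=> t _; rewrite exprSr.
have -> : (m + 1)%:~R * t + (a - t0) = (m%:~R * t + a) + (t - t0).
  by rewrite rmorphD /=; ring.
have -> : (m - 1)%:~R * t + (a + t0) = (m%:~R * t + a) - (t - t0).
  by rewrite rmorphB /=; ring.
by rewrite [cos (_ + (t - t0))]cosD [cos (_ - (t - t0))]cosB; field.
Qed.

Lemma cos_le_far d s : 0 < d <= pi -> d <= s <= 2 * pi - d -> cos s <= cos d :> R.
Proof.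
move=> /andP[d0 dp] /andP[ds sd]; have mono x : d <= x <= pi -> cos x <= cos d.
  move=> /andP[dx xp]; rewrite leNgt ltr_cos ?in_itv/= -?leNgt//.
    by apply/andP; split; lra.
  by apply/andP; split; lra.
have [sp|sp] := leP s pi; first by apply: mono; rewrite ds.
have -> : cos s = cos (2 * pi - s) :> R.
  by rewrite mulr_natl addrC cosD2pi cosN.
by apply: mono; apply/andP; split; lra.
Qed.

Lemma cos_norm (x : R) : cos `|x| = cos x.
Proof. by have [h|h] := leP 0 x; rewrite ?(ger0_norm h) ?(ltr0_norm h) ?cosN. Qed.

Lemma bernoulli (x : R) N : 0 <= x -> 1 + N%:R * x <= (1 + x) ^+ N.
Proof.
move=> x0; elim: N => [|N IH]; first by rewrite mul0r addr0.
rewrite exprS -[N.+1%:R]natr1; have : 0 <= N%:R * x ^+ 2 by rewrite mulr_ge0 ?sqr_ge0.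
nra.
Qed.

Lemma Int_ge_peak (F : R -> R) x y u v (M L : R) : x <= u -> u <= v -> v <= y ->
  continuous F -> 0 <= M -> (forall t, x <= t <= y -> - M <= F t) ->
  (forall t, u <= t <= v -> L <= F t) ->
  L * (v - u) - M * (y - x) <= Int x y F.
Proof.
move=> xu uv vy cF M0 hM hL; have ccst (z : R) : continuous (cst z : R -> R).
  by move=> t; exact: cvg_cst.
have i1 : - M * (u - x) <= Int x u F.
  rewrite -Int_cst//; apply: Int_le => // t /andP[h1 h2]; apply: hM.
  by rewrite h1 (le_trans h2)// (le_trans uv).
have i2 : L * (v - u) <= Int u v F by rewrite -Int_cst//; exact: Int_le.
have i3 : - M * (y - v) <= Int v y F.
  rewrite -Int_cst//; apply: Int_le => // t /andP[h1 h2]; apply: hM.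
  by rewrite h2 andbT (le_trans xu)// (le_trans uv).
have uy := le_trans uv vy.
rewrite (Int_cat xu uy cF) (Int_cat uv vy cF).
have : 0 <= M * (v - u) by rewrite mulr_ge0// subr_ge0.
lra.
Qed.

(* Rudin's peaking kernel (1 + cos (t - t0) - cos d)^N. *)
Let orth_le0 h t0 : continuous h -> orth h -> 0 < t0 < 2 * pi -> h t0 <= 0.
Proof.
move=> ch oh /andP[t00 t01]; have p0 := pi_gt0 R; rewrite leNgt; apply/negP => c0.
have p2 := @twopi_ge0 R.
have [c _ hM] : exists2 c, c \in `[0, 2 * pi] &
    forall t, t \in `[0, 2 * pi] -> `|h t| <= `|h c|.
  apply: (@EVT_max _ (fun t => `|h t|)) => //; apply: continuous_subspaceT => t.
  by apply: continuous_comp; [exact: ch|exact: norm_continuous].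
set M : R := `|h c| in hM; have M0 : 0 <= M by exact: normr_ge0.
have c2 : 0 < h t0 / 2 by lra.
have /cvgrPdist_le/(_ _ c2) := ch t0; rewrite -nbhs_nearE => /nbhs_ballP[d1 /= d10 hd].
(* h stays above h t0 / 2 within d of t0. The bounds in terms of t0 keep that window inside
   [0, 2 pi] and keep |t - t0| <= 2 pi - d, so that the kernel is at most 1 in absolute value
   outside the window. *)
pose d := Num.min (d1 / 2) (Num.min (Num.min (t0 / 2) ((2 * pi - t0) / 2)) pi).
have d0 : 0 < d by rewrite !lt_min p0 !divr_gt0 ?subr_gt0.
have [ [dd1 dt0] [dt1 dp] ] : (d <= d1 / 2 /\ d <= t0 / 2) /\
    (d <= (2 * pi - t0) / 2 /\ d <= pi).
  by rewrite !ge_min !lexx !orbT.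
have hge t : `|t - t0| <= d -> h t0 / 2 <= h t.
  move=> ht; have : `|h t0 - h t| <= h t0 / 2.
    by apply: hd; rewrite /ball/= distrC (le_lt_trans ht)//; lra.
  by rewrite ler_norml => /andP[_]; lra.
have cd2 : cos d < cos (d / 2).
  by rewrite ltr_cos ?in_itv/=; [lra| |]; apply/andP; split; lra.
pose x := cos (d / 2) - cos d; have x0 : 0 < x by rewrite subr_gt0.
(* On the half window the kernel is at least 1 + x; by Bernoulli's inequality this N makes the peak
   outweigh the loss M 2 pi from elsewhere. *)
pose N := (Num.truncn (M * (2 * pi) / (h t0 / 2 * d) / x)).+1.
pose F t := h t * (1 + cos (t - t0) - cos d) ^+ N.
have cF : continuous F.
  move=> t; apply: cvgM; first exact: ch.
  suff : {for t, continuous (fun t => (1 + cos (t - t0) - cos d) ^+ N)} by [].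
  dcont.
have IF : Int 0 (2 * pi) F = 0.
  apply: etrans (@orth_kernel h N t0 (cos d) ch oh 0 0); apply: Int_ext => t _.
  by rewrite mul0r addr0 cos0 mulr1.
have cos_near (t s : R) : `|t - t0| <= s -> s <= d -> cos s <= cos (t - t0).
  move=> ts sd; rewrite -(cos_norm (t - t0)).
  rewrite leNgt ltr_cos ?in_itv/= -?leNgt ?normr_ge0//=.
    by apply/andP; split; have := normr_ge0 (t - t0); lra.
  by lra.
have outer t : 0 <= t <= 2 * pi -> - M <= F t.
  move=> tt; have [td|td] := leP `|t - t0| d.
    apply: (@le_trans _ _ 0); first by rewrite oppr_le0.
    apply: mulr_ge0; first by have := hge t td; lra.
    by apply: exprn_ge0; have := cos_near t d td (lexx _); lra.
  have : `|F t| <= M; last by rewrite ler_norml => /andP[].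
  rewrite normrM -[leRHS]mulr1 ler_pM//; first by apply: hM; rewrite in_itv.
  rewrite normrX exprn_ile1// ler_norml.
  have := cos_max d; rewrite ler_norml => /andP[k1 k2].
  have := cos_max (t - t0); rewrite ler_norml => /andP[k3 k4].
  have k5 : cos (t - t0) <= cos d.
    rewrite -(cos_norm (t - t0)); apply: cos_le_far; first by rewrite d0.
    rewrite ltW//= ler_norml; case/andP: tt => *; apply/andP; split; lra.
  by apply/andP; split; lra.
have inner t : t0 - d / 2 <= t <= t0 + d / 2 -> h t0 / 2 * (1 + x) ^+ N <= F t.
  move=> /andP[t1 t2]; have td : `|t - t0| <= d / 2 by rewrite ler_norml; apply/andP; split; lra.
  apply: ler_pM; [lra| |apply: hge; lra|].
    by apply: exprn_ge0; lra.
  apply: lerXn2r; rewrite ?nnegrE; [lra| |].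
    by have := cos_near t (d / 2) td; rewrite /x in x0; lra.
  by have := cos_near t (d / 2) td; rewrite /x; lra.
have h1 : 0 <= t0 - d / 2 by clear - dt0 t00 d0; lra.
have h2 : t0 - d / 2 <= t0 + d / 2 by clear - d0; lra.
have h3 : t0 + d / 2 <= 2 * pi by clear - dt1 d0; lra.
have := Int_ge_peak h1 h2 h3 cF M0 outer inner; rewrite IF {h1 h2 h3}.
rewrite subr0 [t0 + d / 2 - _](_ : _ = d); last by field.
have b2 : M * (2 * pi) / (h t0 / 2 * d) / x < N%:R by exact: truncnS_gt.
have hd0 : 0 < h t0 / 2 * d by rewrite mulr_gt0.
rewrite subr_le0 leNgt => /negP; apply.
rewrite [ltRHS]mulrAC [ltRHS]mulrC.
rewrite -ltr_pdivrMr//; apply: lt_le_trans (bernoulli N (ltW x0)).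
by rewrite ltr_pdivrMr// in b2; apply: lt_le_trans b2 _; rewrite lerDr.
Qed.

(** [orth_le0] for h and for - h settles the open interval; the end points follow by continuity. *)
Lemma fourier_complete h : continuous h ->
  (forall k, Int 0 (2 * pi) (fun t => h t * ang k t) = 0) ->
  forall t, 0 <= t <= 2 * pi -> h t = 0.
Proof.
move=> ch oh t0 /andP[t00 t01]; have p0 := pi_gt0 R.
have in_ t : 0 < t < 2 * pi -> h t = 0.
  move=> tt; apply/eqP; rewrite eq_le orth_le0//= -oppr_le0.
  apply: (@orth_le0 (fun t => - h t)) => // [s|k]; first by apply: cvgN; exact: ch.
  rewrite (@Int_ext _ _ _ _ (fun t => - (h t * ang k t))); last by move=> s _; rewrite mulNr.
  rewrite IntN ?oh ?oppr0// => s; apply: cvgM; [exact: ch|exact: ang_cont].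
apply/eqP; rewrite -normr_le0; apply/ler_addgt0Pr => e e0; rewrite add0r.
have /cvgrPdist_le/(_ _ e0) := ch t0; rewrite -nbhs_nearE => /nbhs_ballP[d /= d0 hd].
pose s := Num.min (d / 2) (pi / 2).
have s0 : 0 < s by rewrite lt_min !divr_gt0.
have [sd sp] : s <= d / 2 /\ s <= pi / 2 by rewrite !ge_min !lexx !orbT.
have [h1|h1] := leP t0 pi.
  have := hd (t0 + s); rewrite (in_ (t0 + s)) ?subr0; last by apply/andP; split; lra.
  by apply; rewrite /ball/= opprD addrA subrr sub0r normrN gtr0_norm//; lra.
have := hd (t0 - s); rewrite (in_ (t0 - s)) ?subr0; last by apply/andP; split; lra.
by apply; rewrite /ball/= opprB addrCA subrr addr0 gtr0_norm//; lra.
Qed.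
End FourierCompleteness.

(** * Multiplicities and lattice points *)

Section Multiplicity.
Variable R : realType.
Implicit Types (u : R * R -> R) (mu nu r t : R) (k : int) (n : nat).

Lemma cont_sum (T : topologicalType) (I : Type) (s : seq I) (F : I -> T -> R) p :
  (forall i, {for p, continuous (F i)}) ->
  {for p, continuous (fun x => \sum_(i <- s) F i x)}.
Proof.
move=> cF; elim: s => [|i s IH].
  by have -> : (fun x => \sum_(i <- [::]) F i x) = cst 0
    by [apply/funext => x; rewrite big_nil]; exact: cvg_cst.
have -> : (fun x => \sum_(j <- i :: s) F j x) = (fun x => F i x + \sum_(j <- s) F j x).
  by apply/funext => x; rewrite big_cons.
by apply: cvgD; [exact: cF|exact: IH].
Qed.

Lemma Int_sum (a b : R) (I : Type) (s : seq I) (F : I -> R -> R) :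
  a <= b -> (forall i, continuous (F i)) ->
  Int a b (fun x => \sum_(i <- s) F i x) = \sum_(i <- s) Int a b (F i).
Proof.
move=> ab cF; elim: s => [|i s IH].
  rewrite big_nil (@Int_ext _ _ _ _ (cst 0)) ?Int_cst ?mul0r// => x _.
  by rewrite big_nil.
rewrite big_cons -IH -IntD//; last by move=> x; apply: cont_sum => j; exact: cF.
by apply: Int_ext => x _; rewrite big_cons.
Qed.

(** Completeness on every circle of radius in (0, 1); the centre is reached by continuity. *)
Lemma disk_vanish (m : nat) (u : 'I_m -> R * R -> R) (b : 'I_m -> R) :
  (forall i p, open_disk p -> {for p, continuous (u i)}) ->
  (forall k r, 0 < r < 1 -> \sum_(i < m) b i * coef (u i) (ang k) r = 0) ->
  forall p, open_disk p -> \sum_(i < m) b i * u i p = 0.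
Proof.
move=> cu hb.
pose S p := \sum_(i < m) b i * u i p.
have cS p : open_disk p -> {for p, continuous S}.
  move=> hp; apply: cont_sum => i; apply: cvgM; first exact: cvg_cst.
  exact: cu.
have pos r t : 0 < r < 1 -> 0 <= t <= 2 * pi -> S (polar r t) = 0.
  move=> r01; have r01' : 0 <= r < 1 by case/andP: r01 => *; apply/andP; split; lra.
  apply: (fourier_complete (polar_cont cS r01')) => k; rewrite -[RHS](hb k r r01).
  have ci i : continuous (fun t => u i (polar r t) * ang k t).
    by move=> s; apply: cvgM; [exact: polar_cont (cu i) r01' s|exact: ang_cont].
  rewrite (@Int_ext _ _ _ _ (fun t => \sum_(i < m) b i * (u i (polar r t) * ang k t))).
    rewrite Int_sum ?twopi_ge0//; first by apply: eq_bigr => i _; rewrite IntZ.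
    by move=> i s; apply: cvgM; [exact: cvg_cst|exact: ci].
  by move=> s _; rewrite mulr_suml; apply: eq_bigr => i _; rewrite mulrA.
move=> p hp; rewrite -/(S p); have [r [t [r0 tt E]]] := polar_surj p.
have r1 : r < 1.
  move: hp; rewrite E /open_disk/=; have := polar_sqr r t; rewrite /= => ->.
  by move=> h; rewrite -(@expr_lt1 _ 2).
rewrite E; move: r0; rewrite le_eqVlt => /predU1P[r0|r0]; last first.
  by apply: pos => //; rewrite r0.
have E0 s : polar r t = polar 0 s by rewrite -r0 /polar !mul0r.
apply/eqP; rewrite -normr_le0; apply/ler_addgt0Pr => e e0; rewrite add0r.
have h0 : open_disk (polar r t) by rewrite -E.
have /cvgrPdist_le/(_ _ e0) := cS _ h0.
move=> /near_ball2[d d0 hd]; pose s := Num.min (d / 2) (1 / 2).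
have s0 : 0 < s by rewrite lt_min !divr_gt0.
have [sd s1] : s <= d / 2 /\ s <= 1 / 2 by rewrite !ge_min !lexx !orbT.
have := hd (polar s 0).1 (polar s 0).2.
rewrite -r0 /polar !mul0r /= cos0 sin0 mulr1 mulr0 !subr0 normr0 gtr0_norm//.
have -> : S (s, 0) = 0.
  have := pos s 0; rewrite /polar cos0 sin0 mulr1 mulr0; apply.
    by apply/andP; split; lra.
  by rewrite lexx/= twopi_ge0.
by rewrite subr0; apply; lra.
Qed.

Lemma mult_nonpos mu (m : nat) (u : 'I_m -> R * R -> R) : mu <= 0 ->
  (forall i, dirichlet_eigenspace mu (u i)) -> lin_indep_on_disk u -> m = 0%N.
Proof.
move=> mu0 hu li; case: m u hu li => // m u hu li.
suff H : forall p, open_disk p -> \sum_(i < m.+1) 1 * u i p = 0.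
  by have /eqP := li (fun=> 1) H ord0; rewrite oner_eq0.
apply: disk_vanish => [i p|k r r01]; first by have [_ []] := hu i; move=> h _ _ _; exact: h.
rewrite big1// => i _; have [K [A rad]] := radial_coef (hu i) (angular_ang R k).
by rewrite (radial_nonpos mu0 rad r01) mulr0.
Qed.

(** Only modes in ks have nonzero coefficients, and each of these is a multiple of a fixed function
    of r, hence determined by its value at one radius r0. More than [size ks] functions therefore
    admit a nontrivial combination with all coefficients 0. *)
Lemma mult_le nu (m : nat) (u : 'I_m -> R * R -> R) (ks : seq int) : 0 < nu ->
  (forall i, dirichlet_eigenspace (nu ^+ 2) (u i)) -> lin_indep_on_disk u ->
  (forall k, PJ `|k|%N nu = 0 -> k \in ks) -> (m <= size ks)%N.
Proof.
move=> nu0 hu li hks; rewrite leqNgt; apply/negP => lt.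
have rad k i := radial_coef (hu i) (angular_ang R k).
have bes k : exists l : 'I_m -> R, forall i r, 0 < r < 1 ->
    coef (u i) (ang k) r = l i * fJ `|k|%N (nu * r).
  apply: (@fin_all_exists _ _ (fun i l => forall r, 0 < r < 1 ->
    coef (u i) (ang k) r = l * fJ `|k|%N (nu * r))) => i.
  by have [K [A h]] := rad k i; exact: radial_bessel nu0 h.
(* nu r0 <= 1 < pi / 2, so that no Bessel function vanishes at nu r0. *)
pose r0 : R := Num.min (1 / 2) nu^-1.
have r00 : 0 < r0 by rewrite lt_min divr_gt0 ?invr_gt0.
have r01 : 0 < r0 < 1 by rewrite r00 /= /r0 gt_min; apply/orP; left; lra.
have nr0 : nu * r0 <= 1 by rewrite -ler_pdivlMl// mulr1 ge_min lexx orbT.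
have f0 n : fJ n (nu * r0) != 0.
  have p2 := pihalf_gt1 R; have nr : 0 < nu * r0 by rewrite mulr_gt0.
  by rewrite gt_eqF// mulr_gt0 ?exprn_gt0// PJ_gt0// (ltW nr)/=; lra.
(* With more rows than columns, M has a nonzero row vector in its left kernel; a row of [kermx M]
   serves as the combination. *)
pose M : 'M[R]_(m, size ks) := \matrix_(i, j) coef (u i) (ang (nth 0 ks j)) r0.
have kn0 : kermx M != 0.
  rewrite -mxrank_eq0 mxrank_ker -lt0n subn_gt0.
  by apply: leq_ltn_trans (rank_leq_col M) lt.
have [i0 [j0 bij]] := matrix0Pn _ kn0.
pose b j : R := kermx M i0 j.
suff H : forall p, open_disk p -> \sum_(i < m) b i * u i p = 0.
  by move: bij; rewrite -/(b j0) (li b H) eqxx.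
apply: disk_vanish => [i p|k r r01'].
  by have [_ []] := hu i; move=> h _ _ _; exact: h.
have [hk|hk] := eqVneq (PJ `|k|%N nu) 0; last first.
  rewrite big1// => i _; have [K [A h]] := rad k i.
  by rewrite (radial_zero_bd nu0 h hk r01') mulr0.
have [l hl] := bes k.
have kk := hks k hk; have lk : (index k ks < size ks)%N by rewrite index_mem.
have E : \sum_(i < m) b i * l i = 0.
  apply: (mulIf (f0 `|k|%N)); rewrite mul0r mulr_suml.
  have := congr1 (fun B : 'M[R]_(m, size ks) => B i0 (Ordinal lk)) (mulmx_ker M).
  rewrite !mxE => h; rewrite -[RHS]h; apply: eq_bigr => i _.
  by rewrite [M _ _]mxE /= nth_index// hl// -[LHS]mulrA.
under eq_bigr do rewrite hl// mulrA.
by rewrite -mulr_suml E mul0r.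
Qed.
End Multiplicity.

(** * From Bessel zeros to lattice points *)

Section Counting.
Variable R : realType.
Implicit Types (mu nu lambda : R) (k : int) (n m i B : nat) (X : seq R).

Definition lattice lambda : set (int * int) :=
  [set nk | dilate lambda (@domD R) (nk.1%:~R, nk.2%:~R - 4^-1)].

Lemma phiJ_scale lambda n : n%:R < lambda -> phiJ n lambda / lambda =
  Num.sqrt (1 - (n%:R / lambda) ^+ 2) - n%:R / lambda * acos (n%:R / lambda).
Proof.
move=> nl; have l0 : 0 < lambda by apply: le_lt_trans nl.
have h0 := sqr_gap_gt0 nl.
have -> : 1 - (n%:R / lambda) ^+ 2 = (lambda ^+ 2 - n%:R ^+ 2) / lambda ^+ 2.
  by field; rewrite gt_eqF.
rewrite sqrtrM ?ltW// sqrtrV ?sqr_ge0// sqrtr_sqr gtr0_norm// /phiJ mulrBl.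
by congr (_ - _); rewrite mulrAC.
Qed.

Lemma scale_pair lambda (x y : R) : lambda *: (x, y) = (lambda * x, lambda * y).
Proof. by []. Qed.

Lemma lattice_pos lambda n m : n%:R < lambda -> (0 < m)%N ->
  pi * (m%:R - 1 / 4) <= phiJ n lambda -> lattice lambda (n%:Z, m%:Z).
Proof.
move=> nl m0 hphi; have l0 : 0 < lambda by apply: le_lt_trans nl.
have p0 := pi_gt0 R; have m1 : 1 <= m%:R :> R by rewrite ler1n.
have n0 : 0 <= n%:R / lambda by rewrite divr_ge0// ltW.
have n1 : n%:R / lambda < 1 by rewrite ltr_pdivrMr// mul1r.
exists (n%:R / lambda, (m%:R - 4^-1) / lambda); last first.
  by rewrite scale_pair /=; congr pair; rewrite mulrC divfK// gt_eqF.
rewrite /domD/=; split; first by apply/andP; split; lra.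
apply/andP; split.
  have q0 : 0 <= (m%:R - 4^-1) / lambda by apply: divr_ge0; lra.
  by rewrite ge_max; apply/andP; split; lra.
rewrite -phiJ_scale// mulrA ler_pM2r ?invr_gt0// mulrC ler_pdivlMr// mulrC.
by move: hphi; rewrite mul1r.
Qed.

(** Since acos (- x) = pi - acos x, both the lower and the upper boundary of [domD] at - n / lambda
    exceed those at n / lambda by n / lambda, that is by n after dilation. *)
Lemma lattice_neg lambda n m : n%:R < lambda -> (0 < m)%N ->
  pi * (m%:R - 1 / 4) <= phiJ n lambda -> lattice lambda (- n%:Z, (m + n)%:Z).
Proof.
move=> nl m0 hphi; have l0 : 0 < lambda by apply: le_lt_trans nl.
have p0 := pi_gt0 R; have m1 : 1 <= m%:R :> R by rewrite ler1n.
have n0 : 0 <= n%:R / lambda by rewrite divr_ge0// ltW.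
have n1 : n%:R / lambda < 1 by rewrite ltr_pdivrMr// mul1r.
exists (- (n%:R / lambda), ((m + n)%:R - 4^-1) / lambda); last first.
  rewrite scale_pair /=; congr pair.
    by rewrite mulrN mulrC divfK ?gt_eqF// mulrNz.
  by rewrite mulrC divfK// gt_eqF.
have mn : ((m + n)%:R - 4^-1) / lambda = (m%:R - 4^-1) / lambda + n%:R / lambda.
  by rewrite natrD; field; rewrite gt_eqF.
have q0 : 0 <= (m%:R - 4^-1) / lambda by apply: divr_ge0; lra.
rewrite /domD/=; split; first by apply/andP; split; lra.
rewrite mn opprK; apply/andP; split; first by rewrite ge_max; apply/andP; split; lra.
have q2 : -1 <= n%:R / lambda <= 1 by apply/andP; split; lra.
rewrite acosN// sqrrN mulNr opprK mulrBr.
have := phiJ_scale nl; move: (Num.sqrt _) (acos _) => s a E.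
rewrite [_ + (_ - _)](_ : _ = phiJ n lambda / lambda + n%:R / lambda * pi); last first.
  by rewrite E; ring.
rewrite mulrDr [pi^-1 * (_ * pi)]mulrCA mulVf ?gt_eqF// mulr1 lerD2r.
rewrite mulrA ler_pM2r ?invr_gt0// mulrC ler_pdivlMr// mulrC.
by move: hphi; rewrite mul1r.
Qed.

Definition ints B : seq int :=
  [seq n%:Z | n <- iota 0 B] ++ [seq Negz n | n <- iota 0 B].

Lemma ints_uniq B : uniq (ints B).
Proof.
rewrite cat_uniq !map_inj_uniq ?iota_uniq//=; last by move=> ? ? [].
  by rewrite andbT; apply/hasPn => k /mapP[n _ ->]; apply/mapP => -[].
by move=> ? ? [].
Qed.

Lemma mem_ints B k : (`|k| < B)%N -> k \in ints B.
Proof.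
rewrite mem_cat => h; apply/orP; case: k h => n /= h; [left|right]; apply/mapP.
  by exists n; rewrite // mem_iota.
by exists n; rewrite // mem_iota /= (ltn_trans _ h).
Qed.

Definition bessel_zero k mu : bool := PJ `|k|%N (Num.sqrt mu) == 0.

(** For each mode k, one point per eigenvalue in X that admits k, numbered from 1. For k < 0 the
    ordinates are shifted by |k| = n + 1, as in [lattice_neg]. *)
Definition points X B : seq (int * int) :=
  [seq (k, (i + 1 + (if k is Negz n then n.+1 else 0))%:Z) | k <- ints B,
     i <- iota 0 (count (bessel_zero k) X)].

(** Double counting of the pairs (k, mu) with J_|k| (sqrt mu) = 0: by modes on the left, by
    eigenvalues on the right. *)
Lemma size_points X B : size (points X B) =
  (\sum_(mu <- X) size [seq k <- ints B | bessel_zero k mu])%N.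
Proof.
rewrite /points size_allpairs_dep sumnE big_map.
under eq_bigr do rewrite size_iota -sum1_count big_mkcond/=.
rewrite exchange_big/=; apply: eq_bigr => mu _.
by rewrite size_filter -sum1_count [RHS]big_mkcond.
Qed.

Lemma points_uniq X B : uniq (points X B).
Proof.
apply: allpairs_uniq_dep; first exact: ints_uniq.
  by move=> k _; exact: iota_uniq.
move=> [k i] [k' i'] /= _ _ [<-] /eqP; rewrite !eqn_add2r => /eqP[->] //.
Qed.

(** For fixed k the square roots of the relevant eigenvalues, sorted, form a list of zeros bounded
    by lambda; [PJ_zeros_phase] bounds its whole length, hence every index i + 1 up to it. *)
Lemma points_lattice X B lambda : uniq X -> (forall mu, mu \in X -> 0 < mu) ->
  (forall mu, mu \in X -> Num.sqrt mu <= lambda) ->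
  forall nk, nk \in points X B -> lattice lambda nk.
Proof.
move=> uX X0 Xl nk /allpairsPdep[k [i [kB]]]; rewrite mem_iota add0n => /= ic ->.
pose s := sort <=%R [seq Num.sqrt mu | mu <- X & bessel_zero k mu].
have us : uniq [seq Num.sqrt mu | mu <- X & bessel_zero k mu].
  rewrite map_inj_in_uniq ?filter_uniq// => x y.
  rewrite !mem_filter => /andP[_ /X0 x0] /andP[_ /X0 y0] E.
  by rewrite -(sqr_sqrtr (ltW x0)) E sqr_sqrtr// ltW.
have ss : sorted <%R s by rewrite sort_lt_sorted.
have hs z : z \in s -> [/\ 0 < z, PJ `|k|%N z = 0 & z <= lambda].
  rewrite mem_sort => /mapP[mu]; rewrite mem_filter => /andP[/eqP h1 h2] ->.
  by split; rewrite ?sqrtr_gt0 ?X0 ?Xl.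
have sz : size s = count (bessel_zero k) X by rewrite size_sort size_map size_filter.
have s0 : (0 < size s)%N by rewrite sz; exact: leq_trans ic.
have sl : last 0 s <= lambda.
  have : last 0 s \in s by case: (s) s0 => //= z s' _; exact: mem_last.
  by case/hs.
have hz : zeros `|k|%N s by move=> z /hs[].
have [nl hphi] := PJ_zeros_phase ss hz s0 sl.
have hphi' : pi * ((i + 1)%:R - 1 / 4) <= phiJ `|k|%N lambda.
  apply: le_trans hphi; rewrite ler_pM2l ?pi_gt0// lerD2r ler_nat addn1 sz//.
case: k nl hphi' {kB ic s us ss hs sz s0 sl hz hphi} => n /= nl hphi.
  by rewrite addn0; apply: lattice_pos => //; rewrite addn1.
by rewrite NegzE; apply: lattice_neg => //; rewrite addn1.
Qed.

(** A mode with J_|k| (sqrt mu) = 0 satisfies |k| < sqrt mu <= lambda < B by [PJ_neq0_le], so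
    [ints B] contains all relevant modes. *)
Lemma multiplicity_le mu lambda B : 0 < mu -> Num.sqrt mu <= lambda -> lambda < B%:R ->
  (multiplicity mu <= (size [seq k <- ints B | bessel_zero k mu])%:R%:E)%E.
Proof.
move=> mu0 ml lB; apply: ub_ereal_sup => _ [m [u hu li] <-].
have nu0 : 0 < Num.sqrt mu by rewrite sqrtr_gt0.
rewrite lee_fin ler_nat; apply: (mult_le nu0 _ li).
  by move=> i; rewrite sqr_sqrtr// ltW.
move=> k hk; rewrite mem_filter /bessel_zero hk eqxx /=; apply: mem_ints.
rewrite -(ltr_nat R); apply: lt_trans (lt_le_trans _ ml) lB.
rewrite ltNge; apply/negP => h.
by have := @PJ_neq0_le R `|k|%N (Num.sqrt mu); rewrite nu0 h hk eqxx => /(_ isT).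
Qed.

(** A single eigenfunction that is nonzero on the disk is an independent family of length 1, which
    [mult_nonpos] excludes for mu <= 0. *)
Lemma eigenvalue_gt0 mu : dirichlet_eigenvalue mu -> 0 < mu.
Proof.
move=> [u hu [p hp up]]; rewrite ltNge; apply/negP => mu0.
have : 1%N = 0%N; last by [].
apply: (@mult_nonpos R mu 1 (fun=> u) mu0) => //.
move=> c hc i; have := hc p hp; rewrite big_ord1 (ord1 i) => /eqP.
by rewrite mulf_eq0 (negbTE up) orbF => /eqP.
Qed.
End Counting.

Local Open Scope ereal_scope.

Theorem corollary2p24 (R : realType) (lambda : R) (hlambda : (0 < lambda)%R) :
  N_disk lambda <= N_D lambda.
Proof.
rewrite /N_disk /N_D /counting -/(lattice lambda).
(* [counting] is +oo on an infinite set, where the bound is immediate. *)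
case: ifPn => [/asboolP fin|_]; last exact: leey.
(* The sum over eigenvalues is a supremum of sums over finite sets A, so it suffices to bound each
   of these by the cardinality of the lattice set. *)
apply: ub_ereal_sup => _ [A [finA AD] <-].
rewrite fsbig_finite//; set X := finmap.enum_fset (fset_set A).
have hX mu : mu \in X -> dirichlet_eigenvalue mu /\ (mu <= lambda ^+ 2)%R.
  by rewrite in_fset_set// inE => /AD.
have X0 mu : mu \in X -> (0 < mu)%R by move=> /hX[/eigenvalue_gt0].
have Xl mu : mu \in X -> (Num.sqrt mu <= lambda)%R.
  move=> h; rewrite -[leRHS]gtr0_norm// -sqrtr_sqr ler_sqrt ?sqr_ge0//.
  by case/hX: h.
pose B := (Num.truncn lambda).+1.
have lB : (lambda < B%:R)%R by exact: truncnS_gt.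
apply: (@le_trans _ _ (\sum_(mu <- X)
    (size [seq k <- ints B | bessel_zero k mu])%:R%:E)).
  rewrite !big_seq; apply: lee_sum => mu h; apply: multiplicity_le (Xl _ h) lB.
  exact: X0.
rewrite sumEFin lee_fin -natr_sum -size_points ler_nat.
apply: uniq_leq_size; first exact: points_uniq.
move=> nk h; rewrite in_fset_set// inE.
by apply: points_lattice h => //; exact: finmap.fset_uniq.
Qed.
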